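(* Let $s,v\in\{\mathsf L,\mathsf N\}$, $r>0$ and $z>0$. Under the first-order correlation model, conditioned on the serving BS being of type $s$ at distance $X_0=r$ from the user, the Laplace transform of the interference $I_v$ caused by the $v$-type interferers in the 2D network is $$\mathcal L_{I_v|X_0=r,E_s}(z)=\exp\Big(-\frac{\lambda}{p_s(r)}\int_{e_{v|s}(r)}^\infty\frac{z\,\ell_v(t)}{1+z\,\ell_v(t)}\Big(\int_0^{2\pi}p_{s,v}(r,t,\theta)\,d\theta\Big)\,t\,dt\Big).$$
   Context: 2D network. Base stations (BSs) form a homogeneous Poisson point process (PPP) of density $\lambda>0$ on $\mathbb R^2$; the typical user is at the origin. Blockages form an independent Boolean model of line segments: centers form a homogeneous PPP of density $\mu>0$, with i.i.d. random lengths $L$ ($0<\mathbb E[L]<\infty$) and independent orientations uniform on $[0,\pi]$; $\beta=2\mu\mathbb E[L]/\pi$. A link is the segment from the origin to a BS; it is LoS (type $\mathsf L$) if no blockage intersects it and NLoS (type $\mathsf N$) otherwise. A link of length $r$ is LoS with probability $p_{\mathsf L}(r)=e^{-\beta r}$ and NLoS with probability $p_{\mathsf N}(r)=1-e^{-\beta r}$. For two links of lengths $r_1,r_2$ with directions differing by $\theta\in[0,2\pi]$, $p_{s,v}(r_1,r_2,\theta)$ is the probability that the first is of type $s$ and the second of type $v$; thus $p_{\mathsf L,\mathsf L}$ is the probability that no blockage intersects either link, $p_{\mathsf L,\mathsf N}=e^{-\beta r_1}-p_{\mathsf L,\mathsf L}$, $p_{\mathsf N,\mathsf L}=e^{-\beta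 r_2}-p_{\mathsf L,\mathsf L}$, $p_{\mathsf N,\mathsf N}=1-e^{-\beta r_1}-e^{-\beta r_2}+p_{\mathsf L,\mathsf L}$. Path loss: $\ell_{\mathsf L},\ell_{\mathsf N}:[0,\infty)\to[0,\infty)$ are bounded and nonincreasing with $\ell_{\mathsf L}\ge\ell_{\mathsf N}$. A BS of type $v$ at distance $t$ gives received power $H\ell_v(t)$, with fading $H$ i.i.d. exponential of mean $1$, independent of everything else. Exclusion radii: $e_{\mathsf L|\mathsf L}(x)=e_{\mathsf N|\mathsf N}(x)=x$, $e_{\mathsf N|\mathsf L}(x)=\min\{y\ge0:\ell_{\mathsf N}(y)\le\ell_{\mathsf L}(x)\}$, $e_{\mathsf L|\mathsf N}(x)=\min\{y\ge0:\ell_{\mathsf L}(y)\le\ell_{\mathsf N}(x)\}$ (min read as infimum, $\infty$ if the set is empty). A BS of type $s$ at distance $x$ is serving iff every other BS of type $v$ is at distance greater than $e_{v|s}(x)$, for $v\in\{\mathsf L,\mathsf N\}$. $E_s$ is the event that the serving BS is of type $s$, and $I_v$ is the sum of the received powers of all non-serving BSs of type $v$. First-order correlation model: given a BS at distance $r$ from the user, it is of type $s$ with probability $p_s(r)$; given that it is of type $s$, the other BSs form a PPP of density $\lambda$ and their types are mutually independent, a BS at distance $t$ whose direction makes angle $\theta$ with that of the given BS having type $v$ with probability $p_{s,v}(r,t,\theta)/p_s(r)$. Correlation between the types of two interfering BSs is thus ignored. Conditioning on $X_0=r$, $E_s$ means conditioning, in this model, on the given BS at distance $r$ being of type $s$ and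 serving. *)

(* Defs.v *)
From HB Require Import structures.
From mathcomp Require Export all_boot all_order all_algebra.
From mathcomp Require Export all_classical all_reals all_analysis.
Export Order.TTheory GRing.Theory Num.Theory.
Export numFieldNormedType.Exports.
Set Implicit Arguments.
Unset Strict Implicit.
Unset Printing Implicit Defensive.
Local Open Scope classical_set_scope.
Local Open Scope ring_scope.
Local Open Scope ereal_scope.

Inductive link_type := LoS | NLoS.

Section probability_notions.
Context {R : realType} {d : measure_display} {Omega : measurableType d}.

Definition area : set (R * R) -> \bar R :=
  (@lebesgue_measure R \x @lebesgue_measure R)%E.

(* The mass function is written out because poisson_pmf is constantly 1 at
   rate 0, whereas sets of measure zero must be counted here. *)
Definition poisson_mass (m : R) (k : nat) : R :=
  (expR (- m) * m ^+ k / k`!%:R)%R.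

Definition point_count (X : nat -> Omega -> R * R) (B : set (R * R)) (w : Omega)
    : \bar R :=
  \sum_(0 <= i <oo) (\1_B (X i w))%:E.

(* X enumerates the points of a homogeneous Poisson process; such a process has
   infinitely many points almost surely, so indexing by nat loses nothing.
   Q is only a set function so that a conditional probability can be used. *)
Definition homogeneous_PPP (Q : set Omega -> \bar R) (intensity : R)
    (X : nat -> Omega -> R * R) : Prop :=
  forall (n : nat) (B : 'I_n -> set (R * R)) (k : 'I_n -> nat),
    (forall j, measurable (B j)) -> (forall j, area (B j) < +oo) ->
    trivIset setT B ->
    Q [set w | forall j, point_count X (B j) w = (k j)%:R%:E] =
    (\prod_(j < n) poisson_mass (intensity * fine (area (B j))) (k j))%:E.

Definition cond_prob (P : probability Omega R) (A B : set Omega) : \bar R :=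
  P (B `&` A) / P A.

Definition cond_expectation (P : probability Omega R) (A : set Omega)
    (Y : Omega -> \bar R) : \bar R :=
  (\int[P]_(w in A) Y w) / P A.

Definition position_events (X : nat -> Omega -> R * R) : set (set Omega) :=
  [set A | exists i B, measurable B /\ A = X i @^-1` B].

Definition type_events (T : nat -> Omega -> link_type) : set (set Omega) :=
  [set A | exists i u, A = T i @^-1` [set u]].

End probability_notions.

Section blockage.
Context {R : realType}.

Definition length_mean (nuL : probability (measurableTypeR R) R) : \bar R :=
  \int[nuL]_l (l%:E).

Record length_law (nuL : probability (measurableTypeR R) R) : Prop := {
  length_ge0 : nuL `]-oo, 0%R[%classic = 0 ;
  length_mean_gt0 : 0 < length_mean nuL ;
  length_mean_fin : length_mean nuL < +oo
}.

Definition beta (mu : R) (nuL : probability (measurableTypeR R) R) : R :=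
  (2 * mu * fine (length_mean nuL) / pi)%R.

Definition p_single (b : R) (s : link_type) (r : R) : R :=
  match s with
  | LoS => expR (- (b * r))
  | NLoS => (1 - expR (- (b * r)))%R
  end.

Context {d : measure_display} {Omega : measurableType d}.

Record blockages := Blockages {
  center : nat -> Omega -> R * R ;
  len : nat -> Omega -> R ;
  orientation : nat -> Omega -> R
}.

Record boolean_model (P : probability Omega R) (mu : R)
    (nuL : probability (measurableTypeR R) R) (K : blockages) : Prop := {
  measurable_center : forall i, measurable_fun setT (center K i) ;
  measurable_len : forall i, measurable_fun setT (len K i) ;
  measurable_orientation : forall i, measurable_fun setT (orientation K i) ;
  center_PPP : homogeneous_PPP P mu (center K) ;
  (* the pairs (length, orientation) are i.i.d. with law nuL x U[0, pi], and
     independent of the centers *)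
  blockage_marks : forall (n : nat) (A : set Omega) (B C : 'I_n -> set R),
    <<s position_events (center K) >> A ->
    (forall j, measurable (B j)) -> (forall j, measurable (C j)) ->
    P (A `&` [set w | forall j : 'I_n,
                B j (len K j w) /\ C j (orientation K j w)]) =
    P A * \prod_(j < n) (nuL (B j) * uniform_prob (@pi_gt0 R) (C j))
}.

Definition blockage_segment (c : R * R) (l o : R) : set (R * R) :=
  [set y | exists2 a : R, (`|a| <= l / 2)%R &
           y = (c.1 + a * cos o, c.2 + a * sin o)%R].

Definition link (x : R * R) : set (R * R) :=
  [set y | exists2 a : R, (0 <= a <= 1)%R & y = (a * x.1, a * x.2)%R].

Definition unblocked (K : blockages) (x : R * R) (w : Omega) : Prop :=
  forall i, blockage_segment (center K i w) (len K i w) (orientation K i w)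
              `&` link x = set0.

Definition link_has_type (K : blockages) (s : link_type) (x : R * R)
    (w : Omega) : Prop :=
  match s with LoS => unblocked K x w | NLoS => ~ unblocked K x w end.

Definition polar (t a : R) : R * R := (t * cos a, t * sin a)%R.

(* The blockage model is isotropic: the first link is put on the first axis. *)
Definition p_joint (P : probability Omega R) (K : blockages) (s v : link_type)
    (r1 r2 theta : R) : R :=
  fine (P [set w | link_has_type K s (polar r1 0) w /\
                   link_has_type K v (polar r2 theta) w]).

End blockage.
Arguments blockages R {d} Omega.

Section path_loss.
Context {R : realType}.
Implicit Type ell : link_type -> R -> R.

Record path_loss ell : Prop := {
  path_loss_ge0 : forall s t, (0 <= t)%R -> (0 <= ell s t)%R ;
  path_loss_bounded : forall s,
    exists M : R, forall t, (0 <= t)%R -> (ell s t <= M)%R ;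
  path_loss_noninc : forall s t u,
    (0 <= t)%R -> (t <= u)%R -> (ell s u <= ell s t)%R ;
  path_loss_LoS : forall t, (0 <= t)%R -> (ell NLoS t <= ell LoS t)%R
}.

(* exclusion ell v s x is e_{v|s}(x); ereal_inf set0 = +oo. *)
Definition exclusion ell (v s : link_type) (x : R) : \bar R :=
  match v, s with
  | LoS, LoS | NLoS, NLoS => x%:E
  | _, _ => ereal_inf [set y%:E | y in
                        [set y : R | (0 <= y)%R /\ (ell v y <= ell s x)%R]]
  end.

End path_loss.

Section network.
Context {R : realType} {d : measure_display} {Omega : measurableType d}.

(* bs_type0 is the type of the given BS; the other BSs are indexed by nat, and
   bs_angle is measured from the direction of the given BS. *)
Record network := Network {
  bs_type0 : Omega -> link_type ;
  bs_dist : nat -> Omega -> R ;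
  bs_angle : nat -> Omega -> R ;
  bs_type : nat -> Omega -> link_type ;
  bs_fading : nat -> Omega -> R
}.

Definition bs_position (phi : R) (N : network) (i : nat) (w : Omega) : R * R :=
  polar (bs_dist N i w) (phi + bs_angle N i w)%R.

(* First-order correlation model seen from a BS at distance r in direction phi;
   p1 s r and p2 s v r t theta are the marginal and the joint type
   probabilities of the links. *)
Record first_order_model (P : probability Omega R) (lam : R)
    (p1 : link_type -> R -> R) (p2 : link_type -> link_type -> R -> R -> R -> R)
    (r phi : R) (N : network) : Prop := {
  measurable_type0 : forall u, measurable (bs_type0 N @^-1` [set u]) ;
  measurable_dist : forall i, measurable_fun setT (bs_dist N i) ;
  measurable_angle : forall i, measurable_fun setT (bs_angle N i) ;
  measurable_type : forall i u, measurable (bs_type N i @^-1` [set u]) ;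
  measurable_fading : forall i, measurable_fun setT (bs_fading N i) ;
  dist_ge0 : forall i w, (0 <= bs_dist N i w)%R ;
  angle_itv : forall i w, (0 <= bs_angle N i w <= 2 * pi)%R ;
  type0_law : forall s, P (bs_type0 N @^-1` [set s]) = (p1 s r)%:E ;
  bs_PPP : forall s,
    homogeneous_PPP (cond_prob P (bs_type0 N @^-1` [set s])) lam
      (bs_position phi N) ;
  (* given bs_type0 = s, the types are conditionally independent given all the
     positions, with conditional probabilities p2 s v / p1 s *)
  bs_type_law : forall (s : link_type) (n : nat) (v : 'I_n -> link_type)
      (A : set Omega),
    <<s position_events (bs_position phi N) >> A ->
    P (bs_type0 N @^-1` [set s] `&` A `&`
       [set w | forall j : 'I_n, bs_type N j w = v j]) =
    \int[P]_(w in bs_type0 N @^-1` [set s] `&` A)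
      (\prod_(j < n)
         (p2 s (v j) r (bs_dist N j w) (bs_angle N j w) / p1 s r))%:E ;
  bs_fading_law : forall (n : nat) (B : 'I_n -> set R) (A : set Omega),
    <<s [set bs_type0 N @^-1` [set u] | u in [set: link_type]]
        `|` position_events (bs_position phi N)
        `|` type_events (bs_type N) >> A ->
    (forall j, measurable (B j)) ->
    P (A `&` [set w | forall j : 'I_n, B j (bs_fading N j w)]) =
    P A * \prod_(j < n) exponential_prob 1%R (B j)
}.

Definition serving_event (ell : link_type -> R -> R) (r : R) (s : link_type)
    (N : network) : set Omega :=
  [set w | bs_type0 N w = s /\
     forall i v, bs_type N i w = v -> exclusion ell v s r < (bs_dist N i w)%:E].

(* Every BS other than the given one is an interferer when the latter serves. *)
Definition interference (ell : link_type -> R -> R) (v : link_type)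
    (N : network) (w : Omega) : \bar R :=
  \sum_(0 <= i <oo | `[< bs_type N i w = v >])
    (bs_fading N i w * ell v (bs_dist N i w))%:E.

Definition cond_laplace (P : probability Omega R) (ell : link_type -> R -> R)
    (r : R) (s v : link_type) (N : network) (z : R) : \bar R :=
  cond_expectation P (serving_event ell r s N)
    (fun w => expeR (- (z%:E * interference ell v N w))).

End network.
Arguments network R {d} Omega.

(* Main.v *)
(** Given the positions, the types of the other BSs are independent, and the
    fadings are independent of everything, so the numerator of the conditional
    Laplace transform is the expectation of a product over the points of a
    Poisson process, in which a point at [x] contributes the mean [g_z x] of its
    factor. The generating functional of the process turns it into
    [p_s(r) * exp (- lam * \int (1 - g_z))], and the denominator is the same
    expression at [z = 0]. In the quotient [\int (1 - g_0)] cancels, leaving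
    [exp (- lam * \int (g_0 - g_z))], which is the claimed double integral in
    polar coordinates.

    The cancellation needs [\int (1 - g_0) < +oo]. This is clear when every
    exclusion radius is finite. For an NLoS serving BS the LoS exclusion radius
    may be infinite; then, off a bounded set, [1 - g_0 x] is at most a multiple of
    the probability that the link to [x] is unblocked, and this decays exponentially
    in the length of the link, because the blockages that are long and nearly
    orthogonal to the dominant axis of the link already form a thinned Poisson
    process, and the centers from which they hit the link fill a parallelogram of
    area linear in the length of the link. *)

(* The hypotheses speak only of events and of finite families: finitely many counts, types or marks.
   Hence all products run over the first [n] indices and the limit in [n] is taken by dominated
   convergence, the partial products lying in [0, 1]; in the same way the serving event is a
   decreasing limit of events that test finitely many BSs. Statements on events become statements on
   integrals of products by releasing one coordinate at a time: an induction on the number of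
   coordinates still carrying a factor recurs for Poisson counts, for fadings and for thinned
   blockages. The marginal of [p_joint] at distance [r] is identified with [p_single] through the
   type law of the network rather than by a computation in the Boolean model: the two types of one
   other BS exhaust the event that the given BS has type [s]. For the finiteness of the cancelled
   area integral any integrable bound on the probability of an unblocked link will do, which is why
   a crude class of blockages with arbitrary constants is enough. *)
From HB Require Import structures.
Require Import Defs.
From mathcomp Require Import all_boot all_order all_algebra.
From mathcomp Require Import all_classical all_reals all_analysis.
From mathcomp Require Import measurable_realfun ring lra.
Import Order.TTheory GRing.Theory Num.Theory.
Import numFieldNormedType.Exports.
Set Implicit Arguments.
Unset Strict Implicit.
Unset Printing Implicit Defensive.
Local Open Scope classical_set_scope.
Local Open Scope ring_scope.
Local Open Scope ereal_scope.

(** * Weighted integrals and independence *)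

Section density.
Context d (T : measurableType d) (R : realType).
Variables (mu : {measure set T -> \bar R}) (f : T -> R).
Hypothesis mf : measurable_fun setT f.
Hypothesis f0 : forall x, (0 <= f x)%R.

(** The two proofs are arguments because the measure structure declared below depends on them. *)
Definition density of measurable_fun setT f & (forall x, (0 <= f x)%R) :=
  fun A : set T => \int[mu]_(x in A) (f x)%:E.

Local Notation m := (density mf f0).

Let density0 : m set0 = 0.
Proof. by rewrite /density integral_set0. Qed.

Let density_ge0 A : 0 <= m A.
Proof. by apply: integral_ge0 => x _; rewrite lee_fin. Qed.

Let mEf : measurable_fun setT (EFin \o f).
Proof. exact/measurable_EFinP. Qed.

Let Ef0 x : 0 <= (f x)%:E.
Proof. by rewrite lee_fin. Qed.

Let density_sigma_additive : semi_sigma_additive m.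
Proof.
move=> F mF tF mUF.
have -> : m (\bigcup_n F n) = \sum_(n <oo) m (F n).
  by rewrite /density ge0_integral_bigcup//; exact: measurable_funTS.
by apply: is_cvg_nneseries => n _ _; exact: density_ge0.
Qed.

HB.instance Definition _ := isMeasure.Build _ _ _ m
  density0 density_ge0 density_sigma_additive.

Import HBNNSimple.

(** Both sides agree on indicators, hence on the simple functions increasing to [g], and monotone
    convergence applies on either side. *)
Lemma ge0_integral_density (g : T -> \bar R) :
  measurable_fun setT g -> (forall x, 0 <= g x) ->
  \int[m]_x g x = \int[mu]_x (g x * (f x)%:E).
Proof.
move=> mg g0; pose g_ := nnsfun_approx measurableT mg.
have cg x : (g_ n x)%:E @[n --> \oo] --> g x.
  by apply: cvg_nnsfun_approx.
have ndg x k l : (k <= l)%N -> (g_ k x)%:E <= (g_ l x)%:E.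
  by move=> kl; rewrite lee_fin; exact/lefP/nd_nnsfun_approx.
transitivity (limn (fun n => \int[m]_x (g_ n x)%:E)).
  rewrite -monotone_convergence//.
  - by apply: eq_integral => x _; apply/esym/cvg_lim.
  - by move=> n; exact/measurable_EFinP.
  - by move=> n x _; rewrite lee_fin.
  - by move=> x _ k l; exact: ndg.
transitivity (limn (fun n => \int[mu]_x ((g_ n x)%:E * (f x)%:E))); last first.
  rewrite -monotone_convergence//.
  - apply: eq_integral => x _; apply/cvg_lim => //.
    by apply: cvgeZr => //; exact: cg.
  - by move=> n; apply: emeasurable_funM => //; exact/measurable_EFinP.
  - by move=> n x _; rewrite mule_ge0 // lee_fin.
  - by move=> x _ k l kl; rewrite lee_wpmul2r // ndg.
congr (limn _); apply/funext => n.
under [LHS]eq_integral => x _ do rewrite fimfunE -fsumEFin//.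
rewrite ge0_integral_fsum//; last 2 first.
  - by move=> r; exact/measurable_EFinP/measurableT_comp.
  - by move=> r x _; rewrite nnfun_muleindic_ge0.
under [RHS]eq_integral.
  move=> x _; rewrite fimfunE -fsumEFin// ge0_mule_fsuml; last first.
    by move=> r; rewrite nnfun_muleindic_ge0.
  over.
rewrite ge0_integral_fsum//; last 2 first.
  - move=> r; apply: emeasurable_funM => //.
    exact/measurable_EFinP/measurableT_comp.
  - by move=> r x _; rewrite mule_ge0 // nnfun_muleindic_ge0.
apply: eq_fsbigr => r _.
rewrite integralZl_indic_nnsfun// integral_indic// setIT.
(* The level [r] ranges over all reals. A negative level has an empty preimage, which leaves only
   nonnegative scalars to pull out of the integral. *)
have [r0|r0] := ltP r 0%R.
  rewrite preimage_nnfun0// measure0 mule0 integral0_eq// => x _.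
  by rewrite indicE in_set0 mulr0 mul0e.
under eq_integral do rewrite EFinM -muleA.
rewrite ge0_integralZl//; last 2 first.
  - apply: emeasurable_funM => //; exact/measurable_EFinP/measurable_indic.
  - by move=> x _; rewrite mule_ge0 // lee_fin.
congr (_ * _); rewrite /m /density [LHS]integral_mkcond.
apply: eq_integral => x _; rewrite /patch indicE.
by case: ifP => _; rewrite ?mul1e ?mul0e.
Qed.

End density.

Section finite_measure_of.
Context d (T : measurableType d) (R : realType).
Variable m : {measure set T -> \bar R}.
Hypothesis mfin : fin_num_fun m.

(** An alias to which the finite measure structure can be attached: the product measure and Fubini's
    theorem ask for it on the first factor, while the image of a density comes only as a measure. *)
Definition finite_measure_of of fin_num_fun m : set T -> \bar R := m.

HB.instance Definition _ := Measure.on (finite_measure_of mfin).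
HB.instance Definition _ := Measure_isFinite.Build _ _ _
  (finite_measure_of mfin) mfin.

End finite_measure_of.

Lemma ex_finite_measure d (T : measurableType d) (R : realType)
    (m : {measure set T -> \bar R}) : m setT < +oo ->
  exists M : {finite_measure set T -> \bar R}, M = m :> (set T -> \bar R).
Proof. by move=> /lty_fin_num_fun mfin; exists (finite_measure_of mfin). Qed.

Lemma ex_pushforward_measure d d' (T : measurableType d) (S : measurableType d')
    (R : realType) (m : {measure set T -> \bar R}) (V : T -> S) :
  measurable_fun setT V ->
  exists M : {measure set S -> \bar R}, forall A, M A = m (V @^-1` A).
Proof.
move=> mV.
by exists (measure_function_pushforward__canonical__measure_function_Measure m mV).
Qed.

Section weighted_laws.
Context d (T : measurableType d) (R : realType).
Variable mu : {measure set T -> \bar R}.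
Variables f1 f2 : T -> R.
Hypotheses (mf1 : measurable_fun setT f1) (mf2 : measurable_fun setT f2).
Hypotheses (f1_ge0 : forall x, (0 <= f1 x)%R) (f2_ge0 : forall x, (0 <= f2 x)%R).

(** The hypothesis on preimages says that the measures with densities [f1] and [f2] have the same
    image under [V]. *)
Lemma eq_weighted_integral d' (S : measurableType d') (V : T -> S)
    (F : S -> \bar R) :
  measurable_fun setT V -> measurable_fun setT F -> (forall x, 0 <= F x) ->
  (forall B, measurable B ->
    \int[mu]_(x in V @^-1` B) (f1 x)%:E = \int[mu]_(x in V @^-1` B) (f2 x)%:E) ->
  \int[mu]_x (F (V x) * (f1 x)%:E) = \int[mu]_x (F (V x) * (f2 x)%:E).
Proof.
move=> mV mF F0 f12.
have mFV : measurable_fun setT (F \o V) by exact: measurableT_comp.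
have FV0 x : 0 <= (F \o V) x by exact: F0.
rewrite -[LHS](ge0_integral_density mu mf1 f1_ge0 mFV FV0).
rewrite -[RHS](ge0_integral_density mu mf2 f2_ge0 mFV FV0).
rewrite -[LHS](@ge0_integral_pushforward _ _ _ _ _ V mV
  (density mu mf1 f1_ge0) setT F)//.
rewrite -[RHS](@ge0_integral_pushforward _ _ _ _ _ V mV
  (density mu mf2 f2_ge0) setT F)//.
apply: eq_measure_integral => A mA _; exact: f12.
Qed.

(** On rectangles, the image under [(V, H)] of the measure with density [f1] is the product of [nu]
    with the image under [V] of the measure with density [f2]. Uniqueness of the product measure
    extends this to all sets, and Fubini's theorem integrates [H] out. *)
Lemma weighted_integral_indep d' (S : measurableType d') d'' (U : measurableType d'')
    (nu : probability U R) (V : T -> S) (H : T -> U) (F : S * U -> \bar R) :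
  measurable_fun setT V -> measurable_fun setT H ->
  measurable_fun setT F -> (forall x, 0 <= F x) ->
  \int[mu]_x (f2 x)%:E < +oo ->
  (forall B C, measurable B -> measurable C ->
    \int[mu]_(x in V @^-1` B `&` H @^-1` C) (f1 x)%:E =
    (\int[mu]_(x in V @^-1` B) (f2 x)%:E) * nu C) ->
  \int[mu]_x (F (V x, H x) * (f1 x)%:E) =
  \int[mu]_x (\int[nu]_y F (V x, y) * (f2 x)%:E).
Proof.
move=> mV mH mF F0 f2oo f12.
pose G x := \int[nu]_y F (x, y).
have mG : measurable_fun setT G by exact: measurable_fun_fubini_tonelli_F.
have G0 x : 0 <= G x by apply: integral_ge0.
have mVH : measurable_fun setT (fun x => (V x, H x)).
  exact: measurable_fun_pair.
have mFVH : measurable_fun setT (F \o (fun x => (V x, H x))).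
  exact: measurableT_comp.
have mGV : measurable_fun setT (G \o V) by exact: measurableT_comp.
have FVH0 x : 0 <= (F \o (fun x => (V x, H x))) x by exact: F0.
have GV0 x : 0 <= (G \o V) x by exact: G0.
rewrite -[LHS](ge0_integral_density mu mf1 f1_ge0 mFVH FVH0).
rewrite -[RHS](ge0_integral_density mu mf2 f2_ge0 mGV GV0).
rewrite -[LHS](@ge0_integral_pushforward _ _ _ _ _ (fun x => (V x, H x)) mVH
  (density mu mf1 f1_ge0) setT F)//.
rewrite -[RHS](@ge0_integral_pushforward _ _ _ _ _ V mV
  (density mu mf2 f2_ge0) setT G)//.
have [m2 m2E] := ex_pushforward_measure (density mu mf2 f2_ge0) mV.
have [|M2 M2E] := @ex_finite_measure _ _ _ m2.
  by rewrite m2E preimage_setT.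
have M2A A : M2 A = density mu mf2 f2_ge0 (V @^-1` A).
  by rewrite -m2E; exact: (congr1 (fun f => f A) M2E).
transitivity (\int[M2 \x nu]_z F z); last first.
  rewrite fubini_tonelli1//; apply: eq_measure_integral => A mA _.
  by first [exact: M2A | exact/esym/M2A].
apply: eq_measure_integral => A mA _.
apply/esym.
apply: (@product_measure_unique _ _ _ _ _ M2 nu
  (pushforward (density mu mf1 f1_ge0) (fun x => (V x, H x)))) => //.
by move=> B C mB mC; apply: etrans (f12 _ _ mB mC) _; congr (_ * _); exact/esym/M2A.
Qed.

End weighted_laws.

(** * Generating functional of a Poisson process *)

Lemma poisson_mass_ge0 (R : realType) (c : R) k : (0 <= c)%R ->
  (0 <= poisson_mass c k)%R.
Proof. by move=> c0; rewrite !mulr_ge0 ?expR_ge0 ?exprn_ge0 ?invr_ge0. Qed.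

Lemma poisson_mass_pgf (R : realType) (c a : R) : (0 <= c)%R -> (0 <= a)%R ->
  \sum_(0 <= k <oo) (poisson_mass c k * a ^+ k)%:E =
  (expR (- (c * (1 - a))))%:E.
Proof.
move=> c0 a0.
have -> : (expR (- (c * (1 - a))) = expR (- c) * expR (c * a))%R.
  by rewrite -expRD mulrBr mulr1 opprB addrC.
under eq_eseriesr.
  move=> k _.
  have -> : (poisson_mass c k * a ^+ k = expR (- c) * exp_coeff (c * a) k)%R.
    by rewrite /poisson_mass /exp_coeff /= exprMn; ring.
  rewrite EFinM; over.
rewrite /= nneseriesZl/=; last first.
  by move=> n _; rewrite lee_fin exp_coeff_ge0 // mulr_ge0.
rewrite EFinM; congr *%E.
have -> : expR (c * a) = limn (series (exp_coeff (c * a))) by rewrite /expR.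
rewrite -EFin_lim; last exact: is_cvg_series_exp_coeff.
by apply/congr_lim/funext => n/=; rewrite /series/= -sumEFin.
Qed.

Section independent_poisson_variables.
Context d (Omega : measurableType d) (R : realType) (m : nat).
Variable Q : {measure set Omega -> \bar R}.
Variables (N : 'I_m -> Omega -> \bar R) (c a : 'I_m -> R).
Variable psi : 'I_m -> Omega -> R.
Hypothesis mN : forall j, measurable_fun setT (N j).
Hypothesis mpsi : forall j, measurable_fun setT (psi j).
Hypothesis c_ge0 : forall j, (0 <= c j)%R.
Hypothesis a_ge0 : forall j, (0 <= a j)%R.
Hypothesis psi_ge0 : forall j w, (0 <= psi j w)%R.
Hypothesis psiE : forall j w k, N j w = k%:R%:E -> psi j w = (a j ^+ k)%R.
Hypothesis Qoo : Q setT < +oo.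
Hypothesis jointN : forall k : 'I_m -> nat,
  Q [set w | forall j, N j w = (k j)%:R%:E] =
  Q setT * (\prod_j poisson_mass (c j) (k j))%:E.
Hypothesis marginN : forall j k,
  Q [set w | N j w = k%:R%:E] = Q setT * (poisson_mass (c j) k)%:E.

Lemma measurable_level j (k : nat) : measurable [set w | N j w = k%:R%:E].
Proof.
rewrite -[X in measurable X]setTI.
exact: (mN j measurableT (emeasurable_set1 k%:R%:E)).
Qed.

(** The Poisson masses sum to one, by their generating function at 1, so infinite counts are
    negligible. This is why [psi j], which stands for [a j] to the power [N j], is prescribed at
    finite counts only. *)
Lemma levels_full j : Q (~` \bigcup_k [set w | N j w = k%:R%:E]) = 0.
Proof.
have mU : measurable (\bigcup_k [set w | N j w = k%:R%:E]).
  by apply: bigcup_measurable => k _; exact: measurable_level.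
have QU : Q (\bigcup_k [set w | N j w = k%:R%:E]) = Q setT.
  rewrite measure_bigcup//=; last 2 first.
  - by move=> k _; exact: measurable_level.
  - apply/trivIsetP => k l _ _ kl; apply/seteqP; split => // w [/= ->] [].
    by move/eqP; rewrite eqr_nat (negbTE kl).
  rewrite (eq_eseriesl (Q := xpredT)); last by move=> k; rewrite in_setT.
  under eq_eseriesr do rewrite marginN.
  have mass0 k : true -> 0 <= (poisson_mass (c j) k)%:E.
    by move=> _; rewrite lee_fin poisson_mass_ge0.
  rewrite (_ : Q setT = (fine (Q setT))%:E); last first.
    by rewrite fineK// ge0_fin_numE.
  rewrite nneseriesZl//.
  rewrite [X in _ * X](_ : _ = 1) ?mule1//.
  have := @poisson_mass_pgf R (c j) 1 (c_ge0 j) ler01.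
  rewrite subrr mulr0 oppr0 expR0 => <-.
  by apply: eq_eseriesr => k _; rewrite expr1n mulr1.
rewrite -setTD measureD//.
rewrite setTI [X in _ - X](_ : _ = Q setT); last exact: QU.
by rewrite subee// ge0_fin_numE.
Qed.

(* [e j = Some k] freezes the j-th count at k; the integral over a cylinder is
   computed by induction on the number of coordinates that are not frozen. *)
Local Notation cylinder e :=
  [set w | forall j k, e j = Some k -> N j w = k%:R%:E].

Let measurable_cylinder (e : 'I_m -> option nat) : measurable (cylinder e).
Proof.
rewrite [X in measurable X](_ : _ = \bigcap_(j in [set: 'I_m])
  (if e j is Some k then [set w | N j w = k%:R%:E] else setT)).
  apply: fin_bigcap_measurable => // j _.
  by case: (e j) => // k; exact: measurable_level.
apply/seteqP; split => [w ew j _ | w ew j k ejk].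
  by case E : (e j) => [k|//]; exact: ew.
by have := ew j I; rewrite ejk.
Qed.

Lemma integral_cylinder (e : 'I_m -> option nat) :
  \int[Q]_(w in cylinder e) (\prod_(j | e j == None) psi j w)%:E =
  Q setT * (\prod_j (if e j is Some k then poisson_mass (c j) k
                     else expR (- (c j * (1 - a j)))))%:E.
Proof.
have mprod (P : pred 'I_m) :
    measurable_fun setT (fun w => (\prod_(j | P j) psi j w)%:E).
  apply/measurable_EFinP.
  rewrite (_ : (fun _ => _) = (fun w => \prod_j (if P j then psi j w else 1)%R)%R).
    by apply: measurable_prod => j _; case: (P j).
  by apply/funext => w; rewrite big_mkcond.
have prod0 (P : pred 'I_m) w : (0 <= \prod_(j | P j) psi j w)%R.
  by apply: prodr_ge0.
have [n] := ubnP #|[pred j | e j == None]|.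
elim: n e => // n IH e; rewrite ltnS => en.
have [j0 /= ej0|eS] := pickP [pred j | e j == None]; last first.
  rewrite (eq_integral (cst 1)); last first.
    by move=> w _; rewrite /= big_pred0.
  rewrite integral_cst// mul1e.
  pose k j := if e j is Some k then k else 0%N.
  have eE j : e j = Some (k j) by move: (eS j); rewrite /k /=; case: (e j).
  rewrite (_ : cylinder e = [set w | forall j, N j w = (k j)%:R%:E]); last first.
    apply/seteqP; split => [w ew j | w ew j l]; first exact/ew/eE.
    by rewrite eE => -[<-].
  by rewrite jointN; congr (_ * _%:E); apply: eq_bigr => j _; rewrite eE.
pose e' k j := if j == j0 then Some k else e j.
have e'None k j : (e' k j == None) = (e j == None) && (j != j0).
  by rewrite /e'; case: (eqVneq j j0) => [->|]; rewrite ?andbF ?andbT.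
have cylE k : cylinder (e' k) = cylinder e `&` [set w | N j0 w = k%:R%:E].
  apply/seteqP; split => [w ew|w [ew /= Nk] j l].
    split; last by apply: (ew j0); rewrite /e' eqxx.
    move=> j l ejl; apply: (ew j); rewrite /e'.
    by case: eqP ejl => // ->; rewrite (eqP ej0).
  by rewrite /e'; case: eqP => [-> [<-]//|_]; exact: ew.
rewrite (@ge0_negligible_integral _ _ _ _ _
    (~` \bigcup_k [set w | N j0 w = k%:R%:E])) //; last 4 first.
- by apply: measurableC; apply: bigcup_measurable => k _; exact: measurable_level.
- exact: measurable_funTS.
- by move=> w _; rewrite lee_fin.
- exact: levels_full.
rewrite setDE setCK setI_bigcupr ge0_integral_bigcup//; last 4 first.
- by move=> k; apply: measurableI => //; exact: measurable_level.
- exact: measurable_funTS.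
- by move=> w _; rewrite lee_fin.
- apply/trivIsetP => k l _ _ kl; apply/seteqP; split => // w [[_ /= ->]] [_ []].
  by move/eqP; rewrite eqr_nat (negbTE kl).
have QT : Q setT = (fine (Q setT))%:E by rewrite fineK// ge0_fin_numE.
pose C := (\prod_(j | j != j0) (if e j is Some k then poisson_mass (c j) k
                     else expR (- (c j * (1 - a j)))))%R.
have Ck k : (\prod_j (if e' k j is Some l then poisson_mass (c j) l
                     else expR (- (c j * (1 - a j)))) =
    poisson_mass (c j0) k * C)%R.
  rewrite (bigD1 j0)//= {1}/e' eqxx; congr (_ * _)%R.
  by apply: eq_bigr => j jj0; rewrite /e' (negbTE jj0).
(* On the slice where the count [j0] equals [k], the factor [psi j0] is the constant [a j0 ^+ k] and
   [e' k] has one free coordinate less; summing over [k] gives the Poisson generating function. *)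
transitivity (\sum_(0 <= k <oo)
    (Q setT * C%:E) * (poisson_mass (c j0) k * a j0 ^+ k)%:E).
  apply: eq_eseriesr => k _; rewrite -cylE.
  rewrite (eq_integral (fun w => (a j0 ^+ k)%:E *
      (\prod_(j | e' k j == None) psi j w)%:E)); last first.
    move=> w; rewrite inE => ew; rewrite -EFinM (bigD1 j0)//=; congr (_ * _)%:E.
      by apply: psiE; apply: (ew j0); rewrite /e' eqxx.
    by apply: eq_bigl => j; rewrite e'None.
  rewrite ge0_integralZl_EFin//; last 3 first.
  - by move=> w _; rewrite lee_fin.
  - exact: measurable_funTS.
  - exact: exprn_ge0.
  rewrite IH; last first.
    apply: leq_trans en; apply: proper_card; apply/properP; split.
      by apply/fintype.subsetP => j; rewrite !inE e'None => /andP[].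
    by exists j0; rewrite !inE // e'None eqxx andbF.
  by rewrite Ck QT -!EFinM; congr EFin; ring.
rewrite QT.
rewrite -(EFinM (fine (Q setT)) C) [LHS]nneseriesZl; last first.
  by move=> k _; rewrite lee_fin mulr_ge0 ?exprn_ge0 ?poisson_mass_ge0.
rewrite poisson_mass_pgf// -!EFinM -mulrA; congr (_ * _)%:E.
by rewrite (bigD1 j0)//= (eqP ej0) mulrC.
Qed.

Lemma integral_prod_poisson_pgf :
  \int[Q]_w (\prod_j psi j w)%:E =
  Q setT * (\prod_j expR (- (c j * (1 - a j))))%:E.
Proof.
rewrite -(integral_cylinder (fun=> None)); congr (\int[Q]_(w in _) _).
by apply/seteqP; split.
Qed.

End independent_poisson_variables.

Lemma cvg_prodr (R : realType) (I : Type) (r : seq I) (u : I -> R^nat) (l : I -> R) :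
  (forall j, u j n @[n --> \oo] --> l j) ->
  (\prod_(j <- r) u j n)%R @[n --> \oo] --> (\prod_(j <- r) l j)%R.
Proof.
move=> ul; elim: r => [|j r IH].
  by rewrite big_nil; under eq_fun do rewrite big_nil; exact: cvg_cst.
by rewrite big_cons; under eq_fun do rewrite big_cons; exact: cvgM.
Qed.

Lemma bounded_cvg_integral d (T : measurableType d) (R : realType)
    (mu : {measure set T -> \bar R}) (f : (T -> R)^nat) (g : T -> R) :
  mu setT < +oo ->
  (forall n, measurable_fun setT (f n)) ->
  (forall n x, (0 <= f n x <= 1)%R) ->
  (forall x, f n x @[n --> \oo] --> g x) ->
  \int[mu]_x (f n x)%:E @[n --> \oo] --> \int[mu]_x (g x)%:E.
Proof.
move=> muoo mf f01 fg.
have [||//|||_ _] := @dominated_convergence _ _ _ mu setT measurableT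
  (fun n x => (f n x)%:E) (fun x => (g x)%:E) (cst 1).
- by move=> n; exact/measurable_EFinP.
- by apply/measurable_EFinP; apply: (measurable_fun_cvg mf) => x _; exact: fg.
- by apply: aeW => x _; apply/cvg_EFin; [exact: nearW | exact: fg].
- by apply/integrableP; split => //; under eq_integral do rewrite abse1;
    rewrite integral_cst// mul1e.
- apply: aeW => x n _; have /andP[f0 f1] := f01 n x.
  by rewrite gee0_abs lee_fin.
exact.
Qed.

Section step_functional.
Context d (Omega : measurableType d) (R : realType).
Variable Q : {measure set Omega -> \bar R}.
Variable X : nat -> Omega -> R * R.
Hypothesis mX : forall i, measurable_fun setT (X i).

(** The product follows the enumeration of the points and not an exhaustion of the plane: with
    factors in [0, 1] it decreases, so it has a limit even where infinitely many factors differ from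
    1. *)
Definition running_prod (f : R * R -> R) (n : nat) (w : Omega) : R :=
  (\prod_(i < n) f (X i w))%R.

Lemma measurable_running_prod f n : measurable_fun setT f ->
  measurable_fun setT (running_prod f n).
Proof.
by move=> mf; apply: measurable_prod => i _; apply: measurableT_comp.
Qed.

Lemma running_prod01 f n w : (forall x, (0 <= f x <= 1)%R) ->
  (0 <= running_prod f n w <= 1)%R.
Proof.
move=> f01; rewrite prodr_ge0/=; last by move=> i _; case/andP: (f01 (X i w)).
by apply: prodr_ile1 => i _; exact: f01.
Qed.

Lemma cvg_running_prod f w : (forall x, (0 <= f x <= 1)%R) ->
  running_prod f n w @[n --> \oo] --> limn (running_prod f ^~ w).
Proof.
move=> f01; apply: nonincreasing_is_cvgn.
  apply/nonincreasing_seqP => n; rewrite /running_prod big_ord_recr/=.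
  rewrite ler_piMr//; last by case/andP: (f01 (X n w)).
  by case/andP: (running_prod01 n w f01).
by exists 0%R => _ [n _ <-]; case/andP: (running_prod01 n w f01).
Qed.

Lemma running_prod_lim_le f n w : (forall x, (0 <= f x <= 1)%R) ->
  (limn (running_prod f ^~ w) <= running_prod f n w)%R.
Proof.
move=> f01; apply: nonincreasing_cvgn_ge; last exact: cvg_running_prod.
apply/nonincreasing_seqP => k; rewrite /running_prod big_ord_recr/=.
rewrite ler_piMr//; last by case/andP: (f01 (X k w)).
by case/andP: (running_prod01 k w f01).
Qed.

Lemma measurable_point_count (B : set (R * R)) : measurable B ->
  measurable_fun setT (point_count X B).
Proof.
move=> mB; apply: ge0_emeasurable_sum => [k w _ _|k _]; first by rewrite lee_fin.
by apply/measurable_EFinP; apply: (measurableT_comp (measurable_indic mB)).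
Qed.

(** The partial products are powers of [a] whose exponents are integers tending to [k], hence
    eventually equal to [k]; this covers [a = 0] as well. *)
Lemma lim_running_prod_step (B : set (R * R)) (a : R) w k : (0 <= a <= 1)%R ->
  point_count X B w = k%:R%:E ->
  limn (running_prod (fun x => if x \in B then a else 1%R) ^~ w) = (a ^+ k)%R.
Proof.
move=> a01 Nk.
pose c n := (\sum_(i < n) (X i w \in B))%N.
have prodE n : running_prod (fun x => if x \in B then a else 1%R) n w = (a ^+ c n)%R.
  rewrite /running_prod /c; elim: n => [|n IH]; first by rewrite !big_ord0.
  by rewrite !big_ord_recr/= IH exprD; case: (X n w \in B).
have cN : ((c n)%:R)%:E @[n --> \oo] --> (k%:R%:E : \bar R).
  rewrite -Nk /point_count.
  have -> : (fun n => ((c n)%:R)%:E) =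
      (fun n => \sum_(0 <= i < n) (\1_B (X i w))%:E :> \bar R).
    apply/funext => n; rewrite /c big_mkord sumEFin natr_sum.
    by congr EFin; apply: eq_bigr => i _; rewrite indicE.
  by apply: is_cvg_nneseries => i _ _; rewrite lee_fin.
have {}cN : ((c n)%:R : R) @[n --> \oo] --> (k%:R : R).
  exact: (fine_cvg cN).
apply/cvg_lim => //; apply: cvg_near_cst.
move/cvgrPdist_lt : cN => /(_ _ ltr01).
apply: filterS => n; rewrite prodE ltr_norml => /andP[lo up].
congr (_ ^+ _)%R; case: (ltngtP (c n) k) => // ck; exfalso.
- have : ((c n)%:R + 1 <= k%:R :> R)%R by rewrite natr1 ler_nat.
  by move: up; lra.
- have : (k%:R + 1 <= (c n)%:R :> R)%R by rewrite natr1 ler_nat.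
  by move: lo; lra.
Qed.

Hypothesis Qoo : Q setT < +oo.

Lemma cvg_integral_running_prod (f : R * R -> R) : measurable_fun setT f ->
  (forall x, (0 <= f x <= 1)%R) ->
  \int[Q]_w (running_prod f n w)%:E @[n --> \oo] -->
  \int[Q]_w (limn (running_prod f ^~ w))%:E.
Proof.
move=> mf f01; apply: bounded_cvg_integral => //.
- by move=> n; exact: measurable_running_prod.
- by move=> n w; exact: running_prod01.
- by move=> w; exact: cvg_running_prod.
Qed.

Lemma measurable_lim_running_prod (f : R * R -> R) : measurable_fun setT f ->
  (forall x, (0 <= f x <= 1)%R) ->
  measurable_fun setT (fun w => limn (running_prod f ^~ w)).
Proof.
move=> mf f01.
apply: (@measurable_fun_cvg _ _ _ _ (running_prod f)) => [n|w _].
  exact: measurable_running_prod.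
exact: cvg_running_prod.
Qed.

Variable lam : R.
Hypothesis lam_ge0 : (0 <= lam)%R.
Hypothesis PPP_Q : forall (n : nat) (B : 'I_n -> set (R * R)) (k : 'I_n -> nat),
    (forall j, measurable (B j)) -> (forall j, area (B j) < +oo) ->
    trivIset setT B ->
    Q [set w | forall j, point_count X (B j) w = (k j)%:R%:E] =
    Q setT * (\prod_(j < n) poisson_mass (lam * fine (area (B j))) (k j))%:E.

(** The product over the points splits into the powers of [a j] by the number of points in [B j],
    and these counts are independent Poisson variables. The total mass of [Q] is kept as a factor so
    that [Q] may be the restriction of a probability to an event. *)
Lemma step_pgfl (m : nat) (B : 'I_m -> set (R * R)) (a : 'I_m -> R)
    (f : R * R -> R) :
  (forall j, measurable (B j)) -> (forall j, area (B j) < +oo) ->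
  trivIset setT B -> (forall j, (0 <= a j <= 1)%R) ->
  (forall x, f x = (\prod_j (if x \in B j then a j else 1))%R) ->
  \int[Q]_w (limn (running_prod f ^~ w))%:E =
  Q setT * (expR (- (lam * (\sum_j (1 - a j) * fine (area (B j))))))%:E.
Proof.
move=> mB Boo tB a01 fE.
pose g j (x : R * R) := (if x \in B j then a j else 1)%R.
have g01 j x : (0 <= g j x <= 1)%R.
  by rewrite /g; case: ifP => _ //; rewrite ler01 lexx.
have mg j : measurable_fun setT (g j).
  rewrite (_ : g j = (fun x => 1 - (1 - a j) * \1_(B j) x)%R).
    by apply: measurable_funB => //; apply: measurable_funM => //; exact: measurable_indic.
  by apply/funext => x; rewrite /g indicE; case: ifP => _ /=; ring.
pose psi j w := limn (running_prod (g j) ^~ w).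
have -> : (fun w => (limn (running_prod f ^~ w))%:E) =
    (fun w => (\prod_j psi j w)%R%:E).
  apply/funext => w; congr EFin; apply/cvg_lim => //.
  have -> : running_prod f ^~ w = (fun n => \prod_j running_prod (g j) n w)%R.
    apply/funext => n; rewrite /running_prod exchange_big/=.
    by apply: eq_bigr => i _; rewrite fE.
  by apply: cvg_prodr => j; exact: cvg_running_prod.
have psi_ge0 j w : (0 <= psi j w)%R.
  apply: limr_ge; first exact: cvg_running_prod.
  by apply: nearW => n; case/andP: (running_prod01 n w (@g01 j)).
rewrite (@integral_prod_poisson_pgf _ _ _ _ _ (fun j => point_count X (B j))
  (fun j => lam * fine (area (B j)))%R a psi)//.
- rewrite -expR_sum; congr (_ * (expR _)%:E); rewrite mulr_sumr -sumrN.
  by apply: eq_bigr => j _; congr (- _)%R; ring.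
- by move=> j; exact: measurable_point_count.
- by move=> j; exact: measurable_lim_running_prod.
- by move=> j; rewrite mulr_ge0// fine_ge0.
- by move=> j; case/andP: (a01 j).
- by move=> j w k; exact: lim_running_prod_step.
- by move=> k; exact: PPP_Q.
- move=> j k.
  have := @PPP_Q 1 (fun=> B j) (fun=> k).
  rewrite big_ord1 => <- //.
  + by congr (Q _); apply/seteqP; split => [w Nw _ //|w /(_ ord0)].
  + by apply/trivIsetP => p q _ _; rewrite !ord1.
Qed.

End step_functional.

Section area_measure.
Context (R : realType).

(* The display of measurableTypeR R differs from that of R, hence the detour
   through the two identity maps below. *)
Let RR := (measurableTypeR R * measurableTypeR R)%type.
Let leb2 : {measure set RR -> \bar R} :=
  (@lebesgue_measure R \x @lebesgue_measure R).

Let measurable_idRR : measurable_fun (setT : set RR) (fun x : RR => x : R * R).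
Proof. by move=> _ Y mY; rewrite setTI; exact: mY. Qed.

Let area0 : area set0 = 0 :> \bar R.
Proof. exact: (measure0 leb2). Qed.

Let area_ge0 (A : set (R * R)) : 0 <= area A.
Proof. exact: (measure_ge0 leb2). Qed.

Let area_sigma_additive : semi_sigma_additive (@area R).
Proof. exact: (@measure_semi_sigma_additive _ _ _ leb2). Qed.

HB.instance Definition _ := isMeasure.Build _ _ R (@area R)
  area0 area_ge0 area_sigma_additive.

Lemma integral_area (f : R * R -> \bar R) : measurable_fun setT f ->
  (forall x, 0 <= f x) ->
  \int[area]_x f x = \int[lebesgue_measure]_x \int[lebesgue_measure]_y f (x, y).
Proof.
move=> mf f0.
rewrite -(@fubini_tonelli1 _ _ _ _ _ (@lebesgue_measure R) (@lebesgue_measure R) f)//;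
  last first.
have := @ge0_integral_pushforward _ _ _ _ R _ measurable_idRR leb2 setT f
  measurableT mf (fun x _ => f0 x).
rewrite preimage_setT => <-.
exact: eq_measure_integral.
Qed.

Lemma areaX (A B : set R) : measurable A -> measurable B ->
  area (A `*` B) = lebesgue_measure A * lebesgue_measure B :> \bar R.
Proof. by move=> mA mB; exact: product_measure1E. Qed.

End area_measure.

Section probability_generating_functional.
Context d (Omega : measurableType d) (R : realType).
Variable Q : {measure set Omega -> \bar R}.
Variable X : nat -> Omega -> R * R.
Hypothesis mX : forall i, measurable_fun setT (X i).
Hypothesis Qoo : Q setT < +oo.
Variable lam : R.
Hypothesis lam_ge0 : (0 <= lam)%R.
Hypothesis PPP_Q : forall (n : nat) (B : 'I_n -> set (R * R)) (k : 'I_n -> nat),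
    (forall j, measurable (B j)) -> (forall j, area (B j) < +oo) ->
    trivIset setT B ->
    Q [set w | forall j, point_count X (B j) w = (k j)%:R%:E] =
    Q setT * (\prod_(j < n) poisson_mass (lam * fine (area (B j))) (k j))%:E.

Import HBNNSimple.

(** The nonzero levels of [v] lie in [D], so they have finite area and form a step function. The
    level 0, which may have infinite area, is filtered out of [s]: there the factor is 1. *)
Lemma simple_pgfl (v : {nnsfun (R * R) >-> R}) (D : set (R * R)) :
  measurable D -> area D < +oo -> (forall x, (v x <= 1)%R) ->
  (forall x, ~ D x -> v x = 0%R) ->
  \int[Q]_w (limn (running_prod X (fun x => 1 - v x)%R ^~ w))%:E =
  Q setT * expeR (- (lam%:E * \int[area]_x (v x)%:E)).
Proof.
move=> mD Doo v1 vD.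
pose s := [seq c <- finmap.enum_fset (fset_set (range v)) | c != 0%R].
pose B (j : 'I_(size s)) := v @^-1` [set s`_j]%R.
have us : uniq s by rewrite filter_uniq//; exact: finmap.fset_uniq.
have smem x : v x != 0%R -> v x \in s.
  move=> vx; rewrite mem_filter vx/= in_fset_set; last exact: fimfunP.
  by rewrite inE; exists x.
have s_neq0 (j : 'I_(size s)) : (s`_j != 0)%R.
  by have := mem_nth 0%R (ltn_ord j); rewrite mem_filter => /andP[].
have s_val (j : 'I_(size s)) : exists x, v x = (s`_j)%R.
  have := mem_nth 0%R (ltn_ord j); rewrite mem_filter => /andP[_].
  rewrite in_fset_set; last exact: fimfunP.
  by rewrite inE => -[x _ <-]; exists x.
have s01 (j : 'I_(size s)) : (0 <= s`_j <= 1)%R.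
  by have [x <-] := s_val j; rewrite v1 andbT.
have mB j : measurable (B j) by exact: measurable_sfunP.
have Boo j : area (B j) < +oo.
  apply: le_lt_trans Doo; apply: le_measure; rewrite ?inE// => x Bx.
  by apply: contrapT => /vD vx0; move: (s_neq0 j); rewrite -[X in X != _]Bx vx0 eqxx.
have tB : trivIset setT B.
  apply/trivIsetP => i j _ _ ij; apply/seteqP; split => // x [/= Bi Bj].
  move/negP: ij; apply; apply/eqP/val_inj/eqP.
  by rewrite -(nth_uniq 0%R (ltn_ord i) (ltn_ord j) us) -Bi -Bj.
have nB x (j : 'I_(size s)) : v x = 0%R -> x \notin B j.
  by move=> vx0; apply/negP; rewrite inE /B /= vx0 => /esym/eqP; exact/negP.
have inB x (j : 'I_(size s)) : v x = (s`_j)%R ->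
    forall i, (x \in B i) = (i == j).
  move=> vxj i; apply/idP/eqP => [|->]; last by rewrite inE.
  rewrite inE /B /= vxj => /eqP; rewrite nth_uniq// => /eqP ij.
  exact/esym/val_inj.
have val_cases x : v x = 0%R \/ exists j : 'I_(size s), v x = (s`_j)%R.
  have [->|vx] := eqVneq (v x) 0%R; [by left|right].
  have i_lt : (index (v x) s < size s)%N by rewrite index_mem smem.
  by exists (Ordinal i_lt); rewrite nth_index// smem.
rewrite (@step_pgfl _ _ _ Q X mX Qoo lam lam_ge0 PPP_Q _ B (fun j => 1 - s`_j)%R)//.
- congr (_ * _); rewrite -[RHS]/(expeR (- _)).
  have -> : \int[area]_x (v x)%:E =
      (\sum_(j < size s) s`_j * fine (area (B j)))%R%:E.
    transitivity (\int[area]_x (\sum_(j < size s) (s`_j)%:E * (\1_(B j) x)%:E)).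
      apply: eq_integral => x _; rewrite -[RHS]/(\sum_(j < size s) (s`_j * \1_(B j) x)%:E).
      rewrite sumEFin; congr EFin.
      have [vx0|[j vxj]] := val_cases x.
        by rewrite vx0 big1// => j _; rewrite indicE (negbTE (nB x j vx0)) mulr0.
      rewrite (bigD1 j)//= big1 ?addr0.
        by rewrite indicE (inB _ _ vxj) eqxx mulr1.
      by move=> i ij; rewrite indicE (inB _ _ vxj) (negbTE ij) mulr0.
    rewrite ge0_integral_sum//; last 2 first.
    + by move=> j; apply: measurable_funeM; exact/measurable_EFinP/measurable_indic.
    + by move=> j x _; rewrite -EFinM lee_fin mulr_ge0//; case/andP: (s01 j).
    rewrite -sumEFin; apply: eq_bigr => j _; case/andP: (s01 j) => s0 _.
    rewrite ge0_integralZl_EFin//; last exact/measurable_EFinP/measurable_indic.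
    by rewrite integral_indic// setIT EFinM fineK// ge0_fin_numE.
  rewrite -EFinM/=; congr (expR (- (_ * _)))%:E.
  by apply: eq_bigr => j _; congr (_ * _)%R; ring.
- by move=> j; case/andP: (s01 j) => ? ?; apply/andP; split; lra.
- move=> x; have [vx0|[j vxj]] := val_cases x.
    by rewrite vx0 subr0 big1// => j _; rewrite (negbTE (nB x j vx0)).
  rewrite (bigD1 j)//= (inB _ _ vxj) eqxx big1 ?mulr1 ?vxj//.
  by move=> i ij; rewrite (inB _ _ vxj) (negbTE ij).
Qed.

End probability_generating_functional.

Section probability_generating_functional.
Context d (Omega : measurableType d) (R : realType).
Variable Q : {measure set Omega -> \bar R}.
Variable X : nat -> Omega -> R * R.
Hypothesis mX : forall i, measurable_fun setT (X i).
Hypothesis Qoo : Q setT < +oo.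
Variable lam : R.
Hypothesis lam_ge0 : (0 <= lam)%R.
Hypothesis PPP_Q : forall (n : nat) (B : 'I_n -> set (R * R)) (k : 'I_n -> nat),
    (forall j, measurable (B j)) -> (forall j, area (B j) < +oo) ->
    trivIset setT B ->
    Q [set w | forall j, point_count X (B j) w = (k j)%:R%:E] =
    Q setT * (\prod_(j < n) poisson_mass (lam * fine (area (B j))) (k j))%:E.

Let box (n : nat) : set (R * R) :=
  (`[(- n%:R)%R, n%:R%R]%classic : set R) `*` `[(- n%:R)%R, n%:R%R]%classic.

Let measurable_box n : measurable (box n).
Proof. by apply: measurableX; exact: measurable_itv. Qed.

Let area_box n : area (box n) < +oo.
Proof.
have itvoo : lebesgue_measure (`[(- n%:R)%R, n%:R%R]%classic : set R) < +oo.
  by rewrite lebesgue_measure_itv/=; case: ifP => _; rewrite ?ltry// -EFinB ltry.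
by rewrite areaX// lte_mul_pinfty// ge0_fin_numE.
Qed.

Let near_box x : \forall n \near \oo, box n x.
Proof.
have nx (y : R) : \forall n \near \oo, (`|y| <= n%:R)%R.
  exact: nbhs_infty_ger.
near=> n; split => /=; rewrite in_itv/= -ler_norml; near: n; exact: nx.
Unshelve. all: by end_near. Qed.

Import HBNNSimple.

(** [1 - f] is approximated from below by simple functions [v k] cut off to growing boxes, so that
    [fk k] decreases to [f]. The two inequalities need different arguments, since limits in [k] and
    in the number of factors cannot simply be exchanged. *)
Lemma ppp_pgfl_lim (f : R * R -> R) : measurable_fun setT f ->
  (forall x, (0 <= f x <= 1)%R) ->
  \int[Q]_w (limn (running_prod X f ^~ w))%:E =
  Q setT * expeR (- (lam%:E * \int[area]_x (1 - f x)%:E)).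
Proof.
move=> mf f01.
pose h x := (1 - f x)%:E : \bar R.
have mh : measurable_fun setT h.
  by apply/measurable_EFinP; apply: measurable_funB.
have h0 x : 0 <= h x by rewrite lee_fin; case/andP: (f01 x); lra.
have h1 x : h x <= 1 by rewrite lee_fin; case/andP: (f01 x); lra.
pose g := nnsfun_approx measurableT mh.
pose v n : {nnsfun (R * R) >-> R} := mul_nnsfun (g n) (indic_nnsfun R (measurable_box n)).
have vE n x : (v n x = g n x * \1_(box n) x)%R by [].
have g_le n x : (g n x)%:E <= h x.
  by rewrite /g nnsfun_approxE; apply: le_approx.
have v_le_g n x : (v n x <= g n x)%R.
  by rewrite vE indicE; case: (_ \in _); rewrite ?mulr1// mulr0.
have v_le n x : (v n x)%:E <= h x.
  by apply: le_trans (g_le n x); rewrite lee_fin.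
have v1 n x : (v n x <= 1)%R by rewrite -lee_fin (le_trans (v_le n x)).
have v_nd x : {homo (fun n => (v n x)%:E : \bar R) : m n / (m <= n)%N >-> m <= n}.
  move=> m n mn; rewrite lee_fin !vE ler_pM//.
    exact/lefP/nd_nnsfun_approx.
  rewrite !indicE; case: (boolP (x \in box m)) => //; rewrite !inE => -[xm1 xm2].
  rewrite mem_set//=; split; move: xm1 xm2; rewrite /= !in_itv/= -!ler_norml => a b;
    [apply: le_trans a _|apply: le_trans b _]; by rewrite ler_nat.
have v_cvg x : (v n x)%:E @[n --> \oo] --> h x.
  have gh : (g n x)%:E @[n --> \oo] --> h x by exact: cvg_nnsfun_approx.
  apply: cvg_trans gh; apply: near_eq_cvg.
  have := near_box x; apply: filterS => n xn.
  by rewrite vE indicE mem_set// mulr1.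
pose fk k x := (1 - v k x)%R.
have v0 n x : (0 <= v n x)%R by exact: fun_ge0.
have fk01 k x : (0 <= fk k x <= 1)%R.
  by rewrite /fk subr_ge0 v1 gerBl v0.
have mfk k : measurable_fun setT (fk k) by exact: measurable_funB.
have f_le_fk k x : (f x <= fk k x)%R.
  by move: (v_le k x); rewrite lee_fin /fk; lra.
have fkE k : \int[Q]_w (limn (running_prod X (fk k) ^~ w))%:E =
    Q setT * expeR (- (lam%:E * \int[area]_x (v k x)%:E)).
  apply: (@simple_pgfl _ _ _ Q X mX Qoo lam lam_ge0 PPP_Q _ (box k)) => //.
  by move=> x xk; rewrite vE indicE memNset ?mulr0.
have int_v_cvg : \int[area]_x (v k x)%:E @[k --> \oo] --> \int[area]_x h x.
  have -> : h = (fun x => limn (fun k => (v k x)%:E)).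
    by apply/funext => x; apply/esym/cvg_lim.
  apply: cvg_monotone_convergence => //.
  - by move=> n; exact/measurable_EFinP.
  - by move=> n x _; rewrite lee_fin.
have int_v_le k : \int[area]_x (v k x)%:E <= \int[area]_x h x.
  by apply: ge0_le_integral => //; [move=> x _; rewrite lee_fin|exact/measurable_EFinP].
set I := \int[Q]_w (limn (running_prod X f ^~ w))%:E.
set M := \int[area]_x h x.
have lim01 (F : R * R -> R) w : (forall x, (0 <= F x <= 1)%R) ->
    (0 <= limn (running_prod X F ^~ w))%R.
  move=> F01; apply: limr_ge; first exact: cvg_running_prod.
  by apply: nearW => n; case/andP: (running_prod01 X n w F01).
have I_le k : I <= Q setT * expeR (- (lam%:E * \int[area]_x (v k x)%:E)).
  rewrite -fkE; apply: ge0_le_integral => //.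
  - by move=> w _; rewrite lee_fin lim01.
  - exact/measurable_EFinP/measurable_lim_running_prod.
  - exact/measurable_EFinP/measurable_lim_running_prod.
  move=> w _; rewrite lee_fin; apply: ler_lim; [exact: cvg_running_prod..|].
  apply: nearW => n; apply: ler_prod => i _; rewrite f_le_fk andbT.
  by case/andP: (f01 (X i w)).
(* Lower bound: with the number [n] of factors fixed, [k] tends to infinity first. Each finite
   product for [fk k] dominates the infinite one, whose integral is known and is at least the
   claimed value; only then does [n] grow. *)
apply/eqP; rewrite eq_le; apply/andP; split; last first.
  apply: (cvge_to_ge (cvg_integral_running_prod mX Qoo mf f01)).
  apply: nearW => n.
  have cvgk : \int[Q]_w (running_prod X (fk k) n w)%:E @[k --> \oo] -->
      \int[Q]_w (running_prod X f n w)%:E.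
    apply: bounded_cvg_integral => //.
    - by move=> k; exact: measurable_running_prod.
    - by move=> k w; exact: running_prod01.
    - move=> w; rewrite /running_prod; apply: cvg_prodr => i.
      have := fine_cvg (v_cvg (X i w)).
      rewrite /h/= => vf; rewrite -[f (X i w)](subKr 1%R); apply: cvgB.
        exact: cvg_cst.
      exact: vf.
  apply: (cvge_to_ge cvgk); apply: nearW => k.
  apply: (@le_trans _ _ (\int[Q]_w (limn (running_prod X (fk k) ^~ w))%:E)).
    rewrite fkE lee_wpmul2l// lee_expeR leeN2 lee_wpmul2l//.
  apply: ge0_le_integral => //.
  - by move=> w _; rewrite lee_fin lim01.
  - exact/measurable_EFinP/measurable_lim_running_prod.
  - exact/measurable_EFinP/measurable_running_prod.
  - by move=> w _; rewrite lee_fin running_prod_lim_le.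
have I0 : 0 <= I by apply: integral_ge0 => w _; rewrite lee_fin lim01.
have [Q0|Q0] := eqVneq (Q setT) 0.
  by move: (I_le 0%N); rewrite Q0 !mul0e.
have Qgt0 : 0 < Q setT by rewrite lt0e Q0/=.
(* Upper bound: with the normalized integral written as [expeR y], the inequalities [I_le] become
   upper bounds [- y] for the area integrals of the [v k], and these pass to the limit even when it
   is infinite. *)
have [|y yE] := @expeR_total R (I / Q setT).
  by rewrite mule_ge0// inve_ge0.
have IE : I = Q setT * expeR y.
  by rewrite yE muleCA divee ?mule1// ge0_fin_numE.
have y_le k : lam%:E * \int[area]_x (v k x)%:E <= - y.
  have := I_le k; rewrite IE lee_pmul2l//; last by rewrite ge0_fin_numE.
  by rewrite lee_expeR leeNr.
rewrite IE lee_wpmul2l// lee_expeR leeNr.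
have := cvgeZl (erefl : lam%:E \is a fin_num) int_v_cvg.
by move=> c; apply: (cvge_to_le c); exact: nearW.
Qed.

Lemma ppp_pgfl (f : R * R -> R) : measurable_fun setT f ->
  (forall x, (0 <= f x <= 1)%R) ->
  \int[Q]_w (running_prod X f n w)%:E @[n --> \oo] -->
  Q setT * expeR (- (lam%:E * \int[area]_x (1 - f x)%:E)).
Proof. by move=> mf f01; rewrite -ppp_pgfl_lim//; exact: cvg_integral_running_prod. Qed.

End probability_generating_functional.

(** The restricted measure is the measure with density [\1_D]. *)
Lemma ge0_integral_mrestr d (T : measurableType d) (R : realType)
    (mu : {measure set T -> \bar R}) (D : set T) (mD : measurable D)
    (g : T -> \bar R) : measurable_fun setT g -> (forall x, 0 <= g x) ->
  \int[mrestr mu mD]_x g x = \int[mu]_(x in D) g x.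
Proof.
move=> mg g0.
have m1 : measurable_fun setT (\1_D : T -> R) by exact: measurable_indic.
have ge01 x : (0 <= (\1_D : T -> R) x)%R by [].
have -> : \int[mu]_(x in D) g x = \int[density mu m1 ge01]_x g x.
  rewrite ge0_integral_density// integral_mkcond.
  apply: eq_integral => x _; rewrite /patch indicE.
  by case: ifP; rewrite ?mule1 ?mule0.
apply: eq_measure_integral => A mA _ /=.
by rewrite /density integral_indic// setIC.
Qed.

Section ppp_pgfl_probability.
Context d (Omega : measurableType d) (R : realType).
Variables (P : probability Omega R) (X : nat -> Omega -> R * R) (lam : R).
Hypothesis mX : forall i, measurable_fun setT (X i).
Hypothesis lam_ge0 : (0 <= lam)%R.

Lemma ppp_pgfl_probability (f : R * R -> R) :
  homogeneous_PPP P lam X -> measurable_fun setT f ->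
  (forall x, (0 <= f x <= 1)%R) ->
  \int[P]_w (running_prod X f n w)%:E @[n --> \oo] -->
  expeR (- (lam%:E * \int[area]_x (1 - f x)%:E)).
Proof.
move=> hX mf f01.
have PT : P setT = 1 by exact: probability_setT.
rewrite -[expeR _]mul1e -PT.
apply: ppp_pgfl => //; first by rewrite ltey_eq fin_num_measure.
move=> n B k mB Boo tB; apply: etrans (hX n B k mB Boo tB) _.
by rewrite -[LHS]mul1e; congr (_ * _); exact/esym/PT.
Qed.

(** [cond_prob] is a bare set function, so the functional is applied to the restriction of [P] to
    [D], a measure of mass [P D]. *)
Lemma ppp_pgfl_cond (D : set Omega) (f : R * R -> R) : measurable D -> P D != 0 ->
  homogeneous_PPP (cond_prob P D) lam X -> measurable_fun setT f ->
  (forall x, (0 <= f x <= 1)%R) ->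
  \int[P]_(w in D) (running_prod X f n w)%:E @[n --> \oo] -->
  P D * expeR (- (lam%:E * \int[area]_x (1 - f x)%:E)).
Proof.
move=> mD PD0 hX mf f01.
have -> : P D = mrestr P mD setT by rewrite /mrestr setTI.
under eq_fun => n.
  rewrite -(ge0_integral_mrestr P mD); last 2 first.
  - exact/measurable_EFinP/measurable_running_prod.
  - by move=> w; rewrite lee_fin; case/andP: (running_prod01 X n w f01).
  over.
apply: ppp_pgfl => //.
  by rewrite /= /mrestr setTI ltey_eq fin_num_measure.
move=> n B k mB Boo tB; have := hX n B k mB Boo tB.
set S := [set w | _] => hS; rewrite -hS.
change (P (S `&` D) = P (setT `&` D) * (P (S `&` D) / P D)).
by rewrite setTI muleCA divee ?mule1// fin_num_measure.
Qed.

End ppp_pgfl_probability.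

(** * Marks and types *)

Section independent_marks.
Context d (Omega : measurableType d) (R : realType) d' (U : measurableType d').
Variables (P : probability Omega R) (nu : probability U R).
Variables (G : set (set Omega)).
Hypothesis G_measurable : G `<=` measurable.
Hypothesis G_setI : setI_closed G.
Variables (n : nat) (H : 'I_n -> Omega -> U) (W : 'I_n -> Omega -> R).
Hypothesis mH : forall j, measurable_fun setT (H j).
Hypothesis GW : forall j B, measurable B -> G (W j @^-1` B).
Hypothesis indep : forall (B : 'I_n -> set U) A, G A ->
  (forall j, measurable (B j)) ->
  P (A `&` [set w | forall j, B j (H j w)]) = P A * \prod_j nu (B j).
Variables (phi : R * U -> R) (mean_phi : R -> R).
Hypothesis mphi : measurable_fun setT phi.
Hypothesis phi01 : forall x, (0 <= phi x <= 1)%R.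
Hypothesis mmean : measurable_fun setT mean_phi.
Hypothesis mean01 : forall x, (0 <= mean_phi x <= 1)%R.
Hypothesis meanE : forall x, \int[nu]_h (phi (x, h))%:E = (mean_phi x)%:E.

Let mW j : measurable_fun setT (W j).
Proof. by move=> _ B mB; rewrite setTI; apply: G_measurable; exact: GW. Qed.

Local Notation cylinder A e :=
  (A `&` [set w | forall j B, e j = Some B -> B (H j w)]).

Let measurable_cylinder A (e : 'I_n -> option (set U)) : measurable A ->
  (forall j B, e j = Some B -> measurable B) -> measurable (cylinder A e).
Proof.
move=> mA me; apply: measurableI => //.
rewrite [X in measurable X](_ : _ = \bigcap_(j in [set: 'I_n])
  (if e j is Some B then H j @^-1` B else setT)).
  apply: fin_bigcap_measurable => // j _.
  case E : (e j) => [B|//]; rewrite -[X in measurable X]setTI; apply: mH => //.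
  exact: me E.
apply/seteqP; split => [w ew j _ | w ew j B ejB].
  by case E : (e j) => [B|//]; exact: ew.
by have := ew j I; rewrite ejB.
Qed.

Let mprod (f : 'I_n -> Omega -> R) (Q : pred 'I_n) :
  (forall j, measurable_fun setT (f j)) ->
  measurable_fun setT (fun w => \prod_(j | Q j) f j w)%R.
Proof.
move=> mf.
rewrite (_ : (fun _ => _) = (fun w => \prod_j (if Q j then f j w else 1))%R).
  by apply: measurable_prod => j _; case: (Q j).
by apply/funext => w; rewrite big_mkcond.
Qed.

Let mphiWH j : measurable_fun setT (fun w => phi (W j w, H j w)).
Proof. by apply: (measurableT_comp mphi); exact: measurable_fun_pair. Qed.

Let mmeanW j : measurable_fun setT (fun w => mean_phi (W j w)).
Proof. exact: (measurableT_comp mmean). Qed.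

(** An index with [e j = Some B] only records that its mark lies in [B]; the others carry a factor,
    and the induction is on their number. To release [j0], the measure weighted by the remaining
    factors is tested on the events [W j0] in [B] and [H j0] in [C]: this is the induction
    hypothesis with [j0] frozen at [C] and [A] cut by a preimage under [W j0], whence the closure of
    [G] under intersection. The test shows that the mark [j0] can be integrated against [nu]. *)
Lemma integral_cylinder_marks A (e : 'I_n -> option (set U)) : G A ->
  (forall j B, e j = Some B -> measurable B) ->
  \int[P]_(w in cylinder A e) (\prod_(j | e j == None) phi (W j w, H j w))%R%:E =
  (\prod_j (if e j is Some B then fine (nu B) else 1))%R%:E *
  \int[P]_(w in A) (\prod_(j | e j == None) mean_phi (W j w))%R%:E.
Proof.
have prod0 (f : 'I_n -> R) (Q : pred 'I_n) : (forall j, (0 <= f j <= 1)%R) ->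
    (0 <= \prod_(j | Q j) f j <= 1)%R.
  move=> f01; rewrite prodr_ge0 => [|j _]; last by case/andP: (f01 j).
  by apply: prodr_ile1 => j _; exact: f01.
have [k] := ubnP #|[pred j | e j == None]|.
elim: k e A => // k IH e A; rewrite ltnS => en GA me.
have mA : measurable A by exact: G_measurable.
have [j0 /= ej0|eS] := pickP [pred j | e j == None]; last first.
  pose B j := if e j is Some B then B else setT.
  have eE j : e j = Some (B j) by move: (eS j); rewrite /B /=; case: (e j).
  rewrite (eq_integral (cst 1)); last by move=> w _; rewrite /= big_pred0.
  rewrite [in RHS](eq_integral (cst 1)); last by move=> w _; rewrite /= big_pred0.
  rewrite !integral_cst//; last exact: measurable_cylinder.
  rewrite !mul1e.
  rewrite (_ : cylinder A e = A `&` [set w | forall j, B j (H j w)]); last first.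
    congr (_ `&` _); apply/seteqP; split => [w ew j | w ew j C]; first exact: (ew j _ (eE j)).
    by rewrite eE => -[<-].
  have mB j : measurable (B j) by exact: me (eE j).
  apply: (etrans (indep GA mB)).
  rewrite muleC; congr (_ * _); rewrite -prodEFin; apply: eq_bigr => j _.
  by rewrite (eE j) fineK// fin_num_measure.
pose e' C j := if j == j0 then Some C else e j.
have e'None C j : (e' C j == None) = (e j == None) && (j != j0).
  by rewrite /e'; case: (eqVneq j j0) => [->|]; rewrite ?andbF ?andbT.
pose c := (\prod_j (if e j is Some B then fine (nu B) else 1))%R.
have c0 : (0 <= c)%R by apply: prodr_ge0 => j _; case: (e j) => // B; rewrite fine_ge0.
have e'c C : (\prod_j (if e' C j is Some B then fine (nu B) else 1) =
    fine (nu C) * c)%R.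
  rewrite /c (bigD1 j0)//= [in RHS](bigD1 j0)//= {1}/e' eqxx (eqP ej0) mul1r.
  by congr (_ * _)%R; apply: eq_bigr => j jj0; rewrite /e' (negbTE jj0).
pose Q j := (e j == None) && (j != j0).
pose f1 w := (\1_(cylinder A e) w * \prod_(j | Q j) phi (W j w, H j w))%R.
pose f2 w := (\1_A w * (c * \prod_(j | Q j) mean_phi (W j w)))%R.
have mcyl := measurable_cylinder mA me.
have mf1 : measurable_fun setT f1.
  by apply: measurable_funM; [exact: measurable_indic|exact: mprod].
have mf2 : measurable_fun setT f2.
  apply: measurable_funM; first exact: measurable_indic.
  by apply: measurable_funM => //; exact: mprod.
have f1_ge0 w : (0 <= f1 w)%R.
  by rewrite mulr_ge0//;
    have /andP[] := prod0 (fun j => phi (W j w, H j w)) Q (fun j => phi01 (W j w, H j w)).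
have f2_ge0 w : (0 <= f2 w)%R.
  by rewrite !mulr_ge0//;
    have /andP[] := prod0 (fun j => mean_phi (W j w)) Q (fun j => mean01 (W j w)).
have int_indic (D E : set Omega) (g : Omega -> R) : measurable D ->
    \int[P]_(w in E) (\1_D w * g w)%:E = \int[P]_(w in D `&` E) (g w)%:E.
  move=> mD; rewrite setIC integral_mkcondr; apply: eq_integral => w _.
  by rewrite /patch indicE; case: ifP => _; rewrite ?mul1r ?mul0r.
have f12 B C : measurable B -> measurable C ->
    \int[P]_(w in W j0 @^-1` B `&` H j0 @^-1` C) (f1 w)%:E =
    (\int[P]_(w in W j0 @^-1` B) (f2 w)%:E) * nu C.
  move=> mB mC.
  have me' : forall j D, e' C j = Some D -> measurable D.
    by move=> j D; rewrite /e'; case: eqP => [_ [<-]//|_]; exact: me.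
  have GAB : G (A `&` W j0 @^-1` B) by apply: G_setI => //; exact: GW.
  have e'Q (F : 'I_n -> R) : (\prod_(j | e' C j == None) F j = \prod_(j | Q j) F j)%R.
    by apply: eq_bigl => j; rewrite e'None.
  have cylE : cylinder A e `&` (W j0 @^-1` B `&` H j0 @^-1` C) =
      cylinder (A `&` W j0 @^-1` B) (e' C).
    apply/seteqP; split => [w [[Aw ew] [Bw Cw]]|w [[Aw Bw] ew]].
      by split => // j D; rewrite /e'; case: eqP => [-> [<-]//|_]; exact: ew.
    split; last by split => //; apply: (ew j0); rewrite /e' eqxx.
    split => // j D ejD; apply: (ew j); rewrite /e'.
    by case: eqP ejD => // ->; rewrite (eqP ej0).
  rewrite !int_indic// cylE.
  under eq_integral do rewrite -e'Q.
  rewrite IH//; last first.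
    apply: leq_trans en; apply: proper_card; apply/properP; split.
      by apply/fintype.subsetP => j; rewrite !inE e'None => /andP[].
    by exists j0; rewrite !inE // e'None eqxx andbF.
  under eq_integral do rewrite e'Q.
  under [in RHS]eq_integral do rewrite EFinM.
  rewrite ge0_integralZl_EFin//; last 3 first.
  - by apply: measurableI => //; exact/G_measurable/GW.
  - move=> w _; rewrite lee_fin.
    by have /andP[] := prod0 (fun j => mean_phi (W j w)) Q (fun j => mean01 (W j w)).
  - by apply/measurable_EFinP/measurable_funTS; exact: mprod.
  rewrite e'c EFinM fineK ?fin_num_measure// -muleA.
  by rewrite muleC.
have mEphi : measurable_fun setT (fun x => (phi x)%:E) by exact/measurable_EFinP.
have Ephi0 x : 0 <= (phi x)%:E by rewrite lee_fin; case/andP: (phi01 x).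
have f2oo : \int[P]_w (f2 w)%:E < +oo.
  apply: (@le_lt_trans _ _ (\int[P]_w (cst c%:E) w)); last first.
    by rewrite integral_cst// ltey_eq fin_numM// fin_num_measure.
  apply: ge0_le_integral => //.
  - by move=> w _; rewrite lee_fin.
  - exact/measurable_EFinP.
  - move=> w _; rewrite lee_fin /f2.
    have /andP[p0 p1] := prod0 (fun j => mean_phi (W j w)) Q (fun j => mean01 (W j w)).
    rewrite indicE; case: (w \in A); rewrite ?mul0r// mul1r.
    by rewrite ler_piMr.
transitivity (\int[P]_w ((phi (W j0 w, H j0 w))%:E * (f1 w)%:E)).
  rewrite -[in RHS](setIT setT) /f1.
  under [RHS]eq_integral.
    move=> w _; rewrite -EFinM mulrCA; over.
  rewrite setIT int_indic// setIT; apply: eq_integral => w _; congr EFin.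
  by rewrite (bigD1 j0).
rewrite (weighted_integral_indep mf1 mf2 f1_ge0 f2_ge0 (nu := nu) (mW j0) (mH j0)
  mEphi Ephi0 f2oo f12).
under eq_integral do rewrite meanE -EFinM mulrCA.
rewrite int_indic// setIT.
under eq_integral do rewrite mulrCA EFinM.
rewrite ge0_integralZl_EFin//; last 2 first.
- move=> w _; rewrite lee_fin mulr_ge0//; first by case/andP: (mean01 (W j0 w)).
  by have /andP[] := prod0 (fun j => mean_phi (W j w)) Q (fun j => mean01 (W j w)).
- apply/measurable_EFinP/measurable_funTS; apply: measurable_funM => //.
  exact: mprod.
congr (_ * _); apply: eq_integral => w _; congr EFin.
by rewrite [in RHS](bigD1 j0).

Qed.

Lemma integral_prod_marks A : G A ->
  \int[P]_(w in A) (\prod_j phi (W j w, H j w))%R%:E =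
  \int[P]_(w in A) (\prod_j mean_phi (W j w))%R%:E.
Proof.
move=> GA; have := @integral_cylinder_marks A (fun=> None) GA.
rewrite (_ : cylinder A _ = A); last by apply/seteqP; split => [w []|w Aw].
by move=> -> //; rewrite big1 ?mul1e.
Qed.

End independent_marks.

Section functions_of_positions.
Context d (Omega : measurableType d) (R : realType).
Variable X : nat -> Omega -> R * R.
Hypothesis mX : forall i, measurable_fun setT (X i).

Lemma position_events_measurable : <<s position_events X >> `<=` measurable.
Proof.
apply: smallest_sub; first exact: sigma_algebra_measurable.
by move=> _ [i [B [mB ->]]]; rewrite -[X in measurable X]setTI; exact: mX.
Qed.

Lemma position_measurable_fun i :
  measurable_fun setT (X i : g_sigma_algebraType (position_events X) -> R * R).
Proof.
move=> _ B mB; rewrite setTI; apply: sub_sigma_algebra.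
by exists i, B.
Qed.

Lemma position_event_prod n (g : 'I_n -> R * R -> R) (B : set R) :
  (forall j, measurable_fun setT (g j)) -> measurable B ->
  <<s position_events X >> ((fun w => \prod_(j < n) g j (X j w))%R @^-1` B).
Proof.
move=> mg mB; rewrite -[_ @^-1` _]setTI.
have mV : measurable_fun setT (fun w : g_sigma_algebraType (position_events X) =>
    (\prod_(j < n) g j (X j w))%R).
  apply: measurable_prod => j _.
  exact: (measurableT_comp (mg j) (@position_measurable_fun j)).
exact: mV measurableT B mB.
Qed.

End functions_of_positions.

Section random_types.
Context d (Omega : measurableType d) (R : realType).
Variables (P : probability Omega R) (D : set Omega).
Variables (X : nat -> Omega -> R * R) (T : nat -> Omega -> link_type).
Hypothesis mD : measurable D.
Hypothesis mX : forall i, measurable_fun setT (X i).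
Hypothesis mT : forall i u, measurable (T i @^-1` [set u]).
Variable q : link_type -> R * R -> R.
Hypothesis q_ge0 : forall u x, (0 <= q u x)%R.
Hypothesis mq : forall u, measurable_fun setT (q u).
Hypothesis type_law : forall n (v : 'I_n -> link_type) A,
  <<s position_events X >> A ->
  P (D `&` A `&` [set w | forall j : 'I_n, T j w = v j]) =
  \int[P]_(w in D `&` A) (\prod_(j < n) q (v j) (X j w))%R%:E.
Variable f : link_type -> R * R -> R.
Hypothesis mf : forall u, measurable_fun setT (f u).
Hypothesis f01 : forall u x, (0 <= f u x <= 1)%R.

(** Coding types by booleans makes the vectors of types a finite index set, over which a product of
    sums can be distributed. In this section the name hides the segment [link]. *)
Let link b := if b then LoS else NLoS.

Let measurable_types n (v : 'I_n -> link_type) :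
  measurable [set w | forall j : 'I_n, T j w = v j].
Proof.
rewrite [X in measurable X](_ : _ = \bigcap_(j in [set: 'I_n]) T j @^-1` [set v j]).
  by apply: fin_bigcap_measurable => // j _; exact: mT.
by apply/seteqP; split => [w ew j _|w ew j]; [exact: ew|exact: ew j I].
Qed.

Let prod_ge0 n (g : link_type -> R * R -> R) (v : 'I_n -> link_type) w :
  (forall u x, (0 <= g u x)%R) -> (0 <= \prod_(j < n) g (v j) (X j w))%R.
Proof. by move=> g0; apply: prodr_ge0. Qed.

Let mprod n (g : link_type -> R * R -> R) (v : 'I_n -> link_type) :
  (forall u, measurable_fun setT (g u)) ->
  measurable_fun setT (fun w => \prod_(j < n) g (v j) (X j w))%R.
Proof.
by move=> mg; apply: measurable_prod => j _; apply: (measurableT_comp (mg _)).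
Qed.

Let f_ge0 u x : (0 <= f u x)%R. Proof. by case/andP: (f01 u x). Qed.

(** The type law is applied to the position events that [V], the product to be integrated, takes its
    value in a set; this identifies two weighted laws of [V]. *)
Lemma integral_fixed_types n (v : 'I_n -> link_type) :
  \int[P]_(w in D `&` [set w | forall j : 'I_n, T j w = v j])
    (\prod_(j < n) f (v j) (X j w))%R%:E =
  \int[P]_(w in D) (\prod_(j < n) (q (v j) (X j w) * f (v j) (X j w)))%R%:E.
Proof.
set E := [set w | _]; have mE : measurable E by exact: measurable_types.
have mDE : measurable (D `&` E) by exact: measurableI.
pose V w := (\prod_(j < n) f (v j) (X j w))%R.
have mV : measurable_fun setT V by exact: mprod.
have V0 w : (0 <= V w)%R by exact: prod_ge0.
pose f1 w := (\1_(D `&` E) w : R).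
pose f2 w := (\1_D w * \prod_(j < n) q (v j) (X j w))%R.
have mf1 : measurable_fun setT f1 by exact: measurable_indic.
have mf2 : measurable_fun setT f2.
  by apply: measurable_funM; [exact: measurable_indic|exact: mprod].
have f1_ge0 w : (0 <= f1 w)%R by rewrite /f1.
have f2_ge0 w : (0 <= f2 w)%R by rewrite mulr_ge0// prod_ge0.
(* The comparison of weighted laws wants a function nonnegative on the whole line; the absolute
   value is harmless because [V] is nonnegative. *)
have mF : measurable_fun setT (fun y : R => `|y|%:E).
  by apply/measurable_EFinP; exact: normr_measurable.
have F0 (y : R) : 0 <= `|y|%:E by rewrite lee_fin.
have f12 B : measurable B ->
    \int[P]_(w in V @^-1` B) (f1 w)%:E = \int[P]_(w in V @^-1` B) (f2 w)%:E.
  move=> mB; have mVB : measurable (V @^-1` B).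
    by rewrite -[X in measurable X]setTI; exact: mV.
  rewrite integral_indic// setIAC.
  have pV : <<s position_events X >> (V @^-1` B).
    exact: (@position_event_prod _ _ _ X n (fun j => f (v j))).
  apply: (etrans (type_law v pV)).
  rewrite setIC integral_mkcondr; apply: eq_integral => w _.
  by rewrite /f2 /patch indicE; case: ifP; rewrite ?mul1r ?mul0r.
have := eq_weighted_integral mf1 mf2 f1_ge0 f2_ge0 mV mF F0 f12.
under eq_integral do rewrite ger0_norm// -EFinM mulrC.
under [X in _ = X -> _]eq_integral do rewrite ger0_norm// -EFinM mulrCA.
have int_indic (C : set Omega) (g : Omega -> R) : measurable C ->
    \int[P]_w (\1_C w * g w)%:E = \int[P]_(w in C) (g w)%:E.
  move=> mC; rewrite [RHS]integral_mkcond; apply: eq_integral => w _.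
  by rewrite /patch indicE; case: ifP => _; rewrite ?mul1r ?mul0r.
rewrite !int_indic// => ->; apply: eq_integral => w _; congr EFin.
by rewrite /V -big_split/=; apply: eq_bigr => j _; rewrite mulrC.
Qed.

(** The integrand is split along the vectors of types, each piece is integrated by the conditional
    law, and distributivity folds the sum back into a product of two-term sums. *)
Lemma integral_prod_types n :
  \int[P]_(w in D) (\prod_(j < n) f (T j w) (X j w))%R%:E =
  \int[P]_(w in D) (\prod_(j < n)
    (q LoS (X j w) * f LoS (X j w) + q NLoS (X j w) * f NLoS (X j w)))%R%:E.
Proof.
pose E (v : {ffun 'I_n -> bool}) : set Omega :=
  [set w | forall j : 'I_n, T j w = link (v j)].
have mE v : measurable (E v) by exact: (measurable_types (fun j => link (v j))).
transitivity (\int[P]_(w in D) \sum_(v : {ffun 'I_n -> bool})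
    (\1_(E v) w * \prod_(j < n) f (link (v j)) (X j w))%R%:E).
  apply: eq_integral => w _; rewrite sumEFin; congr EFin.
  transitivity (\prod_(j < n) \sum_(b : bool)
      (if `[< T j w = link b >] then 1 else 0) * f (link b) (X j w))%R.
    apply: eq_bigr => j _; rewrite big_bool/= /link.
    case: (T j w); case: asboolP => // _; case: asboolP => // _;
      by rewrite ?mul1r ?mul0r ?addr0 ?add0r.
  rewrite bigA_distr_bigA; apply: eq_bigr => v _; rewrite big_split/=.
  congr (_ * _)%R; rewrite indicE; case: (boolP (w \in E v)) => [|].
    rewrite inE => Ev; rewrite big1// => j _.
    by case: asboolP => //; rewrite Ev.
  rewrite notin_setE => /existsNP[j Tj]; rewrite (bigD1 j)//=.
  by case: asboolP => // _; rewrite mul0r.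
transitivity (\sum_(v : {ffun 'I_n -> bool}) \int[P]_(w in D)
    (\prod_(j < n) (q (link (v j)) (X j w) * f (link (v j)) (X j w)))%R%:E).
  rewrite ge0_integral_sum//; last 2 first.
  - move=> v; apply/measurable_EFinP/measurable_funTS.
    apply: measurable_funM; first exact: measurable_indic.
    exact: (@mprod n f (fun j => link (v j))).
  - by move=> v w _; rewrite lee_fin mulr_ge0// (@prod_ge0 n f (fun j => link (v j))).
  apply: eq_bigr => v _; rewrite -(integral_fixed_types (fun j => link (v j))).
  rewrite [RHS]integral_mkcondr; apply: eq_integral => w _.
  by rewrite /patch indicE; case: ifP => _; rewrite ?mul1r ?mul0r.
have g_ge0 u x : (0 <= q u x * f u x)%R by rewrite mulr_ge0.
rewrite -ge0_integral_sum//; last 2 first.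
- move=> v; apply/measurable_EFinP/measurable_funTS.
  apply: (@mprod n (fun u x => q u x * f u x)%R (fun j => link (v j))) => u.
  exact: measurable_funM.
- move=> v w _.
  by rewrite lee_fin (@prod_ge0 n (fun u x => q u x * f u x)%R (fun j => link (v j))).
apply: eq_integral => w _; rewrite sumEFin; congr EFin.
pose F (j : 'I_n) b := (q (link b) (X j w) * f (link b) (X j w))%R.
rewrite -(bigA_distr_bigA F); apply: eq_bigr => j _.
by rewrite big_bool.
Qed.

End random_types.

(** * Polar coordinates *)

Section change_of_variable.
Context (R : realType).
Local Notation mu := (@lebesgue_measure R).

(** The hypothesis on intervals says that the image under [g] of the measure with density [w] agrees
    with Lebesgue measure on half-open intervals, so the two coincide. The Jacobian enters only
    through these values. *)
Lemma ge0_change_of_variable (g : measurableTypeR R -> measurableTypeR R)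
    (w : measurableTypeR R -> R) (G : measurableTypeR R -> \bar R) :
  measurable_fun setT g -> measurable_fun setT w -> (forall x, (0 <= w x)%R) ->
  (forall a b : R, (a < b)%R ->
    \int[mu]_(x in g @^-1` `]a, b]) (w x)%:E = (b - a)%:E) ->
  measurable_fun setT G -> (forall y, 0 <= G y) ->
  \int[mu]_y G y = \int[mu]_x (G (g x) * (w x)%:E).
Proof.
move=> mg mw w0 gw mG G0.
have [m mE] := ex_pushforward_measure (density mu mw w0) mg.
have muE A : measurable A -> mu A = m A.
  apply: lebesgue_measure_unique => _ [[a b] /= _ <-].
  have [ab|ba] := ltP a b; last first.
    by rewrite set_itv_ge ?bnd_simp -?leNgt// !measure0.
  rewrite mE lebesgue_measure_itv/= lte_fin ab -EFinB; exact/esym/gw.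
rewrite (eq_measure_integral m); last by move=> A mA _; exact: muE.
have mGg : measurable_fun setT (G \o g) by exact: measurableT_comp.
rewrite -(ge0_integral_density mu mw w0 mGg); last by move=> x; exact: G0.
rewrite -[RHS](@ge0_integral_pushforward _ _ _ _ _ g mg (density mu mw w0) setT G)//.
by apply: eq_measure_integral => A mA _; rewrite mE.
Qed.

Lemma ge0_integral_scale (c : R) (G : R -> \bar R) : (0 < c)%R ->
  measurable_fun setT G -> (forall y, 0 <= G y) ->
  \int[mu]_y G y = \int[mu]_x (G (c * x)%R * c%:E).
Proof.
move=> c0 mG G0.
apply: (@ge0_change_of_variable (fun x => c * x)%R (cst c)) => //.
- exact: mulrl_measurable.
- by move=> x; exact: ltW.
move=> a b ab; rewrite (_ : _ @^-1` _ = `](a / c)%R, (b / c)%R]%classic); last first.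
  apply/seteqP; split => x /=; rewrite !in_itv/= ltr_pdivrMr// ler_pdivlMr//;
    by rewrite mulrC.
rewrite (eq_integral (cst c%:E))// integral_cst//= lebesgue_measure_itv/= lte_fin.
rewrite ltr_pM2r ?invr_gt0// ab.
by rewrite -EFinB -EFinM; congr EFin; field; exact: lt0r_neq0.
Qed.

Lemma ge0_integral_opp (G : R -> \bar R) :
  measurable_fun setT G -> (forall y, 0 <= G y) ->
  \int[mu]_y G y = \int[mu]_x (G (- x)%R).
Proof.
move=> mG G0.
rewrite (@ge0_change_of_variable -%R (cst 1%R) G)//.
- by apply: eq_integral => x _; rewrite mule1.
move=> a b ab; rewrite (_ : _ @^-1` _ = `[(- b)%R, (- a)%R[%classic); last first.
  apply/seteqP; split => x /=; rewrite !in_itv/= => /andP[? ?];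
    by apply/andP; split; lra.
rewrite (eq_integral (cst 1))// integral_cst//= lebesgue_measure_itv/= lte_fin ltrN2 ab.
by rewrite -EFinB -EFinM; congr EFin; ring.
Qed.

Lemma ge0_integral_shift (c : R) (G : R -> \bar R) :
  measurable_fun setT G -> (forall y, 0 <= G y) ->
  \int[mu]_y G y = \int[mu]_x (G (x + c)%R).
Proof.
move=> mG G0.
rewrite (@ge0_change_of_variable (fun x => x + c)%R (cst 1%R) G)//.
- by apply: eq_integral => x _; rewrite mule1.
- exact: measurable_funD.
move=> a b ab; rewrite (_ : _ @^-1` _ = `](a - c)%R, (b - c)%R]%classic); last first.
  apply/seteqP; split => x /=; rewrite !in_itv/= => /andP[? ?];
    by apply/andP; split; lra.
rewrite (eq_integral (cst 1))// integral_cst//= lebesgue_measure_itv/= lte_fin ltrD2r ab.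
by rewrite -EFinB -EFinM; congr EFin; ring.
Qed.

Let D : set R := `](- (pi / 2))%R, (pi / 2)%R[%classic.

Let mD : measurable D. Proof. exact: measurable_itv. Qed.

Let cosD x : D x -> (0 < cos x)%R.
Proof. by rewrite /D/= in_itv/= => /cos_gt0_pihalf. Qed.

Let continuous_sec2 (x : R) : (cos x != 0)%R ->
  {for x, continuous (fun y => (cos y)^-2 : R)%R}.
Proof.
move=> cx; have c2 : {for x, continuous (fun y => cos y * cos y : R)%R}.
  by apply: continuousM; exact: continuous_cos.
have cx2 : (cos x * cos x != 0)%R by rewrite mulf_neq0.
have h := @continuousV R R _ x cx2 c2.
exact: h.
Qed.

(** The tangent, and below its derivative, are extended by zero in order to be total measurable
    functions; the weight then discards all angles outside [D]. *)
Definition tan_pihalf_itv : R -> R := tan \_ D.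

Definition sec2_pihalf_itv : R -> R := (fun x => (cos x)^-2)%R \_ D.

Lemma measurable_tan_pihalf_itv : measurable_fun setT tan_pihalf_itv.
Proof.
apply/(measurable_restrictT _ mD); apply: open_continuous_measurable_fun.
  exact: interval_open.
by move=> x /set_mem Dx; apply: continuous_tan; rewrite gt_eqF// cosD.
Qed.

Lemma measurable_sec2_pihalf_itv : measurable_fun setT sec2_pihalf_itv.
Proof.
apply/(measurable_restrictT _ mD); apply: open_continuous_measurable_fun.
  exact: interval_open.
by move=> x /set_mem Dx; apply: continuous_sec2; rewrite gt_eqF// cosD.
Qed.

Lemma sec2_pihalf_itv_ge0 x : (0 <= sec2_pihalf_itv x)%R.
Proof.
by rewrite /sec2_pihalf_itv /patch; case: ifP => // _; rewrite invr_ge0 exprn_even_ge0.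
Qed.

(** The substitution [y = c tan x], meant for the abscissa [c] of a point of the right half-plane,
    whose polar angle is then [x]. *)
Lemma ge0_integral_tan (c : R) (G : R -> \bar R) : (0 < c)%R ->
  measurable_fun setT G -> (forall y, 0 <= G y) ->
  \int[mu]_y G y =
  \int[mu]_x (G (c * tan_pihalf_itv x)%R * (c * sec2_pihalf_itv x)%:E).
Proof.
move=> c0 mG G0.
apply: (@ge0_change_of_variable (fun x => c * tan_pihalf_itv x)%R
  (fun x => c * sec2_pihalf_itv x)%R) => //.
- by apply: measurable_funM => //; exact: measurable_tan_pihalf_itv.
- by apply: measurable_funM => //; exact: measurable_sec2_pihalf_itv.
- by move=> x; rewrite mulr_ge0 ?sec2_pihalf_itv_ge0// ltW.
move=> a b ab.
pose A := atan (a / c); pose B := atan (b / c).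
have AB : (A < B)%R by rewrite lt_atan// ltr_pM2r ?invr_gt0.
have sub : `[A, B]%classic `<=` D.
  move=> x; rewrite /D /= !in_itv/= => /andP[Ax xB].
  by rewrite (lt_le_trans (atan_gtNpi2 _) Ax) (le_lt_trans xB (atan_ltpi2 _)).
transitivity (\int[mu]_(x in `]A, B]) (c * (cos x)^-2)%:E).
  rewrite integral_mkcond [RHS]integral_mkcond; apply: eq_integral => x _.
  (* Off [D] the truncated tangent is 0, which may well lie in []a, b]], but the weight is zero
     too. *)
  rewrite /patch; case: (boolP (x \in D)) => [/set_mem Dx|xD]; last first.
    rewrite /sec2_pihalf_itv /patch (negbTE xD) mulr0.
    have -> : (x \in `]A, B]%classic) = false; last by case: ifP.
    apply: contraNF xD; rewrite !inE => xAB.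
    by apply: sub; move: xAB; rewrite /= !in_itv/= => /andP[/ltW -> ->].
  transitivity (if x \in `]A, B]%classic then (c * sec2_pihalf_itv x)%:E else 0).
    congr (if _ then _ else _).
    have xE : atan (tan x) = x by rewrite tanK// inE.
    apply/idP/idP; rewrite !inE /= !in_itv/= /tan_pihalf_itv /patch mem_set//.
      rewrite mulrC -ltr_pdivrMr// -ler_pdivlMr// => /andP[ax xb].
      by rewrite -xE lt_atan//= le_atan.
    move=> /andP[Ax xB].
    have Bpi := atan_ltpi2 (b / c); have Api := atan_gtNpi2 (a / c).
    rewrite mulrC -ltr_pdivrMr// -ler_pdivlMr//.
    rewrite -(atanK (a / c)%R) -(atanK (b / c)%R).
    have inA : atan (a / c)%R \in `](- (pi / 2))%R, (pi / 2)%R[.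
      by rewrite in_itv/= Api atan_ltpi2.
    have inB : atan (b / c)%R \in `](- (pi / 2))%R, (pi / 2)%R[.
      by rewrite in_itv/= atan_gtNpi2 Bpi.
    have inx : x \in `](- (pi / 2))%R, (pi / 2)%R[ by [].
    by rewrite (ltr_tan inA inx) leNgt (ltr_tan inB inx) -leNgt Ax.
  by case: ifP => // _; rewrite /sec2_pihalf_itv /patch mem_set.
rewrite integral_itv_obnd_cbnd; last first.
  apply/measurable_EFinP; apply: measurable_funM => //.
  have : measurable_fun D (fun x => (cos x)^-2 : R)%R.
    apply/(measurable_restrictT _ mD); exact: measurable_sec2_pihalf_itv.
  apply: measurable_funS => //; apply: subset_trans sub.
  by move=> x /=; rewrite !in_itv/= => /andP[/ltW -> ->].
rewrite (@continuous_FTC2 _ _ (fun x => c * tan x)%R A B AB).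
- by rewrite /A /B !atanK -EFinB; congr EFin; field; exact: lt0r_neq0.
- apply: continuous_in_subspaceT => x /set_mem /sub Dx.
  have cx : (cos x != 0)%R by rewrite gt_eqF// cosD.
  have cc : {for x, continuous (fun _ : R => c : R)} by exact: cst_continuous.
  have h := @continuousM R R _ _ x cc (continuous_sec2 cx).
  exact: h.
- have cvtan x : D x -> {for x, continuous (fun y => c * tan y)%R}.
    move=> Dx; have cx : (cos x != 0)%R by rewrite gt_eqF// cosD.
    have cc : {for x, continuous (fun _ : R => c : R)} by exact: cst_continuous.
    have h := @continuousM R R _ _ x cc (continuous_tan cx).
    exact: h.
  split.
  + move=> x xAB; apply: derivableM => //; apply: derivable_tan.
    by rewrite gt_eqF// cosD//; apply: sub; apply: subset_itv_oo_cc xAB.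
  + apply: cvg_at_right_filter; apply: cvtan; apply: sub.
    by rewrite /= in_itv/= lexx ltW.
  + apply: cvg_at_left_filter; apply: cvtan; apply: sub.
    by rewrite /= in_itv/= lexx ltW.
- move=> x xAB.
  have Dx : D x by apply: sub; apply: subset_itv_oo_cc xAB.
  have cx : (cos x != 0)%R by rewrite gt_eqF// cosD.
  have := is_derive_tan cx => dtan.
  rewrite derive1E deriveM//.
  by rewrite derive_cst derive_val scaler0 addr0.
Qed.

End change_of_variable.

Section polar_coordinates.
Context (R : realType).
Local Notation mu := (@lebesgue_measure R).

Let pos : set R := `]0%R, +oo[%classic.
Let halfpi : set R := `](- (pi / 2))%R, (pi / 2)%R[%classic.

Let measurable_cos : measurable_fun setT (@cos R).
Proof. by apply: continuous_measurable_fun; exact: continuous_cos. Qed.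

Let measurable_sin : measurable_fun setT (@sin R).
Proof. by apply: continuous_measurable_fun; exact: continuous_sin. Qed.

Lemma measurable_polar :
  measurable_fun setT (fun x : measurableTypeR R * measurableTypeR R =>
    polar x.1 x.2).
Proof.
have m2 := @measurable_snd _ _ (measurableTypeR R) (measurableTypeR R).
apply: measurable_fun_pair; apply: measurable_funM => //.
  exact: (measurableT_comp measurable_cos m2).
exact: (measurableT_comp measurable_sin m2).
Qed.

Lemma measurable_polar_shift (a : R) :
  measurable_fun setT (fun x : measurableTypeR R * measurableTypeR R =>
    polar x.1 (a + x.2)%R).
Proof.
apply: (measurableT_comp (f := fun x : measurableTypeR R * measurableTypeR R =>
  polar x.1 x.2) (g := fun x => (x.1, (a + x.2)%R))).
  exact: measurable_polar.
by apply: measurable_fun_pair => //; apply: measurable_funD.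
Qed.

Lemma measurable_polar_angle (t : R) :
  measurable_fun setT (fun a : R => polar t a).
Proof.
by apply: measurable_fun_pair; apply: measurable_funM.
Qed.

(** Two one-dimensional substitutions separated by Tonelli's theorem: [y = x tan a] at fixed
    abscissa [x], then [x = t cos a] at fixed angle [a]. The weights multiply to
    [(t cos a) (cos a)^-2 (cos a) = t]. *)
Lemma integral_half_plane (F : R * R -> \bar R) : measurable_fun setT F ->
  (forall x, 0 <= F x) ->
  \int[mu]_(x in pos) \int[mu]_y F (x, y) =
  \int[mu]_(t in pos) (\int[mu]_(a in halfpi) F (polar t a) * t%:E).
Proof.
move=> mF F0.
pose w1 (x : measurableTypeR R * measurableTypeR R) : \bar R :=
  F (x.1, (x.1 * tan_pihalf_itv x.2)%R) *
  (\1_pos x.1 * (x.1 * sec2_pihalf_itv x.2))%R%:E.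
have mpos : measurable pos by exact: measurable_itv.
have mhalf : measurable halfpi by exact: measurable_itv.
have pos_gt0 x : pos x -> (0 < x)%R by rewrite /pos /= in_itv/= andbT.
have mtan2 : measurable_fun setT
    (fun x : measurableTypeR R * measurableTypeR R => tan_pihalf_itv x.2).
  by apply: (measurableT_comp (@measurable_tan_pihalf_itv R)); exact: measurable_snd.
have msec2 : measurable_fun setT
    (fun x : measurableTypeR R * measurableTypeR R => sec2_pihalf_itv x.2).
  by apply: (measurableT_comp (@measurable_sec2_pihalf_itv R)); exact: measurable_snd.
have mw1 : measurable_fun setT w1.
  apply: emeasurable_funM.
    apply: (measurableT_comp mF); apply: measurable_fun_pair => //.
    exact: measurable_funM.
  apply/measurable_EFinP; apply: measurable_funM; last exact: measurable_funM.
  by apply: (measurableT_comp (measurable_indic mpos)); exact: measurable_fst.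
have w10 x : 0 <= w1 x.
  rewrite /w1; rewrite mule_ge0// lee_fin indicE.
  case: (boolP (x.1 \in pos)) => [|_]; last by rewrite mul0r.
  by rewrite inE => /pos_gt0/ltW x0; rewrite !mulr_ge0// sec2_pihalf_itv_ge0.
pose w2 (x : measurableTypeR R * measurableTypeR R) : \bar R :=
  F (polar x.1 x.2) * (\1_pos x.1 * (x.1 * \1_halfpi x.2))%R%:E.
have mw2 : measurable_fun setT w2.
  apply: emeasurable_funM.
    by apply: (measurableT_comp mF); exact: measurable_polar.
  apply/measurable_EFinP; apply: measurable_funM.
    by apply: (measurableT_comp (measurable_indic mpos)); exact: measurable_fst.
  apply: measurable_funM => //.
  by apply: (measurableT_comp (measurable_indic mhalf)); exact: measurable_snd.
have w20 x : 0 <= w2 x.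
  rewrite /w2; rewrite mule_ge0// lee_fin indicE.
  case: (boolP (x.1 \in pos)) => [|_]; last by rewrite mul0r.
  by rewrite inE => /pos_gt0/ltW x0; rewrite !mulr_ge0.
transitivity (\int[mu]_x \int[mu]_a w1 (x, a)).
  rewrite integral_mkcond; apply: eq_integral => x _; rewrite /patch.
  case: ifPn => [|xpos]; last first.
    by rewrite integral0_eq// => a _; rewrite /w1/= indicE (negbTE xpos) mul0r mule0.
  rewrite inE => xpos.
  rewrite (@ge0_integral_tan R x (fun y => F (x, y)) (pos_gt0 _ xpos))//; last first.
    by apply: (measurableT_comp mF); exact: measurable_pair1.
  by apply: eq_integral => a _; rewrite /w1/= indicE mem_set// mul1r.
transitivity (\int[mu]_a \int[mu]_x w1 (x, a)).
  have h := @fubini_tonelli _ _ _ _ R mu mu w1 mw1 w10.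
  exact: h.
transitivity (\int[mu]_a \int[mu]_t w2 (t, a)).
  apply: eq_integral => a _.
  have [|ahalf] := boolP (a \in halfpi); last first.
    rewrite integral0_eq ?integral0_eq// => t _.
      by rewrite /w2/= [in \1_halfpi a]indicE (negbTE ahalf) !mulr0 mule0.
    by rewrite /w1/= /sec2_pihalf_itv /patch (negbTE ahalf) !mulr0 mule0.
  rewrite inE => ahalf.
  have ca : (0 < cos a)%R by move: ahalf; rewrite /halfpi/= in_itv/= => /cos_gt0_pihalf.
  rewrite (@ge0_integral_scale R (cos a) (fun x => w1 (x, a)) ca)//; last first.
    by apply: (measurableT_comp mw1); exact: measurable_pair2.
  apply: eq_integral => t _; rewrite /w1 /w2/= -muleA -EFinM.
  have -> : ((cos a * t)%R, (cos a * t * tan_pihalf_itv a)%R) = polar t a.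
    rewrite /polar /tan_pihalf_itv /patch mem_set// /tan.
    congr pair; [exact: mulrC|]; field; exact: lt0r_neq0.
  congr (_ * _%:E).
  have -> : \1_pos (cos a * t)%R = \1_pos t :> R.
    rewrite !indicE; congr (_%:R)%R; congr nat_of_bool; apply/idP/idP;
      by rewrite !inE /pos /= !in_itv/= !andbT pmulr_rgt0.
  rewrite [\1_halfpi a]indicE (mem_set ahalf)/= /sec2_pihalf_itv /patch (mem_set ahalf).
  by field; exact: lt0r_neq0.
transitivity (\int[mu]_t \int[mu]_a w2 (t, a)).
  have h := @fubini_tonelli _ _ _ _ R mu mu w2 mw2 w20.
  exact: esym h.
rewrite [RHS]integral_mkcond; apply: eq_integral => t _; rewrite /patch.
case: ifPn => [|tpos]; last first.
  by rewrite integral0_eq// => a _; rewrite /w2/= indicE (negbTE tpos) mul0r mule0.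
rewrite inE => tpos; have t0 := pos_gt0 _ tpos.
rewrite [in RHS]integral_mkcond -ge0_integralZr//; last 3 first.
- apply/(measurable_restrictT _ mhalf)/measurable_funTS.
  by apply: (measurableT_comp mF); exact: measurable_polar_angle.
- by move=> a _; rewrite /patch; case: ifP.
- by rewrite lee_fin ltW.
apply: eq_integral => a _; rewrite /w2/= [\1_pos t]indicE mem_set//= mul1r indicE /patch.
by case: ifP => _; rewrite ?mulr1// mulr0 mule0 mul0e.
Qed.

End polar_coordinates.

Section periodic_integral.
Context (R : realType).
Local Notation mu := (@lebesgue_measure R).

Lemma ge0_integral_itv_shift (K : R -> \bar R) (b0 b1 : bool) (a b c : R) :
  measurable_fun setT K -> (forall x, 0 <= K x) ->
  \int[mu]_(x in [set` Interval (BSide b0 (a + c)%R) (BSide b1 (b + c)%R)]) K x =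
  \int[mu]_(x in [set` Interval (BSide b0 a) (BSide b1 b)]) K (x + c)%R.
Proof.
move=> mK K0; set I' := [set` _]; set I := [set` Interval (BSide b0 a) _].
have mI' : measurable I' by exact: measurable_itv.
rewrite integral_mkcond (ge0_integral_shift c)//; last 2 first.
- by apply/(measurable_restrictT _ mI'); exact: measurable_funTS.
- by move=> x; rewrite /patch; case: ifP.
rewrite [RHS]integral_mkcond; apply: eq_integral => x _; rewrite /patch.
congr (if _ then _ else _); apply/idP/idP; rewrite !inE /I /I' /= !itv_boundlr
  /= => /andP[]; by case: b0 {I I' mI'}; case: b1;
  rewrite !bnd_simp !(lerD2r, ltrD2r) => -> ->.
Qed.

Variables (K : R -> \bar R) (p : R).
Hypothesis mK : measurable_fun setT K.
Hypothesis K_ge0 : forall x, 0 <= K x.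
Hypothesis p_gt0 : (0 < p)%R.
Hypothesis K_periodic : forall x, K (x + p)%R = K x.

Let J a := \int[mu]_(x in `]a, (a + p)%R]) K x.

Let J_shift a : J (a + p)%R = J a.
Proof.
rewrite /J ge0_integral_itv_shift//; apply: eq_integral => x _.
exact: K_periodic.
Qed.

Let J_shiftn a n : J (a + n%:R * p)%R = J a.
Proof.
elim: n => [|n IH]; first by rewrite mul0r addr0.
by rewrite -natr1 mulrDl mul1r addrA J_shift.
Qed.

Let split_itv a b c : (a <= b)%R -> (b <= c)%R ->
  \int[mu]_(x in `]a, c]) K x =
  \int[mu]_(x in `]a, b]) K x + \int[mu]_(x in `]b, c]) K x.
Proof.
move=> ab bc; rewrite -ge0_integral_setU//.
- by rewrite -itv_bndbnd_setU// bnd_simp.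
- exact: measurable_funTS.
- rewrite disj_set2E; apply/eqP/seteqP; split => // x [] /=.
  by rewrite !in_itv/= => /andP[_ xb] /andP[bx _]; move: (lt_le_trans bx xb); rewrite ltxx.
Qed.

Let J_fundamental (a : R) : (0 <= a <= p)%R -> J a = J 0%R.
Proof.
move=> /andP[a0 ap]; rewrite /J add0r (@split_itv a p (a + p)%R)//; last by rewrite lerDr.
rewrite (@split_itv 0%R a p)// addeC; congr (_ + _).
rewrite -[X in `]X, _]]add0r ge0_integral_itv_shift//.
by apply: eq_integral => x _; exact: K_periodic.
Qed.

(** The base point is moved into [[0, p]] by a whole number of periods; there the interval is cut at
    [p] and the part beyond is moved back by one period. *)
Lemma ge0_integral_period a b :
  \int[mu]_(x in `]a, (a + p)%R]) K x = \int[mu]_(x in `]b, (b + p)%R]) K x.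
Proof.
suff JE c : J c = J 0%R by exact: etrans (JE a) (esym (JE b)).
have /andP[lo hi] := floor_itv (c / p).
set m := Num.floor (c / p) in lo hi.
have c01 : (0 <= c - m%:~R * p <= p)%R.
  rewrite subr_ge0 -ler_pdivlMr// lo/= lerBlDl -{2}[p]mul1r -mulrDl addrC.
  by move: hi; rewrite ltr_pdivrMr// intrD => /ltW; rewrite addrC.
rewrite -(J_fundamental c01); case: m {lo hi c01} => n.
  by rewrite -pmulrn -(J_shiftn (c - n%:R * p)%R n) subrK.
rewrite -(J_shiftn c n.+1); congr J.
by rewrite NegzE mulrNz mulNr opprK.
Qed.

End periodic_integral.

Section polar_area.
Context (R : realType).
Local Notation mu := (@lebesgue_measure R).

Let pos : set R := `]0%R, +oo[%classic.
Let halfpi : set R := `](- (pi / 2))%R, (pi / 2)%R[%classic.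

Let full_circle (K : R -> \bar R) (phi : R) :
  measurable_fun setT K -> (forall x, 0 <= K x) ->
  (forall x, K (x + pi *+ 2)%R = K x) ->
  \int[mu]_(a in halfpi) K a + \int[mu]_(a in halfpi) K (a + pi)%R =
  \int[mu]_(a in `[0%R, (2 * pi)%R]) K (phi + a)%R.
Proof.
move=> mK K0 Kper.
rewrite -integral_itv_obnd_cbnd; last first.
  apply: measurable_funTS; apply: (measurableT_comp mK).
  exact: measurable_funD.
have p0 := pi_gt0 R.
have p2 : (0 < pi *+ 2 :> R)%R by rewrite mulr2n addr_gt0.
transitivity (\int[mu]_(x in `](- (pi / 2))%R, (- (pi / 2) + pi *+ 2)%R]) K x); last first.
  rewrite (ge0_integral_period mK K0 p2 Kper _ phi).
  rewrite -[X in `]X, _]]add0r [in (phi + _)%R]addrC ge0_integral_itv_shift//.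
  rewrite (_ : (pi *+ 2)%R = (2 * pi)%R :> R); last by rewrite mulr_natl.
  by apply: eq_integral => x _; rewrite addrC.
have -> : (- (pi / 2) + pi *+ 2 = pi / 2 + pi :> R)%R by rewrite mulr2n; field.
rewrite (@itv_bndbnd_setU _ _ _ (BRight (pi / 2)%R));
  [|by rewrite bnd_simp; lra|by rewrite bnd_simp; lra].
rewrite ge0_integral_setU//; last 2 first.
- exact: measurable_funTS.
- rewrite disj_set2E; apply/eqP/seteqP; split => // x [] /=.
  by rewrite !in_itv/= => /andP[_ xb] /andP[bx _]; move: (lt_le_trans bx xb); rewrite ltxx.
congr (_ + _).
  by rewrite /halfpi (integral_itv_bndo_bndc (a := BRight (- (pi / 2))%R))//;
    exact: measurable_funTS.
rewrite /halfpi -(ge0_integral_itv_shift false true)//.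
rewrite integral_itv_bndo_bndc; last exact: measurable_funTS.
by rewrite (_ : (- (pi / 2) + pi)%R = (pi / 2)%R :> R)//; field.
Qed.

(** The left half-plane is the image of the right one under the point reflection [N], which adds
    [pi] to the angle; by periodicity the two half circles make a full turn starting at any [phi].
    The free origin of angles will be the direction of the given BS. *)
Lemma integral_area_polar (F : R * R -> \bar R) (phi : R) :
  measurable_fun setT F -> (forall x, 0 <= F x) ->
  \int[area]_x F x =
  \int[mu]_(t in pos)
    ((\int[mu]_(a in `[0%R, (2 * pi)%R]) F (polar t (phi + a)%R)) * t%:E).
Proof.
move=> mF F0; rewrite integral_area//.
have mpos : measurable pos by exact: measurable_itv.
have mhalf : measurable halfpi by exact: measurable_itv.
pose N (x : R * R) := (- x.1, - x.2)%R.
have mN : measurable_fun setT N.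
  by apply: measurable_fun_pair; apply: measurableT_comp => //; exact: oppr_measurable.
have mFN : measurable_fun setT (F \o N) by exact: measurableT_comp.
pose g x := \int[mu]_y F (x, y).
have mg : measurable_fun setT g.
  exact: (@measurable_fun_fubini_tonelli_F _ _ (measurableTypeR R) (measurableTypeR R) R mu F).
have g0 x : 0 <= g x by apply: integral_ge0.
have gN x : g (- x)%R = \int[mu]_y F (N (x, y)).
  rewrite /g (ge0_integral_opp (G := fun y => F (- x, y)%R))//.
  by apply: (measurableT_comp mF); exact: measurable_pair1.
transitivity (\int[mu]_(x in pos) g x + \int[mu]_(x in pos) g (- x)%R).
  rewrite -[LHS]/(\int[mu]_x g x).
  rewrite -[X in \int[mu]_(x in X) _](setUv pos) ge0_integral_setU//; last 3 first.
  - exact: measurableC.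
  - exact: measurable_funTS.
  - by apply/disj_setPCl.
  congr (_ + _).
  rewrite (_ : ~` pos = `]-oo, 0%R]%classic); last by rewrite /pos setCitvr.
  rewrite integral_mkcond ge0_integral_opp//; last 2 first.
  - by apply/(measurable_restrictT _ (measurable_itv _)); exact: measurable_funTS.
  - by move=> x; rewrite /patch; case: ifP.
  rewrite /pos integral_itv_obnd_cbnd; last first.
    apply: measurable_funTS; apply: (measurableT_comp mg); exact: oppr_measurable.
  rewrite [RHS]integral_mkcond; apply: eq_integral => x _; rewrite /patch.
  congr (if _ then _ else _); apply/idP/idP; rewrite !inE /= !in_itv/= ?andbT;
    by rewrite oppr_le0.
rewrite integral_half_plane//.
under [X in _ + X]eq_integral do rewrite gN.
rewrite (integral_half_plane mFN (fun x => F0 (N x))).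
have mhp (G : R * R -> \bar R) : measurable_fun setT G -> (forall x, 0 <= G x) ->
    measurable_fun pos (fun t => \int[mu]_(a in halfpi) G (polar t a) * t%:E).
  move=> mG G0; apply: measurable_funTS.
  apply: emeasurable_funM; last exact/measurable_EFinP.
  under eq_fun do rewrite integral_mkcond.
  apply: (@measurable_fun_fubini_tonelli_F _ _ (measurableTypeR R) (measurableTypeR R) R mu
     (fun x => ((fun a => G (polar x.1 a)) \_ halfpi) x.2)).
    rewrite (_ : (fun _ => _) = (fun x : measurableTypeR R * measurableTypeR R =>
        G (polar x.1 x.2) * (\1_halfpi x.2)%:E)); last first.
      by apply/funext => x; rewrite /patch indicE; case: ifP; rewrite ?mule1 ?mule0.
    apply: emeasurable_funM.
      by apply: (measurableT_comp mG); exact: measurable_polar.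
    apply/measurable_EFinP; apply: (measurableT_comp (measurable_indic mhalf)).
    exact: measurable_snd.
  by move=> x; rewrite /patch; case: ifP.
have t_ge0 t : pos t -> 0 <= t%:E.
  by rewrite /pos /= in_itv/= andbT lee_fin => /ltW.
have hp0 (G : R * R -> \bar R) t : (forall x, 0 <= G x) ->
    0 <= \int[mu]_(a in halfpi) G (polar t a).
  by move=> G0; apply: integral_ge0.
rewrite -ge0_integralD//; last 4 first.
- by move=> t tpos; rewrite mule_ge0 ?hp0// t_ge0.
- exact: mhp.
- move=> t tpos; apply: mule_ge0; last exact: t_ge0.
  exact: (hp0 (F \o N) t (fun x => F0 (N x))).
- by apply: (mhp (F \o N)) => // x; exact: F0.
apply: eq_integral => t /set_mem tpos.
rewrite -ge0_muleDl; [|exact: integral_ge0|by apply: integral_ge0 => a _; exact: F0].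
congr (_ * _).
rewrite -(full_circle (K := fun a => F (polar t a)) phi)//.
- congr (_ + _); apply: eq_integral => a _ /=; congr F.
  by rewrite /N /polar/= cosDpi sinDpi !mulrN.
- by apply: (measurableT_comp mF); exact: measurable_polar_angle.
- by move=> x; rewrite /polar cosD2pi sinD2pi.
Qed.

End polar_area.

(** * Measurability of the link types *)

Section segment_meets_link.
Context (R : realType).

(** The l1 distance between the point of the blockage with parameter [u.1] in [-1, 1] and the point
    of the link with parameter [u.2] in [0, 1]. *)
Let gap (c : R * R) (l o : R) (x : R * R) (u : R * R) : R :=
  (`|c.1 + u.1 * (l / 2) * cos o - u.2 * x.1| +
   `|c.2 + u.1 * (l / 2) * sin o - u.2 * x.2|)%R.

Let box : set (R * R) := `[(-1)%R, 1%R]%classic `*` `[0%R, 1%R]%classic.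

Let gap_ge0 c l o x u : (0 <= gap c l o x u)%R.
Proof. by rewrite addr_ge0. Qed.

Let normrBr (a b c e : R) : (`|a - b| <= `|c - e| + `|a - c| + `|b - e|)%R.
Proof.
have -> : (a - b = (c - e) + (a - c) - (b - e))%R by ring.
by apply: le_trans (ler_normB _ _) _; rewrite lerD2r ler_normD.
Qed.

Let gap_lipschitz c l o x u v :
  (gap c l o x v <= gap c l o x u +
     (`|l| + `|x.1| + `|x.2|) * (`|v.1 - u.1| + `|v.2 - u.2|))%R.
Proof.
have bound (a b co s t s' t' : R) : (`|co| <= 1)%R ->
    (`|a + s * (l / 2) * co - t * b| <= `|a + s' * (l / 2) * co - t' * b| +
       `|l| / 2 * `|s - s'| + `|b| * `|t - t'|)%R.
  move=> co1; apply: le_trans (normrBr _ _ (a + s' * (l / 2) * co) (t' * b)) _.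
  have -> : (a + s * (l / 2) * co - (a + s' * (l / 2) * co) =
    (l / 2 * (s - s')) * co)%R by ring.
  have -> : (t * b - t' * b = b * (t - t'))%R by ring.
  rewrite !normrM normfV (@ger0_norm _ 2)//.
  by rewrite lerD2r lerD2l ler_piMr// mulr_ge0// divr_ge0.
have h1 := bound c.1 x.1 (cos o) v.1 v.2 u.1 u.2 (cos_max o).
have h2 := bound c.2 x.2 (sin o) v.1 v.2 u.1 u.2 (sin_max o).
rewrite /gap.
have m1 : (0 <= `|x.1| * `|v.1 - u.1|)%R by rewrite mulr_ge0.
have m2 : (0 <= `|x.2| * `|v.1 - u.1|)%R by rewrite mulr_ge0.
have m3 : (0 <= `|l| * `|v.2 - u.2|)%R by rewrite mulr_ge0.
by move: h1 h2 m1 m2 m3; nra.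
Qed.

Let rat_near (lo hi y e : R) : (lo < hi)%R -> (lo <= y <= hi)%R -> (0 < e)%R ->
  exists q : rat, (lo <= ratr q <= hi)%R /\ (`|ratr q - y| < e)%R.
Proof.
move=> lohi /andP[loy yhi] e0.
have [|q] := @rat_in_itvoo R (Num.max lo (y - e)%R) (Num.min hi (y + e)%R).
  by rewrite gt_max !lt_min; apply/andP; split; apply/andP; split; lra.
rewrite in_itv/= gt_max lt_min => /andP[/andP[q1 q2] /andP[q3 q4]].
exists q; split; first by rewrite !ltW.
by rewrite ltr_norml; apply/andP; split; lra.
Qed.

(* Rational parameters suffice, because the distance between the two points is
   Lipschitz in the parameters and attains its infimum on a compact box. *)
Lemma blockage_meets_linkP (c : R * R) (l o : R) (x : R * R) :
  blockage_segment c l o `&` link x !=set0 <->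
  ((0 <= l)%R /\ forall n : nat, exists p q : rat,
    [/\ (-1 <= (ratr p : R) <= 1)%R, (0 <= (ratr q : R) <= 1)%R &
      (`|c.1 + ratr p * (l / 2) * cos o - ratr q * x.1| +
       `|c.2 + ratr p * (l / 2) * sin o - ratr q * x.2| < n.+1%:R^-1)%R]).
Proof.
split.
  move=> [y [[a al yE] [b b01]]]; rewrite yE => -[y1 y2].
  have l0 : (0 <= l)%R by have := le_trans (normr_ge0 a) al; lra.
  split => // n.
  have [t t1 ta] : exists2 t : R, (-1 <= t <= 1)%R & (t * (l / 2) = a)%R.
    have [l00|l0'] := eqVneq l 0%R.
      exists 0%R; first by apply/andP; split; lra.
      by move: al; rewrite l00 mul0r mulr0 normr_le0 => /eqP.
    exists (a / (l / 2))%R; last by field.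
    by rewrite -ler_norml normrM normfV (@ger0_norm _ (l / 2))%R ?ler_pdivrMr ?mul1r//; lra.
  set M := (`|l| + `|x.1| + `|x.2|)%R.
  have M0 : (0 <= M)%R by rewrite !addr_ge0.
  (* Moving both parameters by less than [e] changes the gap by at most [2 * M * e], which is below
     [n.+1%:R^-1]; the added 1 keeps the quotient meaningful for [M = 0]. *)
  pose e : R := (n.+1%:R^-1 / (2 * (M + 1)))%R.
  have e0 : (0 < e)%R by rewrite divr_gt0//; lra.
  have [p [p1 pt]] := @rat_near (-1)%R 1%R t e ltac:(lra) t1 e0.
  have [q [q1 qb]] := @rat_near 0%R 1%R b e ltac:(lra) b01 e0.
  exists p, q; split => //.
  have := gap_lipschitz c l o x (t, b) (ratr p, ratr q).
  have -> : gap c l o x (t, b) = 0%R.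
    by rewrite /gap/= ta y1 y2 !subrr normr0 addr0.
  rewrite /gap/= add0r => /le_lt_trans; apply.
  rewrite -/M; apply: (@le_lt_trans _ _ (M * (e + e))%R).
    by rewrite ler_wpM2l// lerD// ltW.
  have eE : (e * (2 * (M + 1)) = n.+1%:R^-1)%R.
    by rewrite /e mulfVK//; lra.
  by rewrite -eE; nra.
move=> [l0 hit].
have cgap : continuous (gap c l o x).
  move=> u; apply: cvgD; apply: cvg_norm; apply: cvgB.
  - apply: cvgD; first exact: cvg_cst.
    apply: cvgM; last exact: cvg_cst.
    by apply: cvgM; [exact: cvg_fst|exact: cvg_cst].
  - by apply: cvgM; [exact: cvg_snd|exact: cvg_cst].
  - apply: cvgD; first exact: cvg_cst.
    apply: cvgM; last exact: cvg_cst.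
    by apply: cvgM; [exact: cvg_fst|exact: cvg_cst].
  - by apply: cvgM; [exact: cvg_snd|exact: cvg_cst].
have [||u ubox umin] := @compact_EVT_min _ R (gap c l o x) box _ _
    (continuous_subspaceT cgap).
- by exists (0, 0)%R; split => /=; rewrite in_itv/=; apply/andP; split; lra.
- by apply: compact_setX; exact: segment_compact.
have gap0 : gap c l o x u = 0%R.
  apply/eqP; rewrite eq_le gap_ge0 andbT; apply/ler_addgt0Pl => e e0; rewrite addr0.
  have [n ne] : exists n : nat, (n.+1%:R^-1 < e)%R.
    exists (Num.truncn e^-1); rewrite invf_plt ?posrE//.
    by rewrite truncnS_gt.
  have [p [q [p1 q1 pq]]] := hit n.
  have pqbox : (ratr p, ratr q) \in box by rewrite inE; split; rewrite /= in_itv.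
  by apply: le_trans (umin _ pqbox) _; exact: ltW (lt_trans pq ne).
move: ubox; rewrite inE => -[/=]; rewrite !in_itv/= => u1 u2.
have := addr_ge0 (normr_ge0 (c.1 + u.1 * (l / 2) * cos o - u.2 * x.1)%R)
  (normr_ge0 (c.2 + u.1 * (l / 2) * sin o - u.2 * x.2)%R).
move: gap0; rewrite /gap => /eqP; rewrite paddr_eq0// !normr_eq0 !subr_eq0.
move=> /andP[/eqP e1 /eqP e2] _.
exists (u.2 * x.1, u.2 * x.2)%R; split; last by exists u.2.
exists (u.1 * (l / 2))%R; last by rewrite e1 e2.
by rewrite normrM (@ger0_norm _ (l / 2)%R) ?ler_piMl//; [lra|rewrite ler_norml|lra].
Qed.

End segment_meets_link.

Section measurability_of_types.
Context (R : realType) d (Omega : measurableType d).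
Variable K : blockages R Omega.
Hypothesis mcenter : forall i, measurable_fun setT (Defs.center K i).
Hypothesis mlen : forall i, measurable_fun setT (len K i).
Hypothesis morient : forall i, measurable_fun setT (orientation K i).

Let measurable_hit i : measurable [set z : Omega * (R * R) |
  blockage_segment (Defs.center K i z.1) (len K i z.1) (orientation K i z.1)
    `&` link z.2 !=set0].
Proof.
pose g1 (p q : rat) (z : Omega * (R * R)) : R :=
  `|(Defs.center K i z.1).1 + ratr p * (len K i z.1 / 2) * cos (orientation K i z.1)
   - ratr q * z.2.1|%R.
pose g2 (p q : rat) (z : Omega * (R * R)) : R :=
  `|(Defs.center K i z.1).2 + ratr p * (len K i z.1 / 2) * sin (orientation K i z.1)
   - ratr q * z.2.2|%R.
have m1 := @measurable_fst _ _ Omega (R * R)%type.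
have m2 := @measurable_snd _ _ Omega (R * R)%type.
have mc := measurableT_comp (mcenter i) m1.
have ml := measurableT_comp (mlen i) m1.
have mo := measurableT_comp (morient i) m1.
have mcos : measurable_fun setT (@cos R).
  by apply: continuous_measurable_fun; exact: continuous_cos.
have msin : measurable_fun setT (@sin R).
  by apply: continuous_measurable_fun; exact: continuous_sin.
have mg1 p q : measurable_fun setT (g1 p q).
  apply: measurableT_comp; first exact: normr_measurable.
  apply: measurable_funB.
    apply: measurable_funD; first exact: (measurableT_comp measurable_fst mc).
    apply: measurable_funM; last exact: (measurableT_comp mcos mo).
    by apply: measurable_funM => //; apply: measurable_funM.
  by apply: measurable_funM => //; exact: (measurableT_comp measurable_fst m2).
have mg2 p q : measurable_fun setT (g2 p q).
  apply: measurableT_comp; first exact: normr_measurable.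
  apply: measurable_funB.
    apply: measurable_funD; first exact: (measurableT_comp measurable_snd mc).
    apply: measurable_funM; last exact: (measurableT_comp msin mo).
    by apply: measurable_funM => //; apply: measurable_funM.
  by apply: measurable_funM => //; exact: (measurableT_comp measurable_snd m2).
pose A (n : nat) (p q : rat) : set (Omega * (R * R)) :=
  if ((-1 <= (ratr p : R) <= 1) && (0 <= (ratr q : R) <= 1))%R then
    (fun z => g1 p q z + g2 p q z)%R @^-1` `]-oo, n.+1%:R^-1%R[ else set0.
have mA n p q : measurable (A n p q).
  rewrite /A; case: ifP => // _; rewrite -[X in measurable X]setTI.
  by apply: (measurable_funD (mg1 p q) (mg2 p q)) => //; exact: measurable_itv.
rewrite [X in measurable X](_ : _ = ((fun z => len K i z.1) @^-1` `[0%R, +oo[) `&`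
   \bigcap_n \bigcup_p \bigcup_q A n p q).
  apply: measurableI.
    by rewrite -[X in measurable X]setTI; apply: ml => //; exact: measurable_itv.
  apply: bigcapT_measurable => n.
  by apply: bigcupT_measurable_rat => p; exact: bigcupT_measurable_rat.
apply/seteqP; split => z /=.
  move/blockage_meets_linkP => [l0 hit]; split; first by rewrite /= in_itv/= andbT.
  move=> n _; have [p [q [p1 q1 pq]]] := hit n.
  by exists p => //; exists q => //; rewrite /A p1 q1/= in_itv.
move=> [l0 hit]; apply/blockage_meets_linkP; split.
  by move: l0; rewrite /= in_itv/= andbT.
move=> n; have [p _ [q _]] := hit n Logic.I.
rewrite /A; case: ifP => // /andP[p1 q1] /=; rewrite in_itv/= => pq.
by exists p, q; split.
Qed.

(** Measurability is joint in the outcome and the endpoint, so that sections give type probabilities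
    that are measurable in the position. *)
Lemma measurable_unblocked :
  measurable [set z : Omega * (R * R) | unblocked K z.2 z.1].
Proof.
rewrite [X in measurable X](_ : _ = \bigcap_i ~` [set z : Omega * (R * R) |
  blockage_segment (Defs.center K i z.1) (len K i z.1) (orientation K i z.1)
    `&` link z.2 !=set0]).
  by apply: bigcapT_measurable => i; apply: measurableC.
apply/seteqP; split => z /= h.
  by move=> i _ /=; rewrite h => -[].
by move=> i; apply/eqP; apply: contrapT => /negP/set0P; exact: h.
Qed.

Lemma measurable_link_has_type s :
  measurable [set z : Omega * (R * R) | link_has_type K s z.2 z.1].
Proof.
case: s => /=; first exact: measurable_unblocked.
by apply: (measurableC measurable_unblocked).
Qed.

Lemma measurable_link_has_type_at s x :
  measurable [set w | link_has_type K s x w].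
Proof.
have := measurable_ysection x (measurable_link_has_type s).
rewrite (_ : ysection _ x = [set w | link_has_type K s x w])//.
by apply/seteqP; split => w; rewrite /ysection/= inE.
Qed.

Variable PK : probability Omega R.

(** [p_joint] in Cartesian coordinates, ready to be composed with a rotation and integrated over the
    plane. *)
Definition joint_type_prob (s v : link_type) (y x : R * R) : R :=
  fine (PK [set w | link_has_type K s y w /\ link_has_type K v x w]).

Lemma measurable_joint_type_prob s v y :
  measurable_fun setT (joint_type_prob s v y).
Proof.
pose A := [set z : Omega * (R * R) |
  link_has_type K s y z.1 /\ link_has_type K v z.2 z.1].
have mA : measurable A.
  apply: measurableI; last exact: measurable_link_has_type.
  have := measurable_link_has_type_at s y => mE.
  rewrite -[X in measurable X]setTI.
  by apply: (@measurable_fst _ _ Omega (R * R)%type) => //.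
have mF := measurable_fun_ysection PK mA.
rewrite (_ : joint_type_prob s v y = fine \o (PK \o ysection A)).
  exact: (measurableT_comp _ mF).
apply/funext => x; rewrite /joint_type_prob /=; congr (fine (PK _)).
by apply/seteqP; split => w; rewrite /ysection/= inE.
Qed.

End measurability_of_types.

(** * Exponential decay of the LoS probability *)

Section thinned_points.
Context d (Omega : measurableType d) (R : realType).
Variables (P : probability Omega R) (X : nat -> Omega -> R * R).
Variables (E : nat -> set Omega) (p : R) (S : set (R * R)).
Hypothesis mX : forall i, measurable_fun setT (X i).
Hypothesis mE : forall i, measurable (E i).
Hypothesis mS : measurable S.
Hypothesis p01 : (0 <= p <= 1)%R.
Hypothesis thinning : forall n (b : 'I_n -> bool) A, <<s position_events X >> A ->
  P (A `&` [set w | forall j : 'I_n, b j -> E j w]) =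
  P A * (\prod_j (if b j then p else 1))%R%:E.

Local Notation retained x := (1 - p * \1_S x)%R.

Let retained01 x : (0 <= retained x <= 1)%R.
Proof.
by case/andP: p01 => ? ?; rewrite indicE; case: (x \in S) => /=; apply/andP; split; lra.
Qed.

Let measurable_retained : measurable_fun setT (fun x => retained x).
Proof.
by apply: measurable_funB => //; apply: measurable_funM => //; exact: measurable_indic.
Qed.

(* [None] forbids a retained point at index j. Since the indicator of [~ (S /\ E)]
   is [1 - \1_S * \1_E], one [None] is traded for [Some false] minus [Some true]. *)
Let constraint n (e : 'I_n -> option bool) : set Omega :=
  [set w | forall j : 'I_n, match e j with
     | Some b => b -> E j w
     | None => ~ (S (X j w) /\ E j w) end].

Let measurable_S i : measurable (X i @^-1` S).
Proof. by rewrite -[X in measurable X]setTI; exact: mX. Qed.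

Let measurable_constraint n (e : 'I_n -> option bool) : measurable (constraint e).
Proof.
rewrite [X in measurable X](_ : _ = \bigcap_(j in [set: 'I_n])
  match e j with
  | Some true => E j | Some false => setT | None => ~` (X j @^-1` S `&` E j) end).
  apply: fin_bigcap_measurable => // j _; case: (e j) => [[]|] //.
  by apply: measurableC; apply: measurableI.
apply/seteqP; split => [w ew j _ | w ew j].
  by have := ew j; case: (e j) => [[]|] //= h; exact: h.
by have := ew j I; case: (e j) => [[]|].
Qed.

Let mprod n (Q : pred 'I_n) :
  measurable_fun setT (fun w => \prod_(j < n | Q j) retained (X j w))%R.
Proof.
rewrite (_ : (fun _ => _) =
    (fun w => \prod_(j < n) (if Q j then retained (X j w) else 1))%R).
  apply: measurable_prod => j _; case: (Q j) => //.
  exact: (measurableT_comp measurable_retained).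
by apply/funext => w; rewrite [LHS]big_mkcond.
Qed.

Let prod_ge0 n (Q : pred 'I_n) w :
  0 <= (\prod_(j < n | Q j) retained (X j w))%R%:E.
Proof. by rewrite lee_fin; apply: prodr_ge0 => j _; case/andP: (retained01 (X j w)). Qed.

Let prod_le1 n (Q : pred 'I_n) w :
  (\prod_(j < n | Q j) retained (X j w))%R%:E <= 1.
Proof. by rewrite lee_fin; apply: prodr_ile1 => j _; exact: retained01. Qed.

Lemma probability_constraint n (e : 'I_n -> option bool) A :
  <<s position_events X >> A ->
  P (A `&` constraint e) =
  (\prod_j (if e j is Some true then p else 1))%R%:E *
  \int[P]_(w in A) (\prod_(j | e j == None) retained (X j w))%R%:E.
Proof.
have [k] := ubnP #|[pred j | e j == None]|.
elim: k e A => // k IH e A; rewrite ltnS => en GA.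
have mA : measurable A by exact: position_events_measurable GA.
have [j0 /= ej0|eS] := pickP [pred j | e j == None]; last first.
  pose b j := if e j is Some b then b else false.
  have eE j : e j = Some (b j) by move: (eS j); rewrite /b /=; case: (e j).
  rewrite [in RHS](eq_integral (cst 1)); last by move=> w _; rewrite /= big_pred0.
  rewrite integral_cst// mul1e muleC.
  rewrite (_ : constraint e = [set w | forall j : 'I_n, b j -> E j w]); last first.
    by apply/seteqP; split => w ew j; have := ew j; rewrite eE.
  apply: (etrans (thinning b GA)); congr (_ * _%:E).
  by apply: eq_bigr => j _; rewrite (eE j); case: (b j).
pose e' c j := if j == j0 then Some c else e j.
have e'None c j : (e' c j == None) = (e j == None) && (j != j0).
  by rewrite /e'; case: (eqVneq j j0) => [->|]; rewrite ?andbF ?andbT.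
have e'k c : (#|[pred j | e' c j == None]| < k)%N.
  apply: leq_trans en; apply: proper_card; apply/properP; split.
    by apply/fintype.subsetP => j; rewrite !inE e'None => /andP[].
  by exists j0; rewrite !inE // e'None eqxx andbF.
pose Q j := (e j == None) && (j != j0).
pose F w := (\prod_(j < n | Q j) retained (X j w))%R.
have e'F c w : (\prod_(j | e' c j == None) retained (X j w) = F w)%R.
  by apply: eq_bigl => j; rewrite e'None.
pose C := (\prod_(j | j != j0) (if e j is Some true then p else 1))%R.
have e'C c : (\prod_j (if e' c j is Some true then p else 1) =
    (if c then p else 1) * C)%R.
  rewrite (bigD1 j0)//= {1}/e' eqxx; congr (_ * _)%R.
  by apply: eq_bigr => j jj0; rewrite /e' (negbTE jj0).
have eC : (\prod_j (if e j is Some true then p else 1) = C)%R.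
  by rewrite (bigD1 j0)//= (eqP ej0) mul1r.
have eF w : (\prod_(j | e j == None) retained (X j w) = retained (X j0 w) * F w)%R.
  by rewrite (bigD1 j0).
have GAS : <<s position_events X >> (A `&` X j0 @^-1` S).
  have mA' : (measurable : set (set (g_sigma_algebraType (position_events X)))) A by [].
  have mB' : (measurable : set (set (g_sigma_algebraType (position_events X))))
      (X j0 @^-1` S).
    by apply: sub_sigma_algebra; exists j0, S.
  exact: (measurableI _ _ mA' mB').
have split_event : P (A `&` constraint (e' false)) =
    P (A `&` constraint e) + P ((A `&` X j0 @^-1` S) `&` constraint (e' true)).
  rewrite -measureU//; last 3 first.
  - exact: measurableI.
  - by apply: measurableI => //; exact: measurableI.
  - apply/seteqP; split => // w [[_ ew] [[_ Sw] ew']].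
    have := ew j0; rewrite (eqP ej0); apply; split => //.
    by have := ew' j0; rewrite /e' eqxx; exact.
  congr (P _); apply/seteqP; split => w.
    move=> [Aw ew].
    have [[Sw Ew]|nSE] := pselect (S (X j0 w) /\ E j0 w).
      right; split => // j; rewrite /e'; case: eqP => [->//|/eqP jj0].
      by have := ew j; rewrite /e' (negbTE jj0).
    left; split => // j; have := ew j; rewrite /e'.
    by case: eqP => [->|//]; rewrite (eqP ej0).
  move=> [[Aw ew]|[[Aw Sw] ew]]; split => // j; rewrite /e'.
    by case: eqP => // _; exact: ew.
  by have := ew j; rewrite /e'; case: eqP.
have F_ge0 w : 0 <= (F w)%:E by exact: prod_ge0.
have mF : measurable_fun setT (fun w => (F w)%:E).
  by apply/measurable_EFinP; exact: mprod.
have split_int : \int[P]_(w in A) (F w)%:E =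
    \int[P]_(w in A) (retained (X j0 w) * F w)%R%:E +
    p%:E * \int[P]_(w in A `&` X j0 @^-1` S) (F w)%:E.
  rewrite integral_mkcondr -ge0_integralZl_EFin//; last 3 first.
  - by move=> w _; rewrite /patch; case: ifP.
  - by apply/measurable_restrict => //; exact: measurable_funTS.
  - by case/andP: p01.
  rewrite -ge0_integralD//; last 4 first.
  - move=> w _; rewrite lee_fin mulr_ge0//; first by case/andP: (retained01 (X j0 w)).
    by rewrite -lee_fin; exact: F_ge0.
  - apply/measurable_EFinP/measurable_funTS; apply: measurable_funM; last exact: mprod.
    exact: (measurableT_comp measurable_retained).
  - by move=> w _; rewrite mule_ge0//; [case/andP: p01|rewrite /patch; case: ifP].
  - apply: measurable_funeM.
    by apply/measurable_restrict => //; exact: measurable_funTS.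
  apply: eq_integral => w _; rewrite /patch indicE.
  have -> : (w \in X j0 @^-1` S) = (X j0 w \in S) by apply/idP/idP; rewrite !inE.
  by case: (X j0 w \in S); rewrite ?mule0 ?adde0 -?EFinM -?EFinD; congr EFin => /=; ring.
have fin_int (B : set Omega) (G : Omega -> R) : measurable B ->
    measurable_fun setT G -> (forall w, (0 <= G w <= 1)%R) ->
    \int[P]_(w in B) (G w)%:E \is a fin_num.
  move=> mB mG G01; rewrite ge0_fin_numE; last first.
    by apply: integral_ge0 => w _; rewrite lee_fin; case/andP: (G01 w).
  apply: (@le_lt_trans _ _ (\int[P]_(w in B) cst 1 w)).
    apply: ge0_le_integral => //.
    - by move=> w _; rewrite lee_fin; case/andP: (G01 w).
    - exact/measurable_EFinP/measurable_funTS.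
    - by move=> w _; rewrite lee_fin; case/andP: (G01 w).
  by rewrite integral_cst// mul1e ltey_eq fin_num_measure.
have F01 w : (0 <= F w <= 1)%R by rewrite -!lee_fin F_ge0 prod_le1.
have F01' w : (0 <= retained (X j0 w) * F w <= 1)%R.
  case/andP: (retained01 (X j0 w)) => r0 r1; case/andP: (F01 w) => f0 f1.
  by rewrite mulr_ge0//= mulr_ile1.
have I1fin := fin_int A _ mA
  (measurable_funM (measurableT_comp measurable_retained (mX j0)) (mprod Q)) F01'.
have I2fin := fin_int _ _ (measurableI _ _ mA (measurable_S j0)) (mprod Q) F01.
have Pfin : P (A `&` constraint e) \is a fin_num.
  by rewrite fin_num_measure//; exact: measurableI.
have IHf : P (A `&` constraint (e' false)) = C%:E * \int[P]_(w in A) (F w)%:E.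
  rewrite IH// e'C mul1r; congr (_ * _).
  by apply: eq_integral => w _; rewrite e'F.
have IHt : P (A `&` X j0 @^-1` S `&` constraint (e' true)) =
    (p * C)%:E * \int[P]_(w in A `&` X j0 @^-1` S) (F w)%:E.
  rewrite IH// e'C; congr (_ * _).
  by apply: eq_integral => w _; rewrite e'F.
move: split_event; rewrite IHf IHt split_int.
have -> : \int[P]_(w in A) (\prod_(j | e j == None) retained (X j w))%R%:E =
    \int[P]_(w in A) (retained (X j0 w) * F w)%R%:E.
  by apply: eq_integral => w _; rewrite eF.
rewrite eC.
(* All terms are finite, so the unknown probability is obtained by subtraction in the reals. *)
move: I1fin I2fin Pfin.
set I1 := \int[P]_(w in A) _; set I2 := \int[P]_(w in _ `&` _) _; set PP := P _.
move=> /fineK <- /fineK <- /fineK <-.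
rewrite -?EFinM -?EFinD -?EFinM -?EFinD => -[h].
congr EFin.
have -> : (fine PP = (fine PP + p * C * fine I2) - p * C * fine I2)%R by ring.
by rewrite -h; ring.
Qed.

(** Expresses the void probability of the thinned process by the generating functional of the
    original one. *)
Lemma probability_no_retained_point n :
  P [set w | forall j : 'I_n, ~ (S (X j w) /\ E j w)] =
  \int[P]_w (running_prod X (fun x => retained x) n w)%:E.
Proof.
have GT : <<s position_events X >> setT.
  exact: (@measurableT _ (g_sigma_algebraType (position_events X))).
have := @probability_constraint n (fun=> None) setT GT.
by rewrite setTI big1// mul1e.
Qed.

End thinned_points.

(** Otherwise the intervals from [n.+1%:R^-1] on would all be null, the length would vanish almost
    surely, and its mean would be 0. The factor 2 makes [e] a bound for the half-length. *)
Lemma length_pos_prob (R : realType) (nuL : probability (measurableTypeR R) R) :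
  length_law nuL -> exists2 e : R, (0 < e)%R & 0 < nuL `[(2 * e)%R, +oo[%classic.
Proof.
move=> [l0 lpos _]; apply: contrapT => none.
have null e : (0 < e)%R -> nuL `[e, +oo[%classic = 0.
  move=> e0; apply/eqP; rewrite eq_le measure_ge0 andbT leNgt; apply/negP => ne.
  apply: none; exists (e / 2)%R; first by rewrite divr_gt0.
  by rewrite (_ : (2 * (e / 2))%R = e)//; field.
have mneq : measurable ([set~ 0%R] : set (measurableTypeR R)) by apply: measurableC.
have nupos : nuL [set~ 0%R] = 0.
  apply/eqP; rewrite eq_le measure_ge0 andbT.
  have cover : ([set~ 0%R] : set (measurableTypeR R)) `<=`
      `]-oo, 0%R[%classic `|` \bigcup_(n in [set: nat]) `[n.+1%:R^-1%R, +oo[%classic.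
    move=> x /= /eqP x0; case: (ltgtP x 0%R) x0 => // x0 _; first by left; rewrite /= in_itv.
    right; exists (Num.truncn x^-1) => //=; rewrite in_itv/= andbT invf_ple ?posrE//.
    by rewrite ltW// truncnS_gt.
  have mB : measurable (\bigcup_(n in [set: nat]) (`[n.+1%:R^-1%R, +oo[%classic
     : set (measurableTypeR R))).
    by apply: bigcup_measurable => n _; exact: measurable_itv.
  apply: (@le_trans _ _ (nuL (`]-oo, 0%R[%classic `|`
      \bigcup_(n in [set: nat]) `[n.+1%:R^-1%R, +oo[%classic))).
    apply: le_measure => //; rewrite inE//; exact: measurableU.
  have mF n : measurable (`[n.+1%:R^-1%R, +oo[%classic : set (measurableTypeR R)).
    exact: measurable_itv.
  have := @measure_sigma_subadditive _ _ _ nuL _ _ mF mB (@subset_refl _ _).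
  rewrite eseries0 => [h|n _ _]; last by apply: null; rewrite invr_gt0.
  have h0 : nuL `]-oo, 0%R[%classic +
      nuL (\bigcup_(n in [set: nat]) `[n.+1%:R^-1%R, +oo[%classic) <= 0.
    by rewrite l0 add0e.
  by apply: le_trans h0; exact: measureU2.
move: lpos; rewrite /length_mean.
rewrite (@ae_eq_integral _ _ _ nuL setT (cst 0) (fun l => l%:E))//.
- by rewrite integral_cst// mul0e ltxx.
- exact/measurable_EFinP.
exists [set~ 0%R]; split => // x /= /not_implyP[_]; apply: contra_not => ->.
by [].
Qed.

(** The bounds 1/4 and 3/4 leave a determinant of at least 1/2 in [crossing_point]; [d <= pi / 2]
    keeps the windows of orientations starting at 0 and at [pi / 2] inside [[0, pi]]. *)
Lemma near_axis_angle (R : realType) : exists d : R, [/\ (0 < d)%R, (d <= pi / 2)%R &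
  forall h : R, (0 <= h <= d)%R -> (`|sin h| <= 1 / 4)%R /\ (3 / 4 <= cos h)%R].
Proof.
have cs : sin h @[h --> (0 : R)%R] --> (sin 0 : R)%R by exact: continuous_sin.
have cc : cos h @[h --> (0 : R)%R] --> (cos 0 : R)%R by exact: continuous_cos.
have q0 : (0 < 1 / 4 :> R)%R by rewrite divr_gt0.
have : \forall h \near (0 : R)%R, (`|sin h| <= 1 / 4)%R /\ (3 / 4 <= cos h)%R.
  have /cvgrPdist_lt/(_ _ q0) s := cs; have /cvgrPdist_lt/(_ _ q0) c := cc.
  near=> h; split.
    have : (`|sin 0 - sin h| < 1 / 4 :> R)%R by near: h.
    by rewrite sin0 sub0r normrN => /ltW.
  have : (`|cos 0 - cos h| < 1 / 4 :> R)%R by near: h.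
  by rewrite cos0 ltr_norml => /andP[_]; lra.
move=> /nbhs_ballP[e /= e0 he].
have p0 := pi_gt0 R.
exists (Num.min (e / 2) (pi / 2))%R; split.
- by rewrite lt_min !divr_gt0.
- by rewrite ge_min lexx orbT.
move=> h /andP[h0]; rewrite le_min => /andP[he2 _]; apply: he.
rewrite /ball/= sub0r normrN ger0_norm//; apply: le_lt_trans he2 _.
by move: e0; lra.
Unshelve. all: by end_near. Qed.

Lemma uniform_prob_sub_itv (R : realType) (a d : R) :
  (0 <= a)%R -> (0 < d)%R -> (a + d <= pi)%R ->
  uniform_prob (@pi_gt0 R) `[a, (a + d)%R] = (d / pi)%:E.
Proof.
move=> a0 d0 adpi; rewrite /uniform_prob.
rewrite (eq_integral (cst (pi^-1)%:E)); last first.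
  move=> x; rewrite inE/= in_itv/= => /andP[ax xd].
  by rewrite /uniform_pdf (le_trans a0 ax) (le_trans xd adpi)/= subr0.
rewrite integral_cst//= lebesgue_measure_itv/= lte_fin ltrDl d0.
by rewrite -EFinB -EFinM; congr EFin; rewrite addrAC subrr add0r mulrC.
Qed.

(** The two supporting lines meet at the parameter [a] solving an equation with determinant [D]. As
    the slope [m] is at most 1 in absolute value, [D >= 3/4 - 1/4], so [|a| <= e <= l / 2]; the
    abscissa then moves by at most [e], the margin left at both ends of the link by the bound on
    [c1]. *)
Lemma crossing_point (R : realType) (c1 c2 x1 x2 co si l e : R) :
  (`|x2| <= `|x1|)%R -> (0 < e)%R -> (x1 != 0)%R -> (`|co| <= 1 / 4)%R -> (3 / 4 <= si)%R ->
  (2 * e <= l)%R -> (`|c1 - x1 / 2| <= `|x1| / 2 - e)%R ->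
  (`|c2 - x2 / x1 * c1| <= e / 2)%R ->
  exists a b : R, [/\ (`|a| <= l / 2)%R, (0 <= b <= 1)%R,
    (c1 + a * co = b * x1)%R & (c2 + a * si = b * x2)%R].
Proof.
move=> x21 e0 x10 hco hsi el hc1 hc2; set m := (x2 / x1)%R in hc2.
have m1 : (`|m| <= 1)%R.
  by rewrite normrM normfV ler_pdivrMr ?normr_gt0// mul1r.
set D := (si - m * co)%R.
have D1 : (1 / 2 <= D)%R.
  have : (`|m * co| <= 1 / 4)%R.
    by rewrite normrM; apply: le_trans hco; rewrite ler_piMl.
  by rewrite ler_norml /D => /andP[_]; lra.
have D0 : (0 < D)%R by lra.
pose a := (- (c2 - m * c1) / D)%R.
have ae : (`|a| <= e)%R.
  rewrite normrM normrN normfV (gtr0_norm D0) ler_pdivrMr//.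
  by apply: le_trans hc2 _; nra.
have aco : (`|a * co| <= e)%R.
  by rewrite normrM; apply: le_trans ae; rewrite ler_piMr//; lra.
pose t := (c1 + a * co)%R.
have ht : (`|t - x1 / 2| <= `|x1| / 2)%R.
  have -> : (t - x1 / 2 = (c1 - x1 / 2) + a * co)%R by rewrite /t; ring.
  by apply: le_trans (ler_normD _ _) _; lra.
exists a, (t / x1)%R; split.
- by apply: le_trans ae _; lra.
- have h2 : (`|t / x1 - 1 / 2| <= 1 / 2)%R.
    have -> : (t / x1 - 1 / 2 = (t - x1 / 2) / x1)%R by field.
    rewrite normrM normfV ler_pdivrMr ?normr_gt0//.
    by apply: le_trans ht _; lra.
  by move: h2; rewrite ler_norml => /andP[? ?]; apply/andP; split; lra.
- by rewrite divfK.
- have -> : (t / x1 * x2 = m * t)%R by rewrite /m -mulrA mulrC [(_ / _)%R]mulrC.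
  have aD : (a * D = - (c2 - m * c1))%R by rewrite /a divfK// gt_eqF.
  have -> : (c2 + a * si = c2 + a * D + m * (a * co))%R by rewrite /D; ring.
  by rewrite aD /t; ring.
Qed.

Section shadow_areas.
Context (R : realType).
Local Notation mu := (@lebesgue_measure R).

(* Centers from which every long blockage nearly orthogonal to the dominant
   axis of the link (0,0)-(x1,x2), with |x2| <= |x1|, meets that link. *)
Definition shadow (e x1 x2 : R) : set (R * R) :=
  [set c | (`|c.1 - x1 / 2| <= `|x1| / 2 - e)%R /\ (`|c.2 - x2 / x1 * c.1| <= e / 2)%R].

Lemma measurable_shadow e x1 x2 : measurable (shadow e x1 x2).
Proof.
have m1 : measurable_fun setT (fun c : R * R => `|c.1 - x1 / 2|%R).
  apply: measurableT_comp; first exact: normr_measurable.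
  by apply: measurable_funB => //.
have m2 : measurable_fun setT (fun c : R * R => `|c.2 - x2 / x1 * c.1|%R).
  apply: measurableT_comp; first exact: normr_measurable.
  by apply: measurable_funB => //; apply: measurable_funM.
rewrite (_ : shadow e x1 x2 =
   (fun c : R * R => `|c.1 - x1 / 2|%R) @^-1` `]-oo, (`|x1| / 2 - e)%R] `&`
   (fun c : R * R => `|c.2 - x2 / x1 * c.1|%R) @^-1` `]-oo, (e / 2)%R]).
  apply: measurableI; rewrite -[X in measurable X]setTI.
    by apply: m1 => //; exact: measurable_itv.
  by apply: m2 => //; exact: measurable_itv.
by apply/seteqP; split => c; rewrite /= !in_itv/=.
Qed.

(** Above an interval of length [|x1| - 2 * e] every vertical section has length [e]. The iterated
    integral serves the shadow and, by Tonelli's theorem, its mirror image. *)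
Lemma integral_shadow e x1 x2 : (0 < e)%R -> (2 * e <= `|x1|)%R ->
  \int[mu]_x \int[mu]_y (\1_(shadow e x1 x2) (x, y))%:E =
  (e * (`|x1| - 2 * e))%:E.
Proof.
move=> e0 ex.
pose I : set R := `[(x1 / 2 - (`|x1| / 2 - e))%R, (x1 / 2 + (`|x1| / 2 - e))%R]%classic.
transitivity (\int[mu]_(x in I) e%:E); last first.
  rewrite integral_cst//=; last exact: measurable_itv.
  rewrite lebesgue_measure_itv/= lte_fin -EFinB; case: ltP => h.
    by rewrite -EFinM; congr EFin; field.
  (* In this degenerate case [|x1| = 2 * e] and both sides are zero. *)
  by rewrite mule0; congr EFin; apply/esym; nra.
rewrite [RHS]integral_mkcond; apply: eq_integral => x _; rewrite /patch.
case: ifPn => xI; last first.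
  rewrite integral0_eq// => y _; rewrite indicE memNset// => -[/= h _].
  case/negP: xI; rewrite inE /I/= in_itv/=; move: h; rewrite ler_norml => /andP[? ?].
  by apply/andP; split; lra.
pose Y : set R := `[(x2 / x1 * x - e / 2)%R, (x2 / x1 * x + e / 2)%R]%classic.
transitivity (\int[mu]_y (\1_Y y)%:E).
  apply: eq_integral => y _; rewrite !indicE; congr (_%:R%:E); congr nat_of_bool.
  apply/idP/idP; rewrite !inE /Y/= in_itv/=.
    by move=> [_ /=]; rewrite ler_norml => /andP[? ?]; apply/andP; split; lra.
  move=> /andP[? ?]; split; rewrite /= ler_norml.
    move: xI; rewrite inE /I/= in_itv/= => /andP[? ?].
    by apply/andP; split; lra.
  by apply/andP; split; lra.
have mY : measurable Y by exact: measurable_itv.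
rewrite integral_indic//= setIT.
rewrite lebesgue_measure_itv/= lte_fin ifT; last lra.
by rewrite -EFinB; congr EFin; move: (x2 / x1 * x)%R => k; field.
Qed.

Lemma area_shadow e x1 x2 : (0 < e)%R -> (2 * e <= `|x1|)%R ->
  area (shadow e x1 x2) = (e * (`|x1| - 2 * e))%:E.
Proof.
move=> e0 ex; rewrite -(integral_shadow x2 e0 ex).
have mS := measurable_shadow e x1 x2.
rewrite -(setIT (shadow e x1 x2)) -integral_indic// setIT integral_area//.
exact/measurable_EFinP/measurable_indic.
Qed.

Lemma area_swap_shadow e x1 x2 : (0 < e)%R -> (2 * e <= `|x1|)%R ->
  area [set c | shadow e x1 x2 (c.2, c.1)] = (e * (`|x1| - 2 * e))%:E.
Proof.
move=> e0 ex; rewrite -(integral_shadow x2 e0 ex).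
have mS := measurable_shadow e x1 x2.
have mS' : measurable [set c | shadow e x1 x2 (c.2, c.1)].
  rewrite -[X in measurable X]setTI.
  by apply: (@measurable_swap _ _ R R measurableT).
rewrite -[X in area X](setIT _) -integral_indic// integral_area//; last first.
  exact/measurable_EFinP/measurable_indic.
have mI : measurable_fun setT (fun z : R * R => (\1_(shadow e x1 x2) z : R)%:E).
  exact/measurable_EFinP/measurable_indic.
have h := @fubini_tonelli _ _ (measurableTypeR R) (measurableTypeR R) R mu mu
  (fun z => (\1_(shadow e x1 x2) z)%:E) mI.
apply: etrans (esym (h _)); last by [].
apply: eq_integral => x _; apply: eq_integral => y _.
by rewrite !indicE.
Qed.

End shadow_areas.

Section unblocked_probability.
Context (R : realType) (mu : R) (nuL : probability (measurableTypeR R) R).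
Context d (Omega : measurableType d) (P : probability Omega R) (K : blockages R Omega).
Hypothesis mu_gt0 : (0 < mu)%R.
Hypothesis hL : length_law nuL.
Hypothesis hK : boolean_model P mu nuL K.

Let mcenter i : measurable_fun setT (Defs.center K i).
Proof. exact: (measurable_center hK). Qed.

Let munblocked x : measurable [set w | unblocked K x w].
Proof.
exact: (measurable_link_has_type_at (measurable_center hK) (measurable_len hK)
  (measurable_orientation hK) LoS).
Qed.

(** Blockages with center in [S], length in [B] and orientation in [C] all hit the link and form a
    thinned Poisson process of mean number [mu * p * a]; the bound is its void probability. For each
    [n], an unblocked link excludes such a blockage among the first [n]. *)
Lemma unblocked_le_area (x : R * R) (S : set (R * R)) (B : set (measurableTypeR R))
    (C : set R) (p a : R) :
  measurable S -> measurable B -> measurable C -> (0 <= p <= 1)%R ->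
  area S = a%:E -> nuL B * uniform_prob (@pi_gt0 R) C = p%:E ->
  (forall c l o, S c -> B l -> C o -> blockage_segment c l o `&` link x !=set0) ->
  P [set w | unblocked K x w] <= (expR (- (mu * (p * a))))%:E.
Proof.
move=> mS mB mC p01 Sa BCp hit.
pose E i := [set w | B (len K i w) /\ C (orientation K i w)].
have mE i : measurable (E i).
  apply: measurableI; rewrite -[X in measurable X]setTI.
    exact: (measurable_len hK i measurableT).
  exact: (measurable_orientation hK i measurableT).
have thin n (b : 'I_n -> bool) A : <<s position_events (Defs.center K) >> A ->
    P (A `&` [set w | forall j : 'I_n, b j -> E j w]) =
    P A * (\prod_j (if b j then p else 1))%R%:E.
  move=> GA.
  pose B' j : set R := if b j then B else setT.
  pose C' j : set R := if b j then C else setT.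
  have mB' j : measurable (B' j) by rewrite /B'; case: (b j).
  have mC' j : measurable (C' j) by rewrite /C'; case: (b j).
  have := blockage_marks hK GA mB' mC'.
  rewrite (_ : [set w | forall j : 'I_n, b j -> E j w] =
    [set w | forall j : 'I_n, B' j (len K j w) /\ C' j (orientation K j w)]); last first.
    apply/seteqP; split => w ew j; have := ew j; rewrite /B' /C' /E /=.
      by case: (b j) => // /(_ isT).
    by case: (b j).
  move=> ->; congr (_ * _); rewrite -prodEFin; apply: eq_bigr => j _.
  by rewrite /B' /C'; case: (b j) => //; rewrite !probability_setT mule1.
have f01 c : (0 <= 1 - p * \1_S c <= 1)%R.
  by case/andP: p01 => ? ?; rewrite indicE; case: (c \in S) => /=; apply/andP; split; lra.
have mf : measurable_fun setT (fun c => 1 - p * \1_S c)%R.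
  by apply: measurable_funB => //; apply: measurable_funM => //; exact: measurable_indic.
have lim := ppp_pgfl_probability mcenter (ltW mu_gt0) (center_PPP hK) mf f01.
have int1 : \int[area]_c (1 - (1 - p * \1_S c))%:E = (p * a)%:E.
  under eq_integral do rewrite opprB addrC subrK EFinM.
  case/andP: p01 => p0 _.
  rewrite ge0_integralZl_EFin//; last exact/measurable_EFinP/measurable_indic.
  by rewrite integral_indic// setIT EFinM -Sa.
rewrite int1 -EFinM /= in lim.
apply: (cvge_to_ge lim); apply: nearW => n.
rewrite -(probability_no_retained_point mcenter mE mS p01 thin n).
apply: le_measure; rewrite ?inE//.
  rewrite [X in measurable X](_ : _ = \bigcap_(j in [set: 'I_n])
      ~` (Defs.center K j @^-1` S `&` E j)).
    apply: fin_bigcap_measurable => // j _; apply: measurableC.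
    apply: measurableI => //; rewrite -[X in measurable X]setTI.
    exact: mcenter.
  by apply/seteqP; split => [w ew j _|w ew j]; [exact: ew|exact: ew j I].
move=> w uw j [Sc [Bl Co]]; have := uw j.
by have [y yh] := hit _ _ _ Sc Bl Co => e0; rewrite e0 in yh.
Qed.

Lemma unblocked_decay : exists C k : R, [/\ (0 < C)%R, (0 < k)%R &
  forall x : R * R, P [set w | unblocked K x w] <=
    (C * expR (- (k * (`|x.1| + `|x.2|))))%:E].
Proof.
have [e e0 Be] := length_pos_prob hL.
have [dl [d0 dpi axis]] := near_axis_angle R.
have pi0 := pi_gt0 R.
set B : set (measurableTypeR R) := `[(2 * e)%R, +oo[%classic in Be.
have mB : measurable B by exact: measurable_itv.
pose p := (fine (nuL B) * (dl / pi))%R.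
have nu0 : (0 < fine (nuL B))%R by rewrite fine_gt0// Be ltey_eq fin_num_measure.
have nu1 : (fine (nuL B) <= 1)%R.
  by rewrite -lee_fin fineK ?fin_num_measure// probability_le1.
have q0 : (0 < dl / pi)%R by rewrite divr_gt0.
have q1 : (dl / pi <= 1)%R by rewrite ler_pdivrMr// mul1r; lra.
have p0 : (0 < p)%R by rewrite mulr_gt0.
have p01 : (0 <= p <= 1)%R by rewrite ltW//= /p mulr_ile1// ltW.
pose k := (mu * p * e)%R.
have k0 : (0 < k)%R by rewrite /k mulr_gt0// mulr_gt0.
have vert x : (`|x.2| <= `|x.1|)%R -> (2 * e <= `|x.1|)%R ->
    P [set w | unblocked K x w] <= (expR (- (k * (`|x.1| - 2 * e))))%:E.
  move=> x21 ex.
  have x0 : (x.1 != 0)%R by rewrite -normr_gt0; lra.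
  have -> : (k * (`|x.1| - 2 * e) = mu * (p * (e * (`|x.1| - 2 * e))))%R.
    by rewrite /k; ring.
  apply: (@unblocked_le_area x (shadow e x.1 x.2) B
    `[(pi / 2)%R, (pi / 2 + dl)%R]%classic) => //.
  - exact: measurable_shadow.
  - exact: area_shadow.
  - rewrite uniform_prob_sub_itv//; [|by rewrite divr_ge0// ltW|lra].
    by rewrite /p [RHS]EFinM fineK// fin_num_measure.
  - move=> c l o [/= c1 c2]; rewrite /B /= !in_itv/= andbT => el /andP[ho1 ho2].
    have [|sn cs] := axis (o - pi / 2)%R; first by apply/andP; split; lra.
    have cosE : (cos o = - sin (o - pi / 2))%R by rewrite -cosDpihalf subrK.
    have sinE : (sin o = cos (o - pi / 2))%R by rewrite -sinDpihalf subrK.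
    have hco : (`|cos o| <= 1 / 4)%R by rewrite cosE normrN.
    have hsi : (3 / 4 <= sin o)%R by rewrite sinE.
    have [a [b [al b01 h1 h2]]] := crossing_point x21 e0 x0 hco hsi el c1 c2.
    exists (b * x.1, b * x.2)%R; split; last by exists b.
    by exists a => //; rewrite h1 h2.
have horiz x : (`|x.1| <= `|x.2|)%R -> (2 * e <= `|x.2|)%R ->
    P [set w | unblocked K x w] <= (expR (- (k * (`|x.2| - 2 * e))))%:E.
  move=> x12 ex.
  have x0 : (x.2 != 0)%R by rewrite -normr_gt0; lra.
  have -> : (k * (`|x.2| - 2 * e) = mu * (p * (e * (`|x.2| - 2 * e))))%R.
    by rewrite /k; ring.
  apply: (@unblocked_le_area x [set c | shadow e x.2 x.1 (c.2, c.1)] B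
    `[0%R, (0 + dl)%R]%classic) => //.
  - rewrite -[X in measurable X]setTI.
    by apply: (@measurable_swap _ _ R R measurableT); exact: measurable_shadow.
  - exact: area_swap_shadow.
  - rewrite uniform_prob_sub_itv//; last lra.
    by rewrite /p [RHS]EFinM fineK// fin_num_measure.
  - move=> c l o [/= c1 c2]; rewrite /B /= !in_itv/= andbT add0r => el o12.
    have [sn cs] := axis _ o12.
    have [a [b [al b01 h1 h2]]] := @crossing_point R c.2 c.1 x.2 x.1 (sin o) (cos o)
      l e x12 e0 x0 sn cs el c1 c2.
    exists (b * x.1, b * x.2)%R; split; last by exists b.
    by exists a => //; rewrite h1 h2.
(* With [M] the larger of the two coordinates, the bound is [expR (- (k * (M - 2 * e)))]: [C]
   absorbs the term in [e] and makes the bound trivial for [M < 2 * e], and the rate is halved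
   because the l1 norm is at most [2 * M]. *)
exists (expR (k * (2 * e))), (k / 2)%R; split; [exact: expR_gt0|by rewrite divr_gt0|].
move=> x; rewrite -expRD.
have bound M : P [set w | unblocked K x w] <= (expR (- (k * (M - 2 * e))))%:E ->
    (`|x.1| <= M)%R -> (`|x.2| <= M)%R ->
    P [set w | unblocked K x w] <=
      (expR (k * (2 * e) + - (k / 2 * (`|x.1| + `|x.2|))))%:E.
  move=> PM M1 M2; apply: le_trans PM _; rewrite lee_fin ler_expR.
  have : (k * (`|x.1| + `|x.2|) <= k * (2 * M))%R by rewrite ler_pM2l//; lra.
  by lra.
have [M [M1 M2 MP]] : exists M : R, [/\ (`|x.1| <= M)%R, (`|x.2| <= M)%R &
    P [set w | unblocked K x w] <= (expR (- (k * (M - 2 * e))))%:E]; last first.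
  exact: (bound M).
have small M : (M < 2 * e)%R ->
    P [set w | unblocked K x w] <= (expR (- (k * (M - 2 * e))))%:E.
  move=> Me; apply: le_trans (probability_le1 _ (munblocked x)) _.
  rewrite lee_fin -[leLHS]expR0 ler_expR -mulrN mulr_ge0//; [exact: ltW|lra].
have [x21|/ltW x12] := leP `|x.2|%R `|x.1|%R.
  exists `|x.1|%R; split => //.
  by have [ex|ex] := leP (2 * e)%R `|x.1|%R; [exact: vert|exact: small].
exists `|x.2|%R; split => //.
by have [ex|ex] := leP (2 * e)%R `|x.2|%R; [exact: horiz|exact: small].
Qed.

End unblocked_probability.

(** The integrand is at most [k^-1] times the sum of the exponential density and its reflection,
    each of mass 1. *)
Lemma integral_expR_norm_lty (R : realType) (k : R) : (0 < k)%R ->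
  \int[lebesgue_measure]_t (expR (- (k * `|t|)))%:E < +oo.
Proof.
move=> k0; pose f (t : R) := (k^-1 * exponential_pdf k t)%R.
have mpdf : measurable_fun setT (fun t : R => exponential_pdf k t).
  exact: measurable_exponential_pdf.
have mf : measurable_fun setT f by apply: measurable_funM.
have f0 t : (0 <= f t)%R.
  by rewrite mulr_ge0 ?invr_ge0 ?exponential_pdf_ge0// ltW.
have mE : measurable_fun setT (fun t : R => (expR (- (k * `|t|)))%:E).
  apply/measurable_EFinP; apply: measurableT_comp; first exact: measurable_expR.
  apply: measurable_funN; exact: measurable_funM.
have mEf : measurable_fun setT (fun t : R => (f t)%:E) by exact/measurable_EFinP.
have mEfN : measurable_fun setT (fun t : R => (f (- t)%R)%:E).
  by apply: (measurableT_comp mEf); exact: oppr_measurable.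
apply: (@le_lt_trans _ _ (\int[lebesgue_measure]_t ((f t)%:E + (f (- t)%R)%:E))).
  apply: ge0_le_integral => //.
  - exact: emeasurable_funD.
  move=> t _; rewrite -EFinD lee_fin.
  have [t0|t0] := leP 0%R t.
    rewrite ger0_norm// -[leLHS]addr0 lerD//.
    rewrite /f exponential_pdfE// mulrA mulVf ?mul1r ?gt_eqF//.
    by rewrite mulNr.
  rewrite ltr0_norm// -[leLHS]add0r lerD//.
  rewrite /f exponential_pdfE ?oppr_ge0 ?(ltW t0)// mulrA mulVf ?mul1r ?gt_eqF//.
  by rewrite mulNr.
have fin1 : \int[lebesgue_measure]_t (f t)%:E = (k^-1)%:E.
  under eq_integral do rewrite EFinM.
  rewrite ge0_integralZl_EFin//.
  - by rewrite integral_exponential_pdf// mule1.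
  - by move=> t _; rewrite lee_fin exponential_pdf_ge0// ltW.
  - exact/measurable_EFinP.
  - by rewrite invr_ge0 ltW.
rewrite ge0_integralD//; last 2 first.
- by move=> t _; rewrite lee_fin.
- by move=> t _; rewrite lee_fin.
rewrite -(ge0_integral_opp mEf); last by move=> t; rewrite lee_fin.
by rewrite fin1 -EFinD ltry.
Qed.

Lemma integral_area_expR_norm_lty (R : realType) (k : R) : (0 < k)%R ->
  \int[@area R]_x (expR (- (k * (`|x.1| + `|x.2|))))%:E < +oo.
Proof.
move=> k0.
have m1 : measurable_fun setT (fun t : R => expR (- (k * `|t|))).
  apply: measurableT_comp; first exact: measurable_expR.
  apply: measurable_funN; exact: measurable_funM.
have mE1 : measurable_fun setT (fun t : R => (expR (- (k * `|t|)))%:E).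
  exact/measurable_EFinP.
have E x : expR (- (k * (`|x.1| + `|x.2|))) =
    (expR (- (k * `|x.1|)) * expR (- (k * `|x.2|)))%R :> R.
  by rewrite -expRD mulrDr opprD.
under eq_integral do rewrite E.
rewrite integral_area; last 2 first.
- apply/measurable_EFinP; apply: measurable_funM.
    by apply: (measurableT_comp m1); exact: measurable_fst.
  by apply: (measurableT_comp m1); exact: measurable_snd.
- by move=> x; rewrite lee_fin mulr_ge0// expR_ge0.
have I := integral_expR_norm_lty k0.
have inner (x : R) : \int[lebesgue_measure]_y
      (expR (- (k * `|x|)) * expR (- (k * `|y|)))%:E =
    (expR (- (k * `|x|)))%:E * \int[lebesgue_measure]_y (expR (- (k * `|y|)))%:E.
  under eq_integral do rewrite EFinM.
  by rewrite ge0_integralZl_EFin// => y _; rewrite lee_fin expR_ge0.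
under eq_integral do rewrite inner.
rewrite /= ge0_integralZr//; last first.
  by apply: integral_ge0 => x _; rewrite lee_fin expR_ge0.
have I0 : 0 <= \int[lebesgue_measure]_t (expR (- (k * `|t : R|)))%:E.
  by apply: integral_ge0 => x _; rewrite lee_fin expR_ge0.
apply: lte_mul_pinfty => //.
by rewrite ge0_fin_numE.
Qed.

(** * Null sets, limits of exponentials and the Laplace transform of the fading *)

Import HBNNSimple.

(* No measurability is assumed: the infinite sum in [interference] is only
   known to be measurable off a null set. *)
Lemma ge0_integral_eq_off_null d (T : measurableType d) (R : realType)
    (mu : {measure set T -> \bar R}) (D N : set T) (f g : T -> \bar R) :
  measurable N -> mu N = 0 ->
  (forall x, 0 <= f x) -> (forall x, 0 <= g x) ->
  (forall x, ~ N x -> f x = g x) ->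
  \int[mu]_(x in D) f x = \int[mu]_(x in D) g x.
Proof.
move=> mN N0 f0 g0 fg; rewrite integral_mkcond [RHS]integral_mkcond.
wlog suff le_fg : f g f0 g0 fg /
    \int[mu]_x (f \_ D) x <= \int[mu]_x (g \_ D) x.
  apply/eqP; rewrite eq_le; apply/andP; split; first exact: le_fg.
  by apply: le_fg => // x /fg.
have fD0 x : 0 <= (f \_ D) x by rewrite /patch; case: ifP.
have gD0 x : 0 <= (g \_ D) x by rewrite /patch; case: ifP.
rewrite ge0_integralTE// ge0_integralTE//.
apply: ge_ereal_sup => _ [h /= hf <-].
have mNC : measurable (~` N) by exact: measurableC.
pose h' : {nnsfun T >-> R} := mul_nnsfun h (indic_nnsfun R mNC).
have -> : sintegral mu h = sintegral mu h'.
  rewrite -!integralT_nnsfun; apply: ge0_ae_eq_integral => //.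
  - exact/measurable_EFinP.
  - exact/measurable_EFinP.
  - by move=> x _; rewrite lee_fin.
  - by move=> x _; rewrite lee_fin.
  exists N; split => // x /=; apply: contra_notP => Nx _; congr EFin.
  transitivity (h x * \1_(~` N) x)%R; last by [].
  by rewrite indicE mem_set// mulr1.
apply: ereal_sup_ubound; exists h' => //= x.
suff : (h x * \1_(~` N) x)%R%:E <= (g \_ D) x by [].
rewrite indicE.
have [Nx|Nx] := boolP (x \in ~` N); last by rewrite mulr0.
rewrite mulr1; apply: le_trans (hf x) _; rewrite /patch.
by case: ifP => // _; rewrite fg//; exact: set_mem Nx.
Qed.

(** The limit [+oo] is included: infinite interference contributes 0 to the Laplace transform. *)
Lemma cvg_expeRN (R : realType) (u : R^nat) (l : \bar R) :
  (u n)%:E @[n --> \oo] --> l -> (forall n, (0 <= u n)%R) ->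
  (expR (- u n))%:E @[n --> \oo] --> expeR (- l).
Proof.
move=> ul u0; case: l ul => [l| |] ul /=.
- have {}ul : u n @[n --> \oo] --> l by exact: (fine_cvg ul).
  apply: cvg_EFin; first exact: nearW.
  apply: (@continuous_cvg _ _ _ _ _ _ (@expR R)); first exact: continuous_expR.
  exact: cvgN.
- apply: cvg_EFin; first exact: nearW.
  have {}ul : u n @[n --> \oo] --> +oo%R by apply/cvgeryP.
  exact: (cvg_comp _ _ ul (@cvgr_expR R)).
- have : 0 <= (-oo : \bar R) by apply: (cvge_to_ge ul); apply: nearW => n; rewrite lee_fin.
  by [].
Qed.

(** Multiplying the density of rate 1 by [expR (- (h * c'))] with [c' = |w|] gives [(1 + c')^-1]
    times the density of rate [1 + c']. *)
Lemma exponential_laplace (R : realType) (nu : probability (measurableTypeR R) R) :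
  (forall B, measurable B -> nu B = exponential_prob 1%R B) ->
  forall w : R, \int[nu]_h (expR (- (`|h| * `|w|)))%:E = ((1 + `|w|)^-1)%:E.
Proof.
move=> nuE w.
have mpdf : measurable_fun setT (fun t : measurableTypeR R => exponential_pdf (1 : R)%R t).
  exact: measurable_exponential_pdf.
have pdf0 (t : R) : (0 <= exponential_pdf 1%R t)%R by exact: exponential_pdf_ge0.
have mE : measurable_fun setT (fun h : measurableTypeR R => (expR (- (`|h| * `|w|)))%:E).
  apply/measurable_EFinP; apply: measurableT_comp; first exact: measurable_expR.
  apply: measurable_funN; apply: measurable_funM => //.
rewrite (eq_measure_integral (density lebesgue_measure mpdf pdf0)); last first.
  by move=> A mA _; apply: nuE.
rewrite ge0_integral_density//.
set c : R := (1 + `|w|)%R.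
have c0 : (0 < c)%R by rewrite /c; have := normr_ge0 w; lra.
rewrite (_ : (c^-1)%:E = \int[lebesgue_measure]_t (c^-1 * exponential_pdf c t)%:E); last first.
  under eq_integral do rewrite EFinM.
  rewrite ge0_integralZl_EFin//.
  - by rewrite [X in _ * X](integral_exponential_pdf c0) mule1.
  - by move=> t _; rewrite lee_fin; exact: exponential_pdf_ge0 (ltW c0) _.
  - have mc : measurable_fun setT (fun t : measurableTypeR R => exponential_pdf c t).
      exact: measurable_exponential_pdf.
    exact/measurable_EFinP.
  - by rewrite invr_ge0 (ltW c0).
apply: eq_integral => t _; rewrite -EFinM; congr EFin.
have [t0|t0] := leP 0%R t; last by rewrite !lt0_exponential_pdf// !mulr0.
rewrite !exponential_pdfE// mul1r -expRD mulrA mulVf ?mul1r ?gt_eqF//.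
by congr expR; rewrite ger0_norm// /c; ring.
Qed.

Lemma ex_exponential_prob (R : realType) :
  exists nu : probability (measurableTypeR R) R,
    forall B, nu B = exponential_prob (1 : R)%R B.
Proof.
eexists (exponential_prob (1 : R)%R) => B; reflexivity.
Unshelve. exact: ltr01.
Qed.

(** * The Laplace transform of the interference *)

Section plane_rotation.
Context (R : realType).

(** Rotation by [- phi]: it takes the direction of the given BS to the first axis, where [p_joint]
    puts the first link. *)
Definition rotate (phi : R) (x : R * R) : R * R :=
  (x.1 * cos phi + x.2 * sin phi, x.2 * cos phi - x.1 * sin phi)%R.

Definition radius (x : R * R) : R := Num.sqrt (x.1 ^+ 2 + x.2 ^+ 2).

Lemma rotate_polar (phi t a : R) : rotate phi (polar t (phi + a)%R) = polar t a.
Proof.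
transitivity (polar t ((phi + a) - phi)%R); last by rewrite addrAC subrr add0r.
by rewrite /rotate /polar/= cosB sinB; congr pair; ring.
Qed.

Lemma radius_polar (t a : R) : (0 <= t)%R -> radius (polar t a) = t.
Proof.
move=> t0; rewrite /radius /polar/= !exprMn -mulrDr cos2Dsin2 mulr1 sqrtr_sqr.
exact: ger0_norm.
Qed.

Lemma measurable_rotate phi : measurable_fun setT (rotate phi).
Proof.
apply: measurable_fun_pair.
  by apply: measurable_funD; apply: measurable_funM.
by apply: measurable_funB; apply: measurable_funM.
Qed.

Lemma measurable_radius : measurable_fun setT radius.
Proof.
apply: (measurableT_comp (f := @Num.sqrt R)).
  by apply: continuous_measurable_fun => x; exact: sqrt_continuous.
by apply: measurable_funD; apply: measurable_funX.
Qed.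

(** The Euclidean norm is invariant, and the l1 norm lies between it and twice it; 2 is a crude form
    of the square root of 2. *)
Lemma rotate_norm phi x :
  ((`|x.1| + `|x.2|) / 2 <= `|(rotate phi x).1| + `|(rotate phi x).2|)%R.
Proof.
rewrite -ler_sqr ?nnegrE ?divr_ge0 ?addr_ge0//.
set y := rotate phi x.
have yE : (y.1 ^+ 2 + y.2 ^+ 2 = x.1 ^+ 2 + x.2 ^+ 2)%R.
  rewrite /y /rotate/=; have := cos2Dsin2 phi => cs.
  transitivity ((x.1 ^+ 2 + x.2 ^+ 2) * (cos phi ^+ 2 + sin phi ^+ 2))%R.
    by ring.
  by rewrite cs mulr1.
have y0 : (0 <= `|y.1| * `|y.2|)%R by rewrite mulr_ge0.
have ysq : (x.1 ^+ 2 + x.2 ^+ 2 <= (`|y.1| + `|y.2|) ^+ 2)%R.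
  rewrite -yE -(real_normK (num_real y.1)) -(real_normK (num_real y.2)).
  by rewrite sqrrD; lra.
apply: le_trans ysq.
rewrite -(real_normK (num_real x.1)) -(real_normK (num_real x.2)).
by have := sqr_ge0 (`|x.1| - `|x.2|)%R; nra.
Qed.

Lemma radius_le_box (x : R * R) t : (radius x <= t)%R ->
  (`|x.1| <= t)%R /\ (`|x.2| <= t)%R.
Proof.
move=> xt; split; apply: le_trans xt; rewrite -sqrtr_sqr ler_wsqrtr//.
  by rewrite lerDl sqr_ge0.
by rewrite lerDr sqr_ge0.
Qed.

End plane_rotation.

Section parameters.
Context (R : realType) (mu : R) (nuL : probability (measurableTypeR R) R).
Hypothesis mu_gt0 : (0 < mu)%R.
Hypothesis hL : length_law nuL.

Lemma beta_gt0 : (0 < beta mu nuL)%R.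
Proof.
rewrite /beta divr_gt0 ?pi_gt0// !mulr_gt0//.
by rewrite fine_gt0// (length_mean_gt0 hL) (length_mean_fin hL).
Qed.

Lemma p_single_gt0 s r : (0 < r)%R -> (0 < p_single (beta mu nuL) s r)%R.
Proof.
move=> r0; case: s => /=; first exact: expR_gt0.
by rewrite subr_gt0 expR_lt1 oppr_lt0 mulr_gt0// beta_gt0.
Qed.

End parameters.

Section conditional_type_probability.
Context (R : realType) d (Omega : measurableType d).
Variables (P : probability Omega R) (K : blockages R Omega).
Hypothesis mcenter : forall i, measurable_fun setT (Defs.center K i).
Hypothesis mlen : forall i, measurable_fun setT (len K i).
Hypothesis morient : forall i, measurable_fun setT (orientation K i).

Let mtype u x : measurable [set w | link_has_type K u x w].
Proof. exact: measurable_link_has_type_at. Qed.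

Let mtype2 s u y x :
  measurable [set w | link_has_type K s y w /\ link_has_type K u x w].
Proof. exact: (measurableI _ _ (mtype s y) (mtype u x)). Qed.

Lemma joint_type_prob_ge0 s u y x : (0 <= joint_type_prob K P s u y x)%R.
Proof. by rewrite /joint_type_prob fine_ge0. Qed.

Lemma joint_type_prob_sum s y x :
  (joint_type_prob K P s LoS y x + joint_type_prob K P s NLoS y x =
   fine (P [set w | link_has_type K s y w]))%R.
Proof.
rewrite /joint_type_prob -fineD ?fin_num_measure// -measureU//; last first.
  by apply/seteqP; split => // w [[_ /= a] [_ /= b]].
congr (fine (P _)); apply/seteqP; split => w /=; first by move=> [[]|[]].
by move=> sw; have [uw|uw] := pselect (unblocked K x w); [left|right].
Qed.

Lemma joint_type_prob_LoS_le s y x :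
  (joint_type_prob K P s LoS y x)%:E <= P [set w | unblocked K x w].
Proof.
have mA := mtype2 s LoS y x; have mB := mtype LoS x.
rewrite /joint_type_prob fineK ?fin_num_measure//.
by apply: le_measure; [exact: mem_set|exact: mem_set|move=> w []].
Qed.

End conditional_type_probability.

Section thinned_attenuation.
Context (R : realType) d (Omega : measurableType d).
Variables (PK : probability Omega R) (K : blockages R Omega).
Variable ell : link_type -> R -> R.

(** Conditional probability that a BS at [x] has type [u], given a BS of type [s] at distance [r] in
    direction [phi]. *)
Definition type_weight (p1 r phi : R) (s u : link_type) (x : R * R) : R :=
  (joint_type_prob K PK s u (polar r 0) (rotate phi x) / p1)%R.

Definition outside (r : R) (s u : link_type) : set R :=
  [set t | exclusion ell u s r < t%:E].

(* [path_loss] constrains [ell] on nonnegative arguments only. *)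
Definition loss (v : link_type) (t : R) : R := ell v (Num.max t 0%R).

(** Factor contributed by a BS of type [u] at [x]: the indicator that it respects the exclusion
    radius and, when it interferes ([u = v]), the mean of its fading factor. *)
Definition attenuation (r z : R) (s v u : link_type) (x : R * R) : R :=
  (\1_(outside r s u) (radius x) *
   (if `[< u = v >] then (1 + z * loss v (radius x))^-1 else 1))%R.

Definition mean_attenuation (p1 r phi z : R) (s v : link_type) (x : R * R) : R :=
  (type_weight p1 r phi s LoS x * attenuation r z s v LoS x +
   type_weight p1 r phi s NLoS x * attenuation r z s v NLoS x)%R.

Hypothesis hell : path_loss ell.

Lemma measurable_outside r s u : measurable (outside r s u).
Proof.
rewrite (_ : outside r s u = EFin @^-1` `]exclusion ell u s r, +oo]%classic); last first.
  by apply/seteqP; split => t; rewrite /outside /= in_itv/= leey andbT.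
rewrite -[X in measurable X]setTI.
by apply: EFin_measurable => //; exact: emeasurable_itv.
Qed.

Lemma loss_ge0 v t : (0 <= loss v t)%R.
Proof. by apply: (path_loss_ge0 hell); rewrite le_max lexx orbT. Qed.

Lemma loss_nonneg v t : (0 <= t)%R -> loss v t = ell v t.
Proof. by move=> t0; rewrite /loss max_l. Qed.

Lemma loss_noninc v x y : (x <= y)%R -> (loss v y <= loss v x)%R.
Proof.
move=> xy; apply: (path_loss_noninc hell); first by rewrite le_max lexx orbT.
by rewrite ge_max !le_max xy lexx !orbT.
Qed.

Lemma measurable_loss v : measurable_fun setT (loss v).
Proof. by apply: nonincreasing_measurable => // x y; exact: loss_noninc. Qed.

Lemma measurable_attenuation r z s v u : (0 <= z)%R ->
  measurable_fun setT (attenuation r z s v u).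
Proof.
move=> z0; apply: measurable_funM.
  apply: (measurableT_comp (measurable_indic (measurable_outside r s u))).
  exact: measurable_radius.
case: asboolP => _ //.
apply: (measurableT_comp (f := fun t : R => (1 + z * loss v t)^-1%R)); last first.
  exact: measurable_radius.
have pos t : (0 < 1 + z * loss v t)%R by rewrite ltr_wpDr// mulr_ge0// loss_ge0.
apply: nondecreasing_measurable => // x y xy.
rewrite lef_pV2 ?posrE ?pos// lerD2l; apply: ler_wpM2l => //.
exact: loss_noninc.
Qed.

Lemma attenuation01 r z s v u x : (0 <= z)%R -> (0 <= attenuation r z s v u x <= 1)%R.
Proof.
move=> z0; rewrite /attenuation indicE.
case: (_ \in _) => /=; last by rewrite mul0r lexx ler01.
rewrite mul1r; case: asboolP => _; last by rewrite ler01 lexx.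
have zl : (0 <= z * loss v (radius x))%R by rewrite mulr_ge0// loss_ge0.
by rewrite invr_ge0 addr_ge0//= invf_le1 ?lerDl// ltr_wpDr.
Qed.

End thinned_attenuation.

Section mean_attenuation_pgfl.
Context (R : realType) (lam : R) (dK : measure_display) (OmegaK : measurableType dK).
Variables (PK : probability OmegaK R) (K : blockages R OmegaK).
Hypothesis mcenter : forall i, measurable_fun setT (Defs.center K i).
Hypothesis mlen : forall i, measurable_fun setT (len K i).
Hypothesis morient : forall i, measurable_fun setT (orientation K i).
Variables (ell : link_type -> R -> R) (s v : link_type) (r : R).
Hypothesis lam_gt0 : (0 < lam)%R.
Hypothesis hell : path_loss ell.
Context d (Omega : measurableType d) (P : probability Omega R).
Variables (phi : R) (N : network R Omega) (p : link_type -> R -> R).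
Hypothesis p_gt0 : (0 < p s r)%R.
Hypothesis hN : first_order_model P lam p (p_joint PK K) r phi N.

Local Notation X := (bs_position phi N).
Local Notation D0 := (bs_type0 N @^-1` [set s]).
Local Notation q := (type_weight PK K (p s r) r phi s).

Lemma measurable_bs_position i : measurable_fun setT (X i).
Proof.
have m1 := measurable_dist hN i; have m2 := measurable_angle hN i.
have m12 : measurable_fun setT (fun w => (bs_dist N i w, bs_angle N i w)).
  exact: measurable_fun_pair.
exact: (measurableT_comp (measurable_polar_shift phi) m12).
Qed.

Let mD0 : measurable D0.
Proof. exact: (measurable_type0 hN). Qed.

Let PD0 : P D0 = (p s r)%:E.
Proof. exact: (type0_law hN). Qed.

Lemma radius_bs_position i w : radius (X i w) = bs_dist N i w.
Proof. by rewrite /bs_position radius_polar// (dist_ge0 hN). Qed.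

Let rotateX i w : rotate phi (X i w) = polar (bs_dist N i w) (bs_angle N i w).
Proof. exact: rotate_polar. Qed.

Let qX u i w : q u (X i w) =
  (p_joint PK K s u r (bs_dist N i w) (bs_angle N i w) / p s r)%R.
Proof. by rewrite /type_weight rotateX. Qed.

Lemma type_weight_ge0 u x : (0 <= q u x)%R.
Proof. by rewrite /type_weight divr_ge0 ?joint_type_prob_ge0// ltW. Qed.

Lemma measurable_type_weight u : measurable_fun setT (q u).
Proof.
apply: measurable_funM => //.
apply: (measurableT_comp _ (measurable_rotate phi)).
exact: measurable_joint_type_prob.
Qed.

Let type_law n (u : 'I_n -> link_type) A : <<s position_events X >> A ->
  P (D0 `&` A `&` [set w | forall j : 'I_n, bs_type N j w = u j]) =
  \int[P]_(w in D0 `&` A) (\prod_(j < n) q (u j) (X j w))%R%:E.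
Proof.
move=> GA; rewrite (bs_type_law hN)//; apply: eq_integral => w _; congr EFin.
by apply: eq_bigr => j _; rewrite qX.
Qed.

(** The sum is the constant [m / p s r], with [m] the marginal of [p_joint]. Adding the type law
    over the two types of the BS of index 0 gives [P D0 = (m / p s r) * P D0], and [P D0] is
    positive. *)
Lemma type_weight_sum x : (q LoS x + q NLoS x = 1)%R.
Proof.
pose m := fine (PK [set w | link_has_type K s (polar r 0) w]).
have sumE y : (q LoS y + q NLoS y = m / p s r)%R.
  by rewrite /type_weight -mulrDl joint_type_prob_sum.
rewrite sumE.
have GT : <<s position_events X >> setT.
  exact: (@measurableT _ (g_sigma_algebraType (position_events X))).
have lawL := type_law (fun _ : 'I_1 => LoS) GT.
have lawN := type_law (fun _ : 'I_1 => NLoS) GT.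
rewrite !setIT in lawL lawN.
have mq u : measurable_fun setT (fun w => (\prod_(j < 1) q u (X j w))%R%:E).
  apply/measurable_EFinP; apply: measurable_prod => j _.
  exact: (measurableT_comp (measurable_type_weight u) (measurable_bs_position j)).
have q0 u w : 0 <= (\prod_(j < 1) q u (X j w))%R%:E.
  by rewrite lee_fin; apply: prodr_ge0 => j _; exact: type_weight_ge0.
have : P D0 = (m / p s r)%:E * P D0.
  transitivity (\int[P]_(w in D0) (m / p s r)%:E); last by rewrite integral_cst.
  transitivity (\int[P]_(w in D0) ((\prod_(j < 1) q LoS (X j w))%R%:E +
      (\prod_(j < 1) q NLoS (X j w))%R%:E)); last first.
    by apply: eq_integral => w _; rewrite !big_ord1 -EFinD sumE.
  rewrite ge0_integralD//; [|exact: measurable_funTS|exact: measurable_funTS].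
  rewrite -[X in _ = X + _]lawL -[X in _ = _ + X]lawN -measureU//.
  - congr (P _); apply/seteqP; split => w; last by move=> [[]|[]].
    move=> Dw; case E : (bs_type N 0 w); [left|right]; split => // j;
      by rewrite ord1.
  - apply: measurableI => //; rewrite (_ : [set w | _] = bs_type N 0 @^-1` [set LoS]).
      exact: (measurable_type hN).
    by apply/seteqP; split => w /=; [move/(_ ord0)|move=> h j; rewrite ord1].
  - apply: measurableI => //; rewrite (_ : [set w | _] = bs_type N 0 @^-1` [set NLoS]).
      exact: (measurable_type hN).
    by apply/seteqP; split => w /=; [move/(_ ord0)|move=> h j; rewrite ord1].
  - by apply/seteqP; split => // w [[_ /(_ ord0) /= a] [_ /(_ ord0) /= b]]; rewrite a in b.
rewrite PD0 -EFinM => -[h].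
by rewrite -(mulfK (lt0r_neq0 p_gt0) (m / p s r)%R) -h divff// lt0r_neq0.
Qed.

Variable z : R.
Hypothesis z_ge0 : (0 <= z)%R.

Local Notation f := (attenuation ell r z s v).
Local Notation g := (mean_attenuation PK K ell (p s r) r phi z s v).

Let mf u : measurable_fun setT (f u).
Proof. exact: measurable_attenuation. Qed.

Let f01 u x : (0 <= f u x <= 1)%R.
Proof. exact: attenuation01. Qed.

Lemma measurable_mean_attenuation : measurable_fun setT g.
Proof.
by apply: measurable_funD; apply: measurable_funM => //;
  exact: measurable_type_weight.
Qed.

Lemma mean_attenuation01 x : (0 <= g x <= 1)%R.
Proof.
case/andP: (f01 LoS x) => ? ?; case/andP: (f01 NLoS x) => ? ?.
have ? := type_weight_ge0 LoS x; have ? := type_weight_ge0 NLoS x.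
have e := type_weight_sum x.
rewrite /mean_attenuation; apply/andP; split.
  by apply: addr_ge0; apply: mulr_ge0.
apply: (@le_trans _ _ (q LoS x + q NLoS x)%R); last by rewrite e.
by apply: lerD; exact: ler_piMr.
Qed.

Lemma cvg_prod_attenuation :
  \int[P]_(w in D0) (\prod_(j < n) f (bs_type N j w) (X j w))%R%:E @[n --> \oo] -->
  P D0 * expeR (- (lam%:E * \int[area]_x (1 - g x)%:E)).
Proof.
under eq_fun => n.
  rewrite (integral_prod_types mD0 measurable_bs_position (measurable_type hN) type_weight_ge0
    measurable_type_weight type_law mf f01).
  over.
apply: (ppp_pgfl_cond measurable_bs_position (ltW lam_gt0) mD0 _ (bs_PPP hN s)
  measurable_mean_attenuation mean_attenuation01).
by rewrite PD0 eqe gt_eqF.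
Qed.

End mean_attenuation_pgfl.

Section laplace_numerator.
Context (R : realType) (lam : R) (dK : measure_display) (OmegaK : measurableType dK).
Variables (PK : probability OmegaK R) (K : blockages R OmegaK).
Hypothesis mcenter : forall i, measurable_fun setT (Defs.center K i).
Hypothesis mlen : forall i, measurable_fun setT (len K i).
Hypothesis morient : forall i, measurable_fun setT (orientation K i).
Variables (ell : link_type -> R -> R) (s v : link_type) (r : R).
Hypothesis lam_gt0 : (0 < lam)%R.
Hypothesis hell : path_loss ell.
Context d (Omega : measurableType d) (P : probability Omega R).
Variables (phi : R) (N : network R Omega) (p : link_type -> R -> R).
Hypothesis p_gt0 : (0 < p s r)%R.
Hypothesis hN : first_order_model P lam p (p_joint PK K) r phi N.
Variable z : R.
Hypothesis z_ge0 : (0 <= z)%R.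

Local Notation X := (bs_position phi N).
Local Notation D0 := (bs_type0 N @^-1` [set s]).
Local Notation f := (attenuation ell r z s v).
Local Notation g := (mean_attenuation PK K ell (p s r) r phi z s v).

Let mX := measurable_bs_position hN.
Let radiusX := radius_bs_position hN.

Let network_events : set (set Omega) :=
  [set bs_type0 N @^-1` [set u] | u in [set: link_type]]
    `|` position_events X `|` type_events (bs_type N).

Let Og := g_sigma_algebraType network_events.

Let network_events_measurable : <<s network_events >> `<=` measurable.
Proof.
apply: smallest_sub; first exact: sigma_algebra_measurable.
move=> A [[[u _ <-]|[i [B [mB ->]]]]|[i [u ->]]].
- exact: (measurable_type0 hN).
- by rewrite -[X in measurable X]setTI; exact: mX.
- exact: (measurable_type hN).
Qed.

Let mXg i : measurable_fun setT (X i : Og -> R * R).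
Proof.
move=> _ B mB; rewrite setTI; apply: sub_sigma_algebra.
by left; right; exists i, B.
Qed.

Let mTg i u : measurable (bs_type N i @^-1` [set u] : set Og).
Proof. by apply: sub_sigma_algebra; right; exists i, u. Qed.

Let mD0g : measurable (D0 : set Og).
Proof. by apply: sub_sigma_algebra; left; left; exists s. Qed.

(** Testing only the first [n] BSs matches the number of factors in the products; the serving event
    is the intersection over [n]. *)
Let reached n : set Omega :=
  D0 `&` [set w | forall i, (i < n)%N -> outside ell r s (bs_type N i w) (bs_dist N i w)].

Let mreachedg n : measurable (reached n : set Og).
Proof.
apply: measurableI => //.
rewrite [X in measurable X](_ : _ = \bigcap_(i in `I_n)
   \bigcup_(u in [set: link_type])
     (bs_type N i @^-1` [set u] `&`
      (fun w => radius (X i w)) @^-1` outside ell r s u)).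
  apply: bigcap_measurableType => i _.
  rewrite (_ : [set: link_type] = [set LoS] `|` [set NLoS]); last first.
    by apply/seteqP; split => // -[] _; [left|right].
  rewrite bigcup_setU !bigcup_set1; apply: measurableU; apply: measurableI;
    try exact: mTg.
    rewrite -[X in measurable X]setTI.
    exact: (measurableT_comp (@measurable_radius R) (mXg i)) measurableT _
      (measurable_outside _ _ _ _).
  rewrite -[X in measurable X]setTI.
  exact: (measurableT_comp (@measurable_radius R) (mXg i)) measurableT _
    (measurable_outside _ _ _ _).
apply/seteqP; split => [w rw i /= ilt|w rw i ilt].
  by exists (bs_type N i w) => //; split => //=; rewrite radiusX; exact: rw.
by have [u _ [/= uE]] := rw i ilt; rewrite radiusX uE.
Qed.

Let mreached n : measurable (reached n).
Proof. exact: network_events_measurable (mreachedg n). Qed.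

(** Coefficient of the fading [j] in the exponent. It is zero for a BS of the other type, whose
    factor is then 1, so all indices have a factor of the same form. *)
Let W n (j : 'I_n) (w : Omega) : R :=
  (z * loss ell v (radius (X j w)) * \1_(bs_type N j @^-1` [set v]) w)%R.

Let W_ge0 n (j : 'I_n) w : (0 <= W j w)%R.
Proof. by rewrite /W !mulr_ge0// loss_ge0. Qed.

Let GW n (j : 'I_n) (B : set R) : measurable B -> <<s network_events >> (W j @^-1` B).
Proof.
move=> mB; rewrite -[_ @^-1` _]setTI.
have mW : measurable_fun setT (W j : Og -> R).
  apply: measurable_funM; last exact: (measurable_indic (mTg j v)).
  apply: measurable_funM => //.
  apply: (measurableT_comp (measurable_loss hell v)).
  exact: (measurableT_comp (@measurable_radius R) (mXg j)).
exact: mW measurableT B mB.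
Qed.

(** The absolute values keep the kernel in [0, 1] for all real arguments. *)
Let kernel (x : R * measurableTypeR R) : R := expR (- (`|x.2| * `|x.1|)).

Let fading_step n :
  \int[P]_(w in reached n)
    (\prod_(j < n) expR (- (`|bs_fading N j w| * `|W j w|)))%R%:E =
  \int[P]_(w in reached n) (\prod_(j < n) (1 + `|W j w|)^-1)%R%:E.
Proof.
have [nu nuE] := ex_exponential_prob R.
have mkernel : measurable_fun setT kernel.
  apply: measurableT_comp; first exact: measurable_expR.
  apply: measurable_funN; apply: measurable_funM.
    apply: measurableT_comp; first exact: normr_measurable.
    exact: (@measurable_snd _ _ R (measurableTypeR R)).
  apply: measurableT_comp; first exact: normr_measurable.
  exact: (@measurable_fst _ _ R (measurableTypeR R)).
have kernel01 x : (0 <= kernel x <= 1)%R.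
  by rewrite /kernel expR_ge0/= expR_le1 oppr_le0 mulr_ge0.
have mmean : measurable_fun setT (fun x : R => (1 + `|x|)^-1)%R.
  apply: continuous_measurable_fun => x.
  have n1 : (1 + `|x| != 0)%R by rewrite gt_eqF.
  have c1 : {for x, continuous (fun y : R => 1 + `|y| : R)%R}.
    by apply: cvgD; [exact: cvg_cst|exact: norm_continuous].
  have h := @continuousV R R _ x n1 c1.
  exact: h.
have mean01 (x : R) : (0 <= (1 + `|x|)^-1 <= 1)%R.
  by rewrite invr_ge0 ltW//= invf_le1// lerDl.
have meanE (x : R) : \int[nu]_h (kernel (x, h))%:E = ((1 + `|x|)^-1)%:E.
  by apply: exponential_laplace => B _; exact: nuE.
have GI : setI_closed <<s network_events >>.
  move=> A B mA mB.
  exact: (@measurableI _ Og A B mA mB).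
have mH (j : 'I_n) : measurable_fun setT (bs_fading N j : Omega -> measurableTypeR R).
  exact: (measurable_fading hN).
have indep (B : 'I_n -> set (measurableTypeR R)) A : <<s network_events >> A ->
    (forall j, measurable (B j)) ->
    P (A `&` [set w | forall j, B j (bs_fading N j w)]) = P A * \prod_j nu (B j).
  move=> GA mB; rewrite (bs_fading_law hN)//; congr (_ * _).
  by apply: eq_bigr => j _; rewrite nuE.
exact: (integral_prod_marks network_events_measurable GI mH (@GW n) indep mkernel
  kernel01 mmean mean01 meanE (mreachedg n)).
Qed.

Let attenuationE w n : D0 w ->
  (\prod_(j < n) f (bs_type N j w) (X j w) =
   \1_(reached n) w * \prod_(j < n) (1 + `|W j w|)^-1)%R.
Proof.
move=> Dw; rewrite indicE; case: (boolP (w \in reached n)) => [|].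
  rewrite inE => -[_ rw]; rewrite mul1r; apply: eq_bigr => j _.
  rewrite /attenuation indicE radiusX mem_set ?mul1r; last exact: rw.
  rewrite ger0_norm// /W indicE.
  case: asboolP => [Tv|Tv]; first by rewrite mem_set ?mulr1 ?radiusX.
  by rewrite memNset ?mulr0 ?addr0 ?invr1.
rewrite notin_setE => nr; rewrite mul0r.
have [i [ilt ni]] : exists i, (i < n)%N /\
    ~ outside ell r s (bs_type N i w) (bs_dist N i w).
  apply: contrapT => h; apply: nr; split => // i ilt.
  by apply: contrapT => no; apply: h; exists i.
rewrite (bigD1 (Ordinal ilt))//= /attenuation indicE radiusX memNset//.
by rewrite !mul0r.
Qed.

Let mfading_prod n : measurable_fun setT
  (fun w => \prod_(j < n) expR (- (`|bs_fading N j w| * `|W j w|)))%R.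
Proof.
apply: measurable_prod => j _; apply: measurableT_comp; first exact: measurable_expR.
apply: measurable_funN; apply: measurable_funM.
  apply: measurableT_comp; first exact: normr_measurable.
  exact: (measurable_fading hN).
apply: measurableT_comp; first exact: normr_measurable.
by move=> _ B mB; rewrite setTI; apply: network_events_measurable; exact: GW.
Qed.

Lemma cvg_fading_prod :
  \int[P]_(w in reached n)
    (\prod_(j < n) expR (- (`|bs_fading N j w| * `|W j w|)))%R%:E @[n --> \oo] -->
  P D0 * expeR (- (lam%:E * \int[area]_x (1 - g x)%:E)).
Proof.
rewrite [X in X @ _](_ : _ = fun n =>
    \int[P]_(w in D0) (\prod_(j < n) f (bs_type N j w) (X j w))%R%:E).
  exact: (cvg_prod_attenuation mcenter mlen morient lam_gt0 hell p_gt0 hN (v := v) z_ge0).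
apply/funext => n; rewrite fading_step; apply: esym.
rewrite [RHS]integral_mkcond [LHS]integral_mkcond; apply: eq_integral => w _.
rewrite /patch; case: ifPn => [|nD]; last first.
  case: ifPn => //; rewrite inE => -[Dw _]; case/negP: nD; exact: mem_set.
rewrite inE => Dw; rewrite attenuationE// indicE.
by case: ifP => _; rewrite ?mul1r ?mul0r.
Qed.

(* Absolute values make the series nonnegative everywhere; some fading is negative
   only on a null event. *)
Let interference_abs w : \bar R :=
  \sum_(0 <= i <oo | `[< bs_type N i w = v >])
    (`|bs_fading N i w| * ell v (bs_dist N i w))%:E.

Let log_attenuation w n : R := (\sum_(j < n) `|bs_fading N j w| * `|W j w|)%R.

Let cvg_log_attenuation w :
  (log_attenuation w n)%:E @[n --> \oo] --> z%:E * interference_abs w.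
Proof.
have ell0 i : (0 <= ell v (bs_dist N i w))%R.
  by apply: (path_loss_ge0 hell); exact: (dist_ge0 hN).
have -> : (fun n => (log_attenuation w n)%:E) = (fun n =>
    z%:E * \sum_(0 <= i < n | `[< bs_type N i w = v >])
      (`|bs_fading N i w| * ell v (bs_dist N i w))%:E).
  apply/funext => n; rewrite /log_attenuation sumEFin -EFinM; congr EFin.
  rewrite [in RHS]big_mkcond big_mkord mulr_sumr; apply: eq_bigr => j _.
  rewrite (ger0_norm (W_ge0 j w)) /W indicE radiusX loss_nonneg ?(dist_ge0 hN)//.
  case: asboolP => [Tv|Tv]; first by rewrite mem_set// mulr1; ring.
  by rewrite memNset// !mulr0.
apply: cvgeZl => //; apply: is_cvg_nneseries_cond => i _ _.
by rewrite lee_fin mulr_ge0.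
Qed.

Let serving := serving_event ell r s N.

Let servingE : serving = \bigcap_n reached n.
Proof.
apply/seteqP; split => w.
  by move=> [Dw sw] n _; split => // i _; exact: sw.
move=> rw; split; first by have [] := rw 0%N Logic.I.
by move=> i u <-; have [_] := rw i.+1 Logic.I; apply.
Qed.

Lemma measurable_serving_event : measurable (serving_event ell r s N).
Proof. by rewrite -/serving servingE; apply: bigcapT_measurable. Qed.

Let laplace_abs w : R := (\1_serving w * fine (expeR (- (z%:E * interference_abs w))))%R.

Let interference_abs_ge0 w : 0 <= interference_abs w.
Proof.
apply: nneseries_ge0 => i _ _; rewrite lee_fin mulr_ge0//.
by apply: (path_loss_ge0 hell); exact: (dist_ge0 hN).
Qed.

Let expeR_fin w : expeR (- (z%:E * interference_abs w)) \is a fin_num.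
Proof.
have : 0 <= z%:E * interference_abs w by rewrite mule_ge0.
by case: (z%:E * interference_abs w).
Qed.

(** On the serving event these are exponentials of the partial sums of the interference. Off it some
    [reached n0] fails, and as these events decrease the sequence is eventually 0. *)
Let cvg_laplace_abs w :
  (\1_(reached n) w *
    \prod_(j < n) expR (- (`|bs_fading N j w| * `|W j w|)))%R @[n --> \oo] -->
  laplace_abs w.
Proof.
rewrite /laplace_abs.
have [|] := boolP (w \in serving).
  rewrite inE servingE => sw.
  have -> : (fun n => \1_(reached n) w *
      \prod_(j < n) expR (- (`|bs_fading N j w| * `|W j w|)))%R =
      (fun n => expR (- log_attenuation w n)).
    apply/funext => n; rewrite indicE mem_set ?mul1r; last exact: sw.
    by rewrite /log_attenuation -sumrN expR_sum.
  rewrite indicE mem_set ?mul1r; last by move: sw; rewrite -servingE.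
  have log0 n : (0 <= log_attenuation w n)%R.
    by apply: sumr_ge0 => j _; rewrite mulr_ge0.
  have := cvg_expeRN (@cvg_log_attenuation w) log0.
  by rewrite -[X in _ --> X](fineK (expeR_fin w)) => /fine_cvg.
rewrite notin_setE => ns.
have [n0 nr] : exists n0, ~ reached n0 w.
  apply: contrapT => h; apply: ns; rewrite servingE => n _.
  by apply: contrapT => nr; apply: h; exists n.
rewrite indicE memNset// mul0r.
apply: cvg_near_cst.
near=> n.
rewrite indicE memNset ?mul0r// => -[Dw rw]; apply: nr; split => // i ilt.
apply: rw; apply: leq_trans ilt _; near: n; exact: nbhs_infty_ge.
Unshelve. all: by end_near. Qed.

(** One sequence of integrals has two limits: the left side by dominated convergence, the right side
    by [cvg_fading_prod]. *)
Lemma laplace_numerator_abs :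
  \int[P]_(w in serving) expeR (- (z%:E * interference_abs w)) =
  P D0 * expeR (- (lam%:E * \int[area]_x (1 - g x)%:E)).
Proof.
have lim1 := cvg_fading_prod.
have f01 n w : (0 <= \1_(reached n) w *
    \prod_(j < n) expR (- (`|bs_fading N j w| * `|W j w|)) <= 1)%R.
  have p1 : (\prod_(j < n) expR (- (`|bs_fading N j w| * `|W j w|)) <= 1)%R.
    by apply: prodr_ile1 => j _; rewrite expR_ge0 expR_le1 oppr_le0 mulr_ge0.
  have p0 : (0 <= \prod_(j < n) expR (- (`|bs_fading N j w| * `|W j w|)))%R.
    by apply: prodr_ge0 => j _; exact: expR_ge0.
  by rewrite indicE; case: (_ \in _); rewrite ?mul1r ?mul0r ?p0 ?p1 ?lexx ?ler01.
have mF n : measurable_fun setT (fun w => \1_(reached n) w *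
    \prod_(j < n) expR (- (`|bs_fading N j w| * `|W j w|)))%R.
  by apply: measurable_funM; [exact: measurable_indic|exact: mfading_prod].
have Poo : P setT < +oo by rewrite ltey_eq fin_num_measure.
have lim2 := bounded_cvg_integral Poo mF f01 cvg_laplace_abs.
have E1 : \int[P]_w (laplace_abs w)%:E =
    \int[P]_(w in serving) expeR (- (z%:E * interference_abs w)).
  rewrite [RHS]integral_mkcond; apply: eq_integral => w _.
  rewrite /laplace_abs /patch indicE; case: ifP => _; last by rewrite mul0r.
  by rewrite mul1r fineK.
rewrite -E1; apply: (cvg_unique _ _ lim1) => //.
have -> : (fun n => \int[P]_(w in reached n)
    (\prod_(j < n) expR (- (`|bs_fading N j w| * `|W j w|)))%R%:E) =
  (fun n => \int[P]_w (\1_(reached n) w *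
    \prod_(j < n) expR (- (`|bs_fading N j w| * `|W j w|)))%R%:E).
  apply/funext => n; rewrite [LHS]integral_mkcond; apply: eq_integral => w _.
  by rewrite /patch indicE; case: ifP => _; rewrite ?mul1r ?mul0r.
exact: lim2.
Qed.

Let negative_fading : set Omega := \bigcup_i (bs_fading N i @^-1` `]-oo, 0%R[).

Let mnegative i : measurable (bs_fading N i @^-1` `]-oo, 0%R[).
Proof.
rewrite -[X in measurable X]setTI.
by apply: (measurable_fading hN) => //; exact: measurable_itv.
Qed.

Let negative_fading0 : P negative_fading = 0.
Proof.
have null i : P (bs_fading N i @^-1` `]-oo, 0%R[) = 0.
  have [nu nuE] := ex_exponential_prob R.
  (* The fading law concerns initial segments of indices, so index [i] is reached through the first
     [i.+1] fadings, the earlier ones being unconstrained. *)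
  pose B (j : 'I_i.+1) : set R := if (j : nat) == i then `]-oo, 0%R[%classic else setT.
  have mB j : measurable (B j).
    by rewrite /B; case: ifP => // _; exact: measurable_itv.
  have GT : <<s network_events >> setT by exact: (@measurableT _ Og).
  have := bs_fading_law hN GT mB; rewrite setTI.
  rewrite (_ : [set w | _] = bs_fading N i @^-1` `]-oo, 0%R[); last first.
    apply/seteqP; split => w /=.
      by move=> /(_ ord_max); rewrite /B/= eqxx.
    by move=> wi j; rewrite /B; case: eqP => // ->.
  move=> ->; rewrite (bigD1 ord_max)//= /B/= eqxx.
  rewrite /exponential_prob integral0_eq ?mul0e ?mule0// => x /=.
  by rewrite in_itv/= => x0; rewrite lt0_exponential_pdf.
apply/eqP; rewrite eq_le measure_ge0 andbT.
have mU : measurable negative_fading by apply: bigcup_measurable.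
have := @measure_sigma_subadditive _ _ _ P _ _ mnegative mU (@subset_refl _ _).
by rewrite eseries0// => i _ _; exact: null.
Qed.

Lemma laplace_numerator :
  \int[P]_(w in serving_event ell r s N) expeR (- (z%:E * interference ell v N w)) =
  P D0 * expeR (- (lam%:E * \int[area]_x (1 - g x)%:E)).
Proof.
rewrite -laplace_numerator_abs.
apply: (@ge0_integral_eq_off_null _ _ _ _ _ negative_fading) => //.
- by apply: bigcup_measurable.
- by move=> w; exact: expeR_ge0.
- by move=> w; exact: expeR_ge0.
move=> w nw; congr (expeR (- (_ * _))); apply: eq_eseriesr => i _.
rewrite ger0_norm// leNgt; apply/negP => wi; apply: nw.
by exists i => //=; rewrite in_itv.
Qed.

End laplace_numerator.

(** * The quotient of the Laplace functionals and its polar form *)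

Section interference_laplace.
Context (R : realType) (lam mu : R) (nuL : probability (measurableTypeR R) R).
Context (dK : measure_display) (OmegaK : measurableType dK).
Variables (PK : probability OmegaK R) (K : blockages R OmegaK).
Variables (ell : link_type -> R -> R) (s v : link_type) (r z : R).
Context d (Omega : measurableType d) (P : probability Omega R).
Variables (phi : R) (N : network R Omega).
Hypothesis lam_gt0 : (0 < lam)%R.
Hypothesis mu_gt0 : (0 < mu)%R.
Hypothesis hL : length_law nuL.
Hypothesis hK : boolean_model PK mu nuL K.
Hypothesis hell : path_loss ell.
Hypothesis r_gt0 : (0 < r)%R.
Hypothesis z_ge0 : (0 <= z)%R.
Let p := p_single (beta mu nuL).
Hypothesis hN : first_order_model P lam p (p_joint PK K) r phi N.

Let p1 := p s r.
Local Notation q := (type_weight PK K p1 r phi s).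
Local Notation g z := (mean_attenuation PK K ell p1 r phi z s v).

Let mcenter := measurable_center hK.
Let mlen := measurable_len hK.
Let morient := measurable_orientation hK.

Let p1_gt0 : (0 < p1)%R.
Proof. exact: p_single_gt0. Qed.

Let q_ge0 u x : (0 <= q u x)%R.
Proof. exact: type_weight_ge0. Qed.

Let sum_q x : (q LoS x + q NLoS x = 1)%R.
Proof. exact: (type_weight_sum mcenter mlen morient p1_gt0 hN). Qed.

Let mq u : measurable_fun setT (q u).
Proof. exact: measurable_type_weight. Qed.

Let mg z' : (0 <= z')%R -> measurable_fun setT (g z').
Proof. by move=> z0; exact: measurable_mean_attenuation. Qed.

Let g01 z' x : (0 <= z')%R -> (0 <= g z' x <= 1)%R.
Proof.
by move=> z0; exact: (mean_attenuation01 mcenter mlen morient v hell p1_gt0 hN).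
Qed.

(** The drop in the factor of a [v]-type BS at distance [t] when the Laplace argument goes from 0 to
    [z], that is [1 - (1 + z l)^-1] outside the exclusion radius. *)
Definition absorption (t : R) : R :=
  (\1_(outside ell r s v) t * (z * loss ell v t / (1 + z * loss ell v t)))%R.

Let den_gt0 t : (0 < 1 + z * loss ell v t)%R.
Proof. by rewrite ltr_wpDr// mulr_ge0// loss_ge0. Qed.

Let absorption_ge0 t : (0 <= absorption t)%R.
Proof.
apply: mulr_ge0; first by rewrite indicE.
apply: divr_ge0; last exact: ltW.
by rewrite mulr_ge0// loss_ge0.
Qed.

(** Stated as a sum of nonnegative terms, so that the area integrals add without a finiteness
    condition. *)
Let mean_attenuationB x :
  (1 - g z x = (1 - g 0 x) + q v x * absorption (radius x))%R.
Proof.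
have dn0 := lt0r_neq0 (den_gt0 (radius x)).
rewrite /mean_attenuation /attenuation /absorption.
by case: v dn0 => /= dn0; do 2!case: asboolP => //= _;
  rewrite mul0r addr0 invr1; field.
Qed.

(** In the one mixed case that remains, [r] itself belongs to the set defining the infimum, because
    NLoS loss is below LoS loss at [r]. *)
Let exclusion_le u : ~ (s = NLoS /\ u = LoS) -> exclusion ell u s r <= r%:E.
Proof.
rewrite /exclusion; case: s u => -[]// h; last by case: h.
by apply: ereal_inf_lbound; exists r => //; split; [exact: ltW|
  exact: (path_loss_LoS hell (ltW r_gt0))].
Qed.

Let box : set (R * R) := `[(- r)%R, r]%classic `*` `[(- r)%R, r]%classic.

Let mbox : measurable box.
Proof. by apply: measurableX; exact: measurable_itv. Qed.

Let obstructed_le_box u x : ~ (s = NLoS /\ u = LoS) ->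
  (q u x * (1 - \1_(outside ell r s u) (radius x)) <= q u x * \1_box x)%R.
Proof.
move=> su; apply: ler_wpM2l => //.
rewrite [in X in (X <= _)%R]indicE; have [|] := boolP (_ \in outside _ _ _ _).
  by rewrite subrr indicE.
rewrite notin_setE => no; rewrite subr0 indicE mem_set//.
have rx : (radius x <= r)%R.
  rewrite leNgt; apply/negP => rx; apply: no; rewrite /outside/=.
  by apply: le_lt_trans (exclusion_le su) _; rewrite lte_fin.
have [x1 x2] := radius_le_box rx.
by split; rewrite /= in_itv/= -ler_norml.
Qed.

Let obstructed_area_lty : \int[@area R]_x (1 - g 0 x)%:E < +oo.
Proof.
have [C [k [C0 k0 decay]]] := unblocked_decay mu_gt0 hL hK.
(* [C / p1] comes from conditioning on the type of the given BS; the rate is halved because [rotate]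
   may reduce the l1 norm, by a factor of at most 2. *)
pose h (x : R * R) : R := (C / p1 * expR (- (k / 2 * (`|x.1| + `|x.2|))))%R.
have k20 : (0 < k / 2)%R by rewrite divr_gt0.
have Cp0 : (0 <= C / p1)%R by rewrite divr_ge0// ltW.
have h_ge0 x : (0 <= h x)%R by rewrite mulr_ge0// expR_ge0.
have qh x : (q LoS x <= h x)%R.
  rewrite /h mulrAC ler_pdivlMr// /type_weight divfK ?gt_eqF//.
  rewrite -lee_fin; apply: le_trans (joint_type_prob_LoS_le _ _ _ _ _ _ _) _ => //.
  apply: le_trans (decay _) _; rewrite lee_fin ler_pM2l// ler_expR lerN2.
  rewrite -mulrA ler_pM2l// mulrC; exact: rotate_norm.
have bound x : (1 - g 0 x <= \1_box x + h x)%R.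
  have -> : (1 - g 0 x = q LoS x * (1 - \1_(outside ell r s LoS) (radius x)) +
      q NLoS x * (1 - \1_(outside ell r s NLoS) (radius x)))%R.
    rewrite -[X in (X - _)%R](sum_q x) /mean_attenuation /attenuation !mul0r addr0 invr1.
    by rewrite !if_same; ring.
  have boxN : (q NLoS x * (1 - \1_(outside ell r s NLoS) (radius x)) <=
      q NLoS x * \1_box x)%R by apply: obstructed_le_box => -[].
  (* Only for [s = NLoS] can the excluded LoS region leave the box; there the LoS weight itself is
     bounded by [h]. *)
  have [sN|sL] := pselect (s = NLoS).
    have qL : (q LoS x * (1 - \1_(outside ell r s LoS) (radius x)) <= q LoS x)%R.
      by rewrite ler_piMr// gerBl indicE.
    have qN1 : (q NLoS x * \1_box x <= \1_box x)%R.
      by rewrite ler_piMl// -(sum_q x) lerDr.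
    by rewrite addrC; apply: lerD; [exact: le_trans boxN _|exact: le_trans qL (qh x)].
  have boxL : (q LoS x * (1 - \1_(outside ell r s LoS) (radius x)) <=
      q LoS x * \1_box x)%R by apply: obstructed_le_box => -[].
  apply: le_trans (lerD boxL boxN) _.
  by rewrite -mulrDl sum_q mul1r lerDl.
have mh : measurable_fun setT h.
  apply: measurable_funM => //; apply: measurableT_comp; first exact: measurable_expR.
  apply: measurable_funN; apply: measurable_funM => //.
  by apply: measurable_funD; apply: measurableT_comp => //; exact: normr_measurable.
apply: (@le_lt_trans _ _ (\int[@area R]_x ((\1_box x)%:E + (h x)%:E))).
  apply: ge0_le_integral => //.
  - by move=> x _; rewrite lee_fin subr_ge0; case/andP: (g01 x (lexx 0%R)).
  - apply/measurable_EFinP; apply: measurable_funB => //; exact: mg.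
  - apply: emeasurable_funD; apply/measurable_EFinP => //; exact: measurable_indic.
  - by move=> x _; rewrite -EFinD lee_fin.
rewrite ge0_integralD//; last 3 first.
- by apply/measurable_EFinP; exact: measurable_indic.
- by move=> x _; rewrite lee_fin.
- exact/measurable_EFinP.
apply: lte_add_pinfty.
  have itvE : lebesgue_measure `[(- r)%R, r]%classic = (r + r)%:E.
    by rewrite lebesgue_measure_itv/= lte_fin gtrN// -EFinB opprK.
  have boxE : area box = ((r + r) * (r + r))%:E.
    by rewrite areaX; [rewrite !itvE|exact: measurable_itv|exact: measurable_itv].
  rewrite integral_indic// setIT; change (area box < +oo).
  by rewrite boxE; exact: ltry.
rewrite /h; under eq_integral do rewrite EFinM.
rewrite ge0_integralZl_EFin//.
- by rewrite lte_mul_pinfty// integral_area_expR_norm_lty.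
- apply/measurable_EFinP; apply: measurableT_comp; first exact: measurable_expR.
  apply: measurable_funN; apply: measurable_funM => //.
  by apply: measurable_funD; apply: measurableT_comp => //; exact: normr_measurable.
Qed.

Let mabsorption : measurable_fun setT absorption.
Proof.
apply: measurable_funM; first exact: (measurable_indic (measurable_outside _ _ _ _)).
have ml := measurable_loss hell v.
have mzl : measurable_fun setT (fun t => z * loss ell v t)%R by exact: measurable_funM.
apply: measurable_funM => //.
apply: nondecreasing_measurable => // x y xy.
rewrite lef_pV2 ?posrE ?den_gt0// lerD2l; apply: ler_wpM2l => //.
exact: loss_noninc.
Qed.

Let absorbed x := (q v x * absorption (radius x))%R.

Let mabsorbed : measurable_fun setT absorbed.
Proof.
apply: measurable_funM => //.
exact: (measurableT_comp mabsorption (@measurable_radius R)).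
Qed.

Let absorbed_ge0 x : (0 <= absorbed x)%R.
Proof. exact: mulr_ge0. Qed.

Lemma cond_laplace_area :
  cond_laplace P ell r s v N z =
  expeR (- (lam%:E * \int[area]_x (q v x * absorption (radius x))%:E)).
Proof.
rewrite /cond_laplace /cond_expectation.
rewrite (laplace_numerator mcenter mlen morient v lam_gt0 hell p1_gt0 hN z_ge0).
have D := laplace_numerator mcenter mlen morient v lam_gt0 hell p1_gt0 hN (lexx 0%R).
have mS := measurable_serving_event ell s hN.
(* At [z = 0] the integrand is 1 even where the interference is infinite, by the convention
   [0 * +oo = 0]. *)
have PS : P (serving_event ell r s N) =
    p1%:E * expeR (- (lam%:E * \int[area]_x (1 - g 0 x)%:E)).
  rewrite -(type0_law hN) -D; under eq_integral do rewrite mul0e oppe0 expeR0.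
  by rewrite integral_cst// mul1e.
rewrite PS (type0_law hN) -/p1.
have -> : \int[area]_x (1 - g z x)%:E =
    \int[area]_x (1 - g 0 x)%:E + \int[area]_x (absorbed x)%:E.
  rewrite -ge0_integralD//; last 4 first.
  - by move=> x _; rewrite lee_fin subr_ge0; case/andP: (g01 x (lexx 0%R)).
  - by apply/measurable_EFinP; apply: measurable_funB => //; exact: mg.
  - by move=> x _; rewrite lee_fin.
  - exact/measurable_EFinP.
  by apply: eq_integral => x _; rewrite mean_attenuationB EFinD.
have M0 : 0 <= \int[@area R]_x (1 - g 0 x)%:E.
  by apply: integral_ge0 => x _; rewrite lee_fin subr_ge0; case/andP: (g01 x (lexx 0%R)).
have J0 : 0 <= \int[@area R]_x (absorbed x)%:E.
  by apply: integral_ge0 => x _; rewrite lee_fin.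
have Mfin : \int[@area R]_x (1 - g 0 x)%:E \is a fin_num by rewrite ge0_fin_numE.
rewrite -/(absorbed _).
move: (\int[@area R]_x (1 - g 0 x)%:E) M0 Mfin => [M| |]// M0 _.
move: (\int[@area R]_x (absorbed x)%:E) J0 => [J| |]// J0.
  rewrite /= -!EFinM inver gt_eqF ?mulr_gt0 ?expR_gt0// -EFinM; congr EFin.
  have eM := expR_gt0 (- (lam * M)).
  rewrite mulrDr opprD expRD; field.
  by rewrite !gt_eqF.
(* Here the absorbed integral is infinite and both sides are zero. *)
by rewrite addey// gt0_muley ?lte_fin//= mule0 mul0e.
Qed.

Let outside_gt0 t : outside ell r s v t -> (0 < t)%R.
Proof.
rewrite /outside/= -lte_fin; apply: le_lt_trans.
have inf_ge0 (D : set R) : (forall y, D y -> (0 <= y)%R) ->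
    0 <= ereal_inf [set y%:E | y in D].
  by move=> D0; apply: le_ereal_inf_tmp => _ [y Dy <-]; rewrite lee_fin D0.
by case: s v => -[] /=; rewrite ?lee_fin; try exact: ltW; apply: inf_ge0 => y [].
Qed.

(** With angles counted from [phi], [rotate phi] restores the relative angle that [p_joint] expects,
    and the radial factor leaves the inner integral. Exclusion radii are nonnegative, so the domain
    of [t] lies in the positive half-line of polar radii. *)
Lemma integral_absorbed :
  \int[@area R]_x (q v x * absorption (radius x))%:E =
  (p1^-1)%:E * \int[lebesgue_measure]_(t in [set t : R | exclusion ell v s r < t%:E])
    ((z * ell v t / (1 + z * ell v t))%:E *
     (\int[lebesgue_measure]_(theta in `[0%R, (2 * pi)%R])
        (p_joint PK K s v r t theta)%:E) * t%:E).
Proof.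
pose joint x := joint_type_prob K PK s v (polar r 0) x.
have mjoint : measurable_fun setT joint by exact: measurable_joint_type_prob.
have joint_ge0 x : (0 <= joint x)%R by exact: joint_type_prob_ge0.
pose F x := (joint (rotate phi x) * absorption (radius x))%R.
have mF : measurable_fun setT F.
  apply: measurable_funM; first exact: (measurableT_comp mjoint (@measurable_rotate R phi)).
  exact: (measurableT_comp mabsorption (@measurable_radius R)).
have F0 x : (0 <= F x)%R by exact: mulr_ge0.
transitivity (\int[@area R]_x ((p1^-1)%:E * (F x)%:E)).
  apply: eq_integral => x _; rewrite -EFinM /type_weight /F; congr EFin.
  by rewrite -/(joint _); ring.
rewrite ge0_integralZl_EFin//; last 3 first.
- by move=> x _; rewrite lee_fin.
- exact/measurable_EFinP.
- by rewrite invr_ge0 ltW.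
congr (_ * _); rewrite (integral_area_polar phi)//; last exact/measurable_EFinP.
rewrite [LHS]integral_mkcond [RHS]integral_mkcond; apply: eq_integral => t _.
rewrite /patch; case: ifPn => [|tpos]; last first.
  case: ifPn => //; rewrite inE => /outside_gt0 t0; case/negP: tpos.
  by rewrite inE/= in_itv/= t0.
rewrite inE/= in_itv/= andbT => t0.
have FE a : F (polar t (phi + a)%R) = (absorption t * joint (polar t a))%R.
  by rewrite /F rotate_polar radius_polar ?ltW// mulrC.
under eq_integral do rewrite FE EFinM.
rewrite ge0_integralZl_EFin//; last 2 first.
- by move=> a _; rewrite lee_fin.
- apply/measurable_EFinP; apply: measurable_funTS.
  exact: (measurableT_comp mjoint (measurable_polar_angle t)).
rewrite /absorption indicE; case: ifPn => [|] ot.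
  by rewrite mul1r loss_nonneg ?ltW.
by rewrite mul0r !mul0e.
Qed.

End interference_laplace.

Theorem theorem4 (R : realType) (lam mu : R)
    (lam_gt0 : (0 < lam)%R) (mu_gt0 : (0 < mu)%R)
    (nuL : probability (measurableTypeR R) R) (hL : length_law nuL)
    (dK : measure_display) (OmegaK : measurableType dK)
    (PK : probability OmegaK R) (K : blockages R OmegaK)
    (hK : boolean_model PK mu nuL K)
    (ell : link_type -> R -> R) (hell : path_loss ell)
    (s v : link_type) (r z : R) (r_gt0 : (0 < r)%R) (z_gt0 : (0 < z)%R)
    (d : measure_display) (Omega : measurableType d)
    (P : probability Omega R) (phi : R) (N : network R Omega)
    (hN : first_order_model P lam (p_single (beta mu nuL)) (p_joint PK K)
            r phi N) :
  cond_laplace P ell r s v N z =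
  expeR (- ((lam / p_single (beta mu nuL) s r)%:E *
    \int[lebesgue_measure]_(t in [set t : R | exclusion ell v s r < t%:E])
      ((z * ell v t / (1 + z * ell v t))%:E *
       (\int[lebesgue_measure]_(theta in `[0%R, (2 * pi)%R])
          (p_joint PK K s v r t theta)%:E) *
       t%:E))).
Proof.
rewrite (cond_laplace_area s v lam_gt0 mu_gt0 hL hK hell r_gt0 (ltW z_gt0) hN).
rewrite (integral_absorbed s v phi mu_gt0 hL hK hell r_gt0 (ltW z_gt0)).
by rewrite muleA -EFinM.
Qed.
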